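(* Let $T>0$ and let $u\in C^{1,2}\left((0,T]\times\overline{\mathbb{R}^{N+1}_+}\right)\cap C\left([0,T]\times\overline{\mathbb{R}^{N+1}_+}\right)$, $u\ge 0$, satisfy $$\partial_t u=\mathcal L u \ \text{ in } (0,T]\times \overline{\mathbb{R}^{N+1}_+},\qquad u(0,z)=0 \ \text{ for } z\in\overline{\mathbb{R}^{N+1}_+},$$ together with the Neumann boundary condition $\lim_{y\to 0^+}y^cD_yu(t,x,y)=0$ for all $t\in(0,T]$, $x\in\mathbb{R}^N$. Then $u=0$ in $[0,T]\times\overline{\mathbb{R}^{N+1}_+}$.
   Context: $N\ge 0$ is an integer, $\mathbb{R}^{N+1}_+=\{z=(x,y):x\in\mathbb{R}^N,\ y>0\}$ and $\overline{\mathbb{R}^{N+1}_+}=\{y\ge 0\}$. Let $c\in\mathbb{R}$ with $c+1>0$ and $a\in\mathbb{R}^N$ with $|a|<1$, and set $$\mathcal L=\Delta_x+2a\cdot\nabla_xD_y+D_{yy}+\frac{c}{y}D_y .$$ $C^{1,2}(I\times\overline{\mathbb{R}^{N+1}_+})$, for an interval $I$, is the set of functions $u(t,z)$ such that $u$, $\partial_tu$ and all first and second order derivatives of $u$ in $z$ exist and are continuous on $I\times\overline{\mathbb{R}^{N+1}_+}$ (up to $y=0$). At $y=0$, $\mathcal L u$ is understood as the limit as $y\to0^+$. *)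

(* Defs.v *)
From HB Require Import structures.
From mathcomp Require Import all_boot all_order all_algebra.
From mathcomp Require Import all_classical all_reals all_analysis.

Set Implicit Arguments.
Unset Strict Implicit.
Unset Printing Implicit Defensive.

Import Order.TTheory GRing.Theory Num.Theory.
Import numFieldNormedType.Exports.

Local Open Scope classical_set_scope.
Local Open Scope ring_scope.

(* The norm `|a| that the library puts on 'rV[R]_N is the sup norm. *)
Definition enorm (R : realType) (N : nat) (a : 'rV[R]_N) : R :=
  Num.sqrt (\sum_(i < N) a ord0 i ^+ 2).

(* I x {y >= 0}; points are p = (t, x, y): t = p.1.1, x = p.1.2, y = p.2. *)
Definition cyl (R : realType) (N : nat) (I : set R) :
    set (R * 'rV[R]_N * R) :=
  [set p | I p.1.1 /\ 0 <= p.2].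

Section RelativeDerivatives.
Context (R : realType) (N : nat).
Implicit Types (Q : set (R * 'rV[R]_N * R)) (u : R * 'rV[R]_N * R -> R).
Implicit Types (p v : R * 'rV[R]_N * R).

(* Directional derivatives of a function defined on Q: the increments h are  *)
(* restricted by p + h v \in Q, so the derivative is one-sided at y = 0 and  *)
(* at an endpoint of the time interval, and two-sided at interior points.    *)
Definition dquot_at Q u v p : set_system R :=
  h^-1 * (u (p + h *: v) - u p)
    @[h --> within [set h : R | Q (p + h *: v)] 0^'].

Definition derivable_in Q u v p : Prop := cvg (dquot_at Q u v p).

Definition D_in Q v u p : R := lim (dquot_at Q u v p).

Definition dir_t : R * 'rV[R]_N * R := (1, 0, 0).
Definition dir_x (i : 'I_N) : R * 'rV[R]_N * R := (0, delta_mx ord0 i, 0).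
Definition dir_y : R * 'rV[R]_N * R := (0, 0, 1).

(* [Some i] is the direction x_i and [None] the direction y. *)
Definition dir_z (k : option 'I_N) : R * 'rV[R]_N * R :=
  if k is Some i then dir_x i else dir_y.

Definition has_cont_deriv Q v u : Prop :=
  (forall p, Q p -> derivable_in Q u v p) /\ {within Q, continuous (D_in Q v u)}.

(* C^{1,2}(I x {y >= 0}) *)
Definition C12 (I : set R) u : Prop :=
  let Q := cyl I in
  [/\ {within Q, continuous u},
      has_cont_deriv Q dir_t u,
      (forall k, has_cont_deriv Q (dir_z k) u) &
      (forall k l, has_cont_deriv Q (dir_z k) (D_in Q (dir_z l) u))].

Definition Lop (c : R) (a : 'rV[R]_N) Q u p : R :=
  \sum_(i < N) D_in Q (dir_x i) (D_in Q (dir_x i) u) p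
  + 2 * (\sum_(i < N) a ord0 i * D_in Q (dir_x i) (D_in Q dir_y u) p)
  + D_in Q dir_y (D_in Q dir_y u) p
  + c / p.2 * D_in Q dir_y u p.

(* [Lop] is the operator only for y > 0; at y = 0 its value is the limit     *)
(* as y -> 0+.                                                               *)
Definition solves_parabolic (c : R) (a : 'rV[R]_N) (I : set R) u : Prop :=
  let Q := cyl I in
  forall t x, I t ->
    (forall y : R, 0 < y -> D_in Q dir_t u (t, x, y) = Lop c a Q u (t, x, y)) /\
    Lop c a Q u (t, x, y) @[y --> 0^'+] --> D_in Q dir_t u (t, x, 0).

Definition neumann (c : R) (I : set R) u : Prop :=
  forall t x, I t ->
    y `^ c * D_in (cyl I) dir_y u (t, x, y) @[y --> 0^'+] --> (0 : R).

End RelativeDerivatives.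

(* Main.v *)
(** Widder's argument, carried out with barriers and the maximum principle only.
    Extended by 0 to negative times, u remains a solution, and so are finite sums
    of its translates in t and x. Let w be a Riemann sum of u over a space-time
    box. Since the sum over a box is at most the sum over any larger box, a large
    value of the small-box sum at (t, x, y) makes the large-box sum w large on the
    whole slice {|x' - x| <= 1/4} x {y}, at all later times. A slice has
    codimension one, so explicit subsolutions spread this lower bound first to a
    ball and then, along a chain of balls staying away from y = 0, to the point
    (T, 0, 1) with a loss exp(- C (|x|^2 + y^2)) min(1, y)^m. As w is bounded at
    that point, the small-box sums grow at most like
    exp(C (|x|^2 + y^2)) min(1, y)^-m. A supersolution in a thin cap, using the
    Neumann condition, removes the singularity at y = 0, and the Tychonoff
    comparison with Gaussian barriers then shows that the sums tend to 0 on short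
    time intervals, which are iterated. Hence u = 0. *)

Require Import Defs.
From mathcomp Require Import all_boot all_order all_algebra.
From mathcomp Require Import all_classical all_reals all_analysis.
From mathcomp Require Import ring lra zify.

Set Implicit Arguments.
Unset Strict Implicit.
Unset Printing Implicit Defensive.

Import Order.TTheory GRing.Theory Num.Theory.
Import numFieldNormedType.Exports.

Local Open Scope classical_set_scope.
Local Open Scope ring_scope.

(** * Pointwise maximum principle *)

Section Defect.
Context (R : realType) (N : nat) (c : R) (a : 'rV[R]_N).
Notation pt := (R * 'rV[R]_N * R)%type.
Implicit Types (f g : pt -> R) (p e : pt).

(** Nothing is assumed on the growth of u, so largeness at one point has to be turned into largeness
    on a set that barriers can use; averaging does this. The Gaussian rate comes from scaling.
    Carrying a lower bound over a distance s, the radius of the ball, costs a fixed factor and a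
    time of order s^2. Covering a distance r in bounded time thus forces s of order 1/r, that is
    about r^2 steps and a factor [Lam ^+ (r ^ 2)]. Near y = 0 the ball has radius at most y/4;
    enlarging it geometrically takes about log(1/y) steps, whose losses multiply to a power of y.
    Finite sums avoid every integration, at a price: different boxes are compared only up to an
    error that is small on compact sets and for fine meshes. Hence all constants are independent of
    the mesh [n], and [n] is chosen after the radius. *)

Definition quot (n : nat) f p e (k : R) : Prop :=
  (f (p + h *: e) - f p) / h ^+ n @[h --> 0^'+] --> k.

Definition diff2 f p e (k : R) : Prop :=
  (f (p + h *: e) + f (p - h *: e) - 2 * f p) / h ^+ 2 @[h --> 0^'+] --> k.

(* Writing [ndy] for 1 - |a|^2, the principal part of the operator is the sum of
   squares [sum_i (D_i + a_i D_y)^2 + ndy * D_y^2]; [oblique i] is the direction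
   of [D_i + a_i D_y]. *)
Definition oblique (i : 'I_N) : pt := dir_x R i + a ord0 i *: dir_y R N.

Definition ndy : R := 1 - \sum_(i < N) a ord0 i ^+ 2.

(* [defect f p d] says that d = D_t f - L f at p, where every derivative is the
   limit of a difference quotient and D_t looks backwards in time, so that no
   differentiability class is needed to run the maximum principle. At y = 0 the
   condition [D_y f = 0] is built into [quot 2], and [(c / y) D_y f] becomes
   [c * D_y^2 f]. *)
Definition defect_int f p (d : R) : Prop :=
  exists (tau g k : R) (K : 'I_N -> R),
  [/\ quot 1 f p (- dir_t R N) (- tau),
      quot 1 f p (dir_y R N) g /\ quot 1 f p (- dir_y R N) (- g),
      diff2 f p (dir_y R N) k,
      forall i, diff2 f p (oblique i) (K i) &
      d = tau - (\sum_i K i + ndy * k + c / p.2 * g)].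

Definition defect_bd f p (d : R) : Prop :=
  exists (tau k : R) (K : 'I_N -> R),
  [/\ quot 1 f p (- dir_t R N) (- tau),
      quot 2 f p (dir_y R N) (k / 2),
      forall i, diff2 f p (dir_x R i) (K i) &
      d = tau - (\sum_i K i + (1 + c) * k)].

Definition defect f p d : Prop :=
  (0 < p.2 -> defect_int f p d) /\ (p.2 = 0 -> defect_bd f p d).

Lemma quotD n f g p e k l :
  quot n f p e k -> quot n g p e l -> quot n (fun q => f q + g q) p e (k + l).
Proof.
move=> fk gl; apply: cvg_trans (cvgD fk gl); apply: near_eq_cvg.
by near=> h; rewrite ?fctE /=; ring.
Unshelve. all: by end_near. Qed.

Lemma quotZ n f p e k m :
  quot n f p e k -> quot n (fun q => m * f q) p e (m * k).
Proof.
move=> fk; apply: cvg_trans (cvgM (cvg_cst m) fk); apply: near_eq_cvg.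
by near=> h; rewrite ?fctE /=; ring.
Unshelve. all: by end_near. Qed.

Lemma diff2D f g p e k l :
  diff2 f p e k -> diff2 g p e l -> diff2 (fun q => f q + g q) p e (k + l).
Proof.
move=> fk gl; apply: cvg_trans (cvgD fk gl); apply: near_eq_cvg.
by near=> h; rewrite ?fctE /=; ring.
Unshelve. all: by end_near. Qed.

Lemma diff2Z f p e k m :
  diff2 f p e k -> diff2 (fun q => m * f q) p e (m * k).
Proof.
move=> fk; apply: cvg_trans (cvgM (cvg_cst m) fk); apply: near_eq_cvg.
by near=> h; rewrite ?fctE /=; ring.
Unshelve. all: by end_near. Qed.

Lemma defectD f g p d d' :
  defect f p d -> defect g p d' -> defect (fun q => f q + g q) p (d + d').
Proof.
move=> [fi fb] [gi gb]; split=> hp.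
- have [t [s [k [K [h1 [h2 h2'] h3 h4 ->]]]]] := fi hp.
  have [t' [s' [k' [K' [g1 [g2 g2'] g3 g4 ->]]]]] := gi hp.
  exists (t + t'), (s + s'), (k + k'), (fun i => K i + K' i); split.
  + by rewrite opprD; exact: quotD.
  + by split; [exact: quotD|rewrite opprD; exact: quotD].
  + exact: diff2D.
  + by move=> i; exact: diff2D.
  + rewrite big_split /=; ring.
- have [t [k [K [h1 h3 h4 ->]]]] := fb hp.
  have [t' [k' [K' [g1 g3 g4 ->]]]] := gb hp.
  exists (t + t'), (k + k'), (fun i => K i + K' i); split.
  + by rewrite opprD; exact: quotD.
  + by rewrite mulrDl; exact: quotD.
  + by move=> i; exact: diff2D.
  + rewrite big_split /=; ring.
Qed.

Lemma defectZ f p d m : defect f p d -> defect (fun q => m * f q) p (m * d).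
Proof.
move=> [fi fb]; split=> hp.
- have [t [s [k [K [h1 [h2 h2'] h3 h4 ->]]]]] := fi hp.
  exists (m * t), (m * s), (m * k), (fun i => m * K i); split.
  + by rewrite -mulrN; exact: quotZ.
  + by split; [exact: quotZ|rewrite -mulrN; exact: quotZ].
  + exact: diff2Z.
  + by move=> i; exact: diff2Z.
  + rewrite -mulr_sumr /=; ring.
- have [t [k [K [h1 h3 h4 ->]]]] := fb hp.
  exists (m * t), (m * k), (fun i => m * K i); split.
  + by rewrite -mulrN; exact: quotZ.
  + by rewrite -mulrA; exact: quotZ.
  + by move=> i; exact: diff2Z.
  + rewrite -mulr_sumr /=; ring.
Qed.

Lemma quot_cst n m p e : quot n (fun=> m) p e 0.
Proof.
by apply: cvg_near_cst; near=> h; rewrite /= subrr mul0r.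
Unshelve. all: by end_near. Qed.

Lemma diff2_cst m p e : diff2 (fun=> m) p e 0.
Proof.
by apply: cvg_near_cst; near=> h; rewrite ?fctE /=; ring.
Unshelve. all: by end_near. Qed.

Lemma defect_cst m p : defect (fun=> m) p 0.
Proof.
split=> hp.
- exists 0, 0, 0, (fun=> 0); rewrite oppr0; split.
  + exact: quot_cst.
  + by split; exact: quot_cst.
  + exact: diff2_cst.
  + by move=> i; exact: diff2_cst.
  + by rewrite big1 // !mulr0 !addr0 subr0.
- exists 0, 0, (fun=> 0); rewrite oppr0 mul0r; split.
  + exact: quot_cst.
  + exact: quot_cst.
  + by move=> i; exact: diff2_cst.
  + by rewrite big1 // !mulr0 !addr0 subr0.
Qed.

Lemma defect_sum (I : Type) (s : seq I) (P : pred I) (F : I -> pt -> R) p :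
  (forall i, P i -> defect (F i) p 0) ->
  defect (fun q => \sum_(i <- s | P i) F i q) p 0.
Proof.
move=> hF; elim: s => [|i s ih].
  under eq_fun do rewrite big_nil; exact: defect_cst.
under eq_fun do rewrite big_cons.
by case Pi : (P i) => //; have := defectD (hF _ Pi) ih; rewrite addr0.
Qed.

(** The only variable coefficient is [c / y], so translations in t and x commute with the operator;
    the hypothesis [v.2 = 0] excludes the others. *)
Lemma defect_shift f p v d : v.2 = 0 ->
  defect f (p + v) d -> defect (fun q => f (q + v)) p d.
Proof.
move=> v0; have E : (p + v).2 = p.2 by rewrite /= v0 addr0.
have Q n e k : quot n f (p + v) e k -> quot n (fun q => f (q + v)) p e k.
  move=> fk; apply: cvg_trans fk; apply: near_eq_cvg.
  by near=> h; rewrite /= [p + v + _]addrAC.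
have D e k : diff2 f (p + v) e k -> diff2 (fun q => f (q + v)) p e k.
  move=> fk; apply: cvg_trans fk; apply: near_eq_cvg.
  by near=> h; rewrite /= [p + v + _]addrAC [p + v - _]addrAC.
move=> [fi fb]; rewrite E in fi fb; split=> hp.
- have [t [s [k [K [h1 [h2 h2'] h3 h4 ->]]]]] := fi hp.
  exists t, s, k, K; split => //; [exact: Q|by split; exact: Q|exact: D| |].
    by move=> i; exact: D.
  by rewrite E.
- have [t [k [K [h1 h3 h4 ->]]]] := fb hp.
  exists t, k, K; split => //; [exact: Q|exact: Q|].
  by move=> i; exact: D.
Unshelve. all: by end_near. Qed.

Lemma line_cvg p e : p + h *: e @[h --> (0 : R)^'+] --> p.
Proof.
apply: cvg_trans (_ : p + h *: e @[h --> (0 : R)] --> p).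
  by apply: cvg_fmap2; exact: cvg_within.
rewrite -[X in _ --> X](addr0 p) -[X in _ + X](scale0r e).
by apply: cvgD; [exact: cvg_cst|exact: cvgZl].
Qed.

Lemma near_line (P : set pt) p e :
  (\forall q \near p, P q) -> \forall h \near (0 : R)^'+, P (p + h *: e).
Proof. by move=> hP; exact: (@line_cvg p e _ hP). Qed.

Lemma quot_max_le0 n f p e k :
  (\forall h \near (0 : R)^'+, f (p + h *: e) <= f p) -> quot n f p e k -> k <= 0.
Proof.
move=> hf fk; apply: (cvgr_to_le fk); near=> h.
have h0 : 0 < h by near: h; exact: nbhs_right_gt.
by rewrite ler_pdivrMr ?exprn_gt0 // mul0r subr_le0; near: h.
Unshelve. all: by end_near. Qed.

Lemma diff2_max_le0 f p e k :
  (\forall h \near (0 : R)^'+, f (p + h *: e) <= f p) ->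
  (\forall h \near (0 : R)^'+, f (p - h *: e) <= f p) ->
  diff2 f p e k -> k <= 0.
Proof.
move=> hf hf' fk; apply: (cvgr_to_le fk); near=> h.
have h0 : 0 < h by near: h; exact: nbhs_right_gt.
rewrite ler_pdivrMr ?exprn_gt0 // mul0r subr_le0 mulr2n mulrDl mul1r.
by apply: lerD; near: h.
Unshelve. all: by end_near. Qed.

(** At a maximum over earlier times the backward time derivative is nonnegative and all second
    differences are nonpositive. For y > 0 both one-sided y-derivatives are nonpositive, so [g = 0]
    and the sign of [c] is irrelevant. At y = 0 the drift has been turned into a second derivative,
    of total weight [1 + c]. *)
Lemma defect_max_ge0 f p d : 0 <= ndy -> 0 <= 1 + c -> 0 <= p.2 ->
  (\forall q \near p, 0 <= q.2 -> q.1.1 <= p.1.1 -> f q <= f p) ->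
  defect f p d -> 0 <= d.
Proof.
move=> k0 c0 p0 hmax [fi fb].
have hline e : (\forall h \near (0 : R)^'+, 0 <= (p + h *: e).2) -> e.1.1 <= 0 ->
    \forall h \near (0 : R)^'+, f (p + h *: e) <= f p.
  move=> he e0; near=> h.
  have h0 : 0 < h by near: h; exact: nbhs_right_gt.
  apply: (near (near_line _ hmax) h) => //; first by near: h.
  by rewrite /= gerDl /GRing.scale /= pmulr_rle0.
have hlineN e : (\forall h \near (0 : R)^'+, 0 <= (p - h *: e).2) -> 0 <= e.1.1 ->
    \forall h \near (0 : R)^'+, f (p - h *: e) <= f p.
  move=> he e0; near=> h; rewrite -scalerN.
  near: h; apply: hline; last by rewrite /= oppr_le0.
  by near do rewrite scalerN.
have ht : \forall h \near (0 : R)^'+, f (p + h *: - dir_t R N) <= f p.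
  apply: hline; last by rewrite /= oppr_le0.
  by near=> h; rewrite /= oppr0 scaler0 addr0.
move: p0; rewrite le_eqVlt => /orP[/eqP/esym hp|hp].
- have [t [k [K [h1 h3 h4 ->]]]] := fb hp.
  have /(quot_max_le0 ht) t0 := h1.
  have kle : k / 2 <= 0.
    apply: quot_max_le0 h3; apply: hline => //=; near=> h.
    have h0 : 0 < h by near: h; exact: nbhs_right_gt.
    by rewrite hp add0r /GRing.scale /= mulr1 ltW.
  have Kle i : K i <= 0.
    apply: diff2_max_le0 (h4 i); [apply: hline|apply: hlineN] => //=.
      by near=> h; rewrite hp scaler0 addr0.
    by near=> h; rewrite hp scaler0 subr0.
  have Ks : \sum_i K i <= 0 by apply: sumr_le0.
  have : (1 + c) * k <= 0 by rewrite mulr_ge0_le0 //; lra.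
  by lra.
- have [t [g [k [K [h1 [h2 h2'] h3 h4 ->]]]]] := fi hp.
  have /(quot_max_le0 ht) t0 := h1.
  have pos e : \forall h \near (0 : R)^'+, 0 <= (p + h *: e).2.
    apply: (@near_line (fun q => 0 <= q.2)); near=> q; apply: ltW; near: q.
    by apply: (cvgr_gt p.2) => //; exact: cvg_snd.
  have posN e : \forall h \near (0 : R)^'+, 0 <= (p - h *: e).2.
    by near=> h; rewrite -scalerN; near: h; exact: pos.
  have g0 : g <= 0 by apply: quot_max_le0 h2; apply: hline.
  have g0' : - g <= 0.
    by apply: quot_max_le0 h2'; apply: hline; [exact: pos|rewrite /= oppr0].
  have kle : k <= 0.
    by apply: diff2_max_le0 h3; [apply: hline|apply: hlineN].
  have Kle i : K i <= 0.
    apply: diff2_max_le0 (h4 i); [apply: hline|apply: hlineN] => //;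
      by rewrite /= add0r /GRing.scale /= mulr0.
  have Ks : \sum_i K i <= 0 by apply: sumr_le0.
  have -> : g = 0 by lra.
  have : ndy * k <= 0 by rewrite mulr_ge0_le0.
  by lra.
Unshelve. all: by end_near. Qed.

End Defect.

Section Comparison.
Context (R : realType) (N : nat).
Notation pt := (R * 'rV[R]_N * R)%type.
Implicit Types (p q : pt) (x : 'rV[R]_N).

(** The parabolic boundary of [G] is never named: a point where the comparison fails must have all
    nearby earlier points with y >= 0 in [G], which rules out the initial and lateral faces. A
    maximum point of [w - phi] is such a point, and there the negative defect of [w - phi]
    contradicts the maximum principle. *)
Lemma comparison (c : R) (a : 'rV[R]_N) (G : set pt) (w phi : pt -> R) :
  0 <= ndy a -> 0 <= 1 + c ->
  compact G -> continuous w -> {within G, continuous phi} ->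
  (forall p, G p -> 0 <= p.2 /\ defect c a w p 0) ->
  (forall p, G p -> phi p < w p ->
     (\forall q \near p, 0 <= q.2 -> q.1.1 <= p.1.1 -> G q) /\
     exists2 d, 0 < d & defect c a phi p d) ->
  forall p, G p -> w p <= phi p.
Proof.
move=> k0 c0 cG cw cphi hw hphi p Gp; rewrite leNgt; apply/negP => wp.
have cf : {within G, continuous (fun q => w q + -1 * phi q)}.
  move=> q; apply: cvgD; first exact: continuous_subspaceT.
  by apply: cvgM; [exact: cvg_cst|exact: cphi].
have [|m /set_mem Gm mmax] := compact_EVT_max _ cG cf; first by exists p.
have wm : phi m < w m.
  have := mmax p (mem_set Gp); rewrite !mulN1r => h.
  by rewrite -subr_gt0; apply: lt_le_trans h; rewrite subr_gt0.
have [nG [d d0 hd]] := hphi m Gm wm.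
have [m0 hwm] := hw m Gm.
have D := defectD hwm (defectZ (-1) hd).
have := defect_max_ge0 k0 c0 m0 _ D.
suff nf : \forall q \near m, 0 <= q.2 -> q.1.1 <= m.1.1 ->
   w q + -1 * phi q <= w m + -1 * phi m by move=> /(_ nf); lra.
near=> q => q0 qt; apply: mmax; apply/mem_set.
by move: q0 qt; near: q.
Unshelve. all: by end_near. Qed.

Definition box (t0 t1 : R) x (r y0 y1 : R) : set pt :=
  [set p | [/\ t0 <= p.1.1 <= t1, `|p.1.2 - x| <= r & y0 <= p.2 <= y1]].

Lemma box_compact t0 t1 x r y0 y1 : compact (box t0 t1 x r y0 y1).
Proof.
have cx : compact [set z : 'rV[R]_N | `|z - x| <= r].
  apply: bounded_closed_compact.
    exists (r + `|x|); split; first exact: num_real.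
    move=> M rM z /= zx; rewrite -(subrK x z) ltW // (le_lt_trans (ler_normD _ _)) //.
    by apply: le_lt_trans rM; rewrite lerD2r.
  have -> : [set z : 'rV[R]_N | `|z - x| <= r] =
     (fun z => `|z - x|) @^-1` [set s : R | s <= r] by [].
  apply: closed_comp; last exact: closed_le.
  move=> z _; have : (z0 - x) @[z0 --> z] --> z - x.
    by apply: (@cvgB _ _ _ (nbhs z)); [exact: cvg_id|exact: cvg_cst].
  by move=> h; apply: (@cvg_norm _ _ _ (nbhs z) _ _ _ h).
have := compact_setX (compact_setX (@segment_compact _ t0 t1) cx)
  (@segment_compact _ y0 y1).
suff -> : box t0 t1 x r y0 y1 =
  `[t0, t1]%classic `*` [set z : 'rV[R]_N | `|z - x| <= r] `*` `[y0, y1]%classic by [].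
apply/seteqP; split=> [[[t z] y] [/= h1 h2 h3]|[[t z] y] [[/= h1 h2] h3]].
  by split; rewrite /= ?in_itv.
by move: h1 h3; rewrite !in_itv.
Qed.

Lemma near_t_gt p (t : R) : t < p.1.1 -> \forall q \near p, t <= q.1.1.
Proof.
move=> tp; near=> q; apply: ltW; near: q; apply: (cvgr_gt p.1.1) => //.
by apply: (@cvg_comp _ _ _ fst fst (nbhs p) (nbhs p.1)); exact: cvg_fst.
Unshelve. all: by end_near. Qed.

Lemma near_y_gt p (t : R) : t < p.2 -> \forall q \near p, t <= q.2.
Proof.
by move=> tp; near=> q; apply: ltW; near: q; apply: (cvgr_gt p.2) => //; exact: cvg_snd.
Unshelve. all: by end_near. Qed.

Lemma near_y_lt p (t : R) : p.2 < t -> \forall q \near p, q.2 <= t.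
Proof.
by move=> tp; near=> q; apply: ltW; near: q; apply: (cvgr_lt p.2) => //; exact: cvg_snd.
Unshelve. all: by end_near. Qed.

Lemma near_x_lt p x (r : R) : `|p.1.2 - x| < r -> \forall q \near p, `|q.1.2 - x| <= r.
Proof.
move=> tp; near=> q; apply: ltW; near: q; apply: (cvgr_lt `|p.1.2 - x|) => //.
have : (q.1.2 - x) @[q --> p] --> p.1.2 - x.
  apply: (@cvgB _ _ _ (nbhs p)); last exact: cvg_cst.
  by apply: (@cvg_comp _ _ _ fst snd (nbhs p) (nbhs p.1)); [exact: cvg_fst|exact: cvg_snd].
by move=> h; apply: (@cvg_norm _ _ _ (nbhs p) _ _ _ h).
Unshelve. all: by end_near. Qed.

(** The final time face is harmless because only earlier times are tested. A bottom face at y = 0 is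
    not a boundary either, since the Neumann condition is part of [defect]. *)
Lemma near_box t0 t1 x (r y0 y1 : R) p :
  box t0 t1 x r y0 y1 p -> t0 < p.1.1 -> `|p.1.2 - x| < r -> p.2 < y1 ->
  y0 < p.2 \/ y0 = 0 ->
  \forall q \near p, 0 <= q.2 -> q.1.1 <= p.1.1 -> box t0 t1 x r y0 y1 q.
Proof.
move=> [/andP[_ pt1] _ _] pt0 px py1 py0.
have hy : \forall q \near p, 0 <= q.2 -> y0 <= q.2.
  case: py0 => [yp|->]; last by near=> q.
  by near=> q => _; near: q; apply: near_y_gt.
near=> q => q0 qt.
split; [|by near: q; apply: near_x_lt|]; apply/andP; split.
- by near: q; apply: near_t_gt.
- exact: le_trans pt1.
- by move: q0; near: q; exact: hy.
- by near: q; apply: near_y_lt.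
Unshelve. all: by end_near. Qed.

End Comparison.

(** * Barriers *)

Section Taylor.
Context (R : realType).
Implicit Types (g dg : R -> R) (k A : R).

(** Differentiability is required only to the right of 0, so that the expansion applies at y = 0. *)
Lemma taylor2_right g dg A k :
  (\forall h \near (0 : R)^'+, is_derive (h : R) (1 : R) g (dg h)) -> g h @[h --> 0^'+] --> g 0 ->
  (dg h - A) / h @[h --> 0^'+] --> k ->
  (g h - g 0 - A * h) / h ^+ 2 @[h --> 0^'+] --> k / 2.
Proof.
move=> hg g0 hk; apply/cvgrPdist_le => e e0.
have [d /= d0 hd] : \forall h \near (0 : R)^'+, is_derive (h : R) (1 : R) g (dg h) /\
    `|k - (dg h - A) / h| <= e.
  near=> h; split; first by near: h.
  by near: h; move/cvgrPdist_le : hk; exact.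
near=> h.
have h0 : 0 < h by near: h; exact: nbhs_right_gt.
have hlt : h < d by near: h; exact: nbhs_right_lt.
have hd' s : 0 < s <= h -> is_derive s 1 g (dg s) /\ `|k - (dg s - A) / s| <= e.
  move=> /andP[s0 sh]; apply: hd => //=.
  by rewrite sub0r normrN gtr0_norm // (le_lt_trans sh).
(* The derivative of the remainder is [s * ((dg s - A) / s - k)], at most [e * s] in absolute value;
   one application of the mean value theorem then suffices. *)
pose r s := g s - A * s - k / 2 * s ^+ 2.
have [||s sh rE] := @MVT R r (fun s => dg s - A - k * s) 0 h h0.
- move=> s; rewrite in_itv /= => /andP[s0 sh].
  have [dgs _] : is_derive (s : R) (1 : R) g (dg s) /\ `|k - (dg s - A) / s| <= e by apply: hd'; rewrite s0 ltW.
  rewrite /r; apply: is_derive_eq; rewrite /GRing.scale /= ; lra.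
- apply/continuous_within_itvP => //; split.
  + move=> s; rewrite in_itv /= => /andP[s0 sh].
    have [dgs _] : is_derive (s : R) (1 : R) g (dg s) /\ `|k - (dg s - A) / s| <= e by apply: hd'; rewrite s0 ltW.
    apply: cvgB; first apply: cvgB.
    * by apply: differentiable_continuous; apply/derivable1_diffP; exact: ex_derive.
    * by apply: cvgM; [exact: cvg_cst|exact: cvg_id].
    * by apply: cvgM; [exact: cvg_cst|exact: exprn_continuous].
  + rewrite /r; apply: cvgB; first apply: cvgB => //.
    * apply: cvgM; first exact: cvg_cst; exact: cvg_within.
    * apply: cvgM; first exact: cvg_cst.
      by apply: cvg_trans (@exprn_continuous _ 2 0); apply: cvg_app; exact: cvg_within.
  + have [dgs _] : is_derive (h : R) (1 : R) g (dg h) /\ `|k - (dg h - A) / h| <= e by apply: hd'; rewrite h0 lexx.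
    apply: cvg_at_left_filter.
    apply: cvgB; first apply: cvgB.
    * by apply: differentiable_continuous; apply/derivable1_diffP; exact: ex_derive.
    * by apply: cvgM; [exact: cvg_cst|exact: cvg_id].
    * by apply: cvgM; [exact: cvg_cst|exact: exprn_continuous].
move: sh; rewrite in_itv /= => /andP[s0 sh].
have [_ ks] : is_derive (s : R) (1 : R) g (dg s) /\ `|k - (dg s - A) / s| <= e by apply: hd'; rewrite s0 ltW.
have -> : k / 2 - (g h - g 0 - A * h) / h ^+ 2 = - (r h - r 0) / h ^+ 2.
  by rewrite /r; field; rewrite gt_eqF.
rewrite rE subr0.
have -> : - ((dg s - A - k * s) * h) / h ^+ 2 = (k - (dg s - A) / s) * (s / h).
  by field; rewrite !gt_eqF.
have sh0 : 0 <= s / h by rewrite divr_ge0 // ltW.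
rewrite normrM [`|s / h|]ger0_norm //.
have := normr_ge0 (k - (dg s - A) / s) => n0.
apply: le_trans ks; rewrite -[leRHS]mulr1 ler_wpM2l // ler_pdivrMr // mul1r ltW //.
Unshelve. all: by end_near. Qed.

(** Sum of the one-sided expansions of [g] and of its reflection [g (- h)]; the first-order terms
    cancel. *)
Lemma diff2_real g dg k :
  (\forall h \near (0 : R), is_derive (h : R) (1 : R) g (dg h)) -> is_derive (0 : R) (1 : R) dg k ->
  (g h + g (- h) - 2 * g 0) / h ^+ 2 @[h --> 0^'+] --> k.
Proof.
move=> hg hk.
have lim0 (F : R -> R) : F h @[h --> 0^'] --> k -> F h @[h --> 0^'+] --> k.
  exact: cvg_dnbhs_at_right.
have limN (F : R -> R) : F h @[h --> 0^'] --> k -> F (- h) @[h --> 0^'+] --> k.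
  by move=> /cvg_dnbhs_at_left /cvg_at_leftNP; rewrite oppr0.
have dk : (dg h - dg 0) / h @[h --> 0^'] --> k.
  have /cvg_ex [l hl] := @ex_derive _ _ _ _ _ _ _ hk.
  have E := @derive_val _ _ _ _ _ _ _ hk.
  have kl : k = l by rewrite -E; exact: cvg_lim hl.
  rewrite kl; apply: cvg_trans hl; apply: near_eq_cvg; near=> h.
  by rewrite /= addr0 /GRing.scale /= mulr1 mulrC.
have g0 : is_derive (0 : R) (1 : R) g (dg 0) by exact: nbhs_singleton hg.
have cg : g h @[h --> 0] --> g 0.
  by apply: differentiable_continuous; apply/derivable1_diffP; exact: ex_derive.
have T1 : (g h - g 0 - dg 0 * h) / h ^+ 2 @[h --> 0^'+] --> k / 2.
  apply: (@taylor2_right g dg).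
  - exact: cvg_within hg.
  - by apply: cvg_trans cg; apply: cvg_app; exact: cvg_within.
  - exact: lim0.
have hgN : \forall h \near (0 : R), is_derive (h : R) (1 : R) (fun s => g (- s)) (- dg (- h)).
  have : \forall h \near (0 : R), is_derive (- h : R) (1 : R) g (dg (- h)).
    have cN : (- h) @[h --> (0 : R)] --> (0 : R).
      by rewrite -[X in _ --> X]oppr0; apply: cvgN; exact: cvg_id.
    exact: cN hg.
  apply: filterS => h hh.
  apply: is_derive_eq; rewrite ?mulrN1 //.
have T2 : (g (- h) - g (- 0) - - dg 0 * h) / h ^+ 2 @[h --> 0^'+] --> k / 2.
  apply: (@taylor2_right (fun h => g (- h)) (fun h => - dg (- h))).
  - exact: cvg_within hgN.
  - rewrite oppr0.
    have cN : (- h) @[h --> (0 : R)^'+] --> (0 : R).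
      rewrite -[X in _ --> X]oppr0; apply: cvgN; exact: cvg_within.
    exact: cvg_comp cN cg.
  - apply: cvg_trans (limN _ dk); apply: near_eq_cvg; near=> h.
    have h0 : 0 < h by near: h; exact: nbhs_right_gt.
    by field; rewrite gt_eqF.
rewrite (splitr k); apply: cvg_trans (cvgD T1 T2); apply: near_eq_cvg.
near=> h; rewrite ?fctE oppr0; lra.
Unshelve. all: by end_near. Qed.

End Taylor.

Section Barriers.
Context (R : realType) (N : nat).
Notation pt := (R * 'rV[R]_N * R)%type.
Implicit Types (p e : pt) (x : 'rV[R]_N).

Definition sqn x : R := \sum_(i < N) x ord0 i ^+ 2.

Lemma sqn_ge0 x : 0 <= sqn x.
Proof. by apply: sumr_ge0 => i _; exact: sqr_ge0. Qed.

Lemma sqn_line x i h :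
  sqn (x + h *: delta_mx ord0 i) = sqn x + 2 * x ord0 i * h + h ^+ 2.
Proof.
rewrite /sqn (bigD1 i) //= [in RHS](bigD1 i) //= !mxE !eqxx /= mulr1.
rewrite (eq_bigr (fun j => x ord0 j ^+ 2)); first by ring.
by move=> j ji; rewrite !mxE eqxx /= (negbTE ji) mulr0 addr0.
Qed.

Lemma line_derive (f : pt -> R) p e (dg : R -> R) (k : R) :
  (\forall h \near (0 : R), is_derive (h : R) (1 : R) (fun s => f (p + s *: e)) (dg h)) ->
  is_derive (0 : R) (1 : R) dg k ->
  [/\ quot 1 f p e (dg 0), diff2 f p e k & dg 0 = 0 -> quot 2 f p e (k / 2)].
Proof.
move=> hg hk.
have g0 : is_derive (0 : R) (1 : R) (fun s => f (p + s *: e)) (dg 0).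
  exact: nbhs_singleton hg.
have dlim (F : R -> R) l : is_derive (0 : R) (1 : R) F l ->
    (F h - F 0) / h @[h --> 0^'+] --> l.
  move=> hF; have /cvg_ex [l' hl] := @ex_derive _ _ _ _ _ _ _ hF.
  have E := @derive_val _ _ _ _ _ _ _ hF.
  have -> : l = l' by rewrite -E; exact: cvg_lim hl.
  apply: cvg_dnbhs_at_right; apply: cvg_trans hl; apply: near_eq_cvg; near=> h.
  by rewrite /= addr0 /GRing.scale /= mulr1 mulrC.
split.
- have := dlim _ _ g0; apply: cvg_trans; apply: near_eq_cvg; near=> h.
  by rewrite /= scale0r addr0 expr1.
- have := diff2_real hg hk; apply: cvg_trans; apply: near_eq_cvg; near=> h.
  by rewrite /= scale0r addr0 scaleNr.
- move=> dg0.
  have := @taylor2_right _ (fun s => f (p + s *: e)) dg 0 k _ _ _.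
  have cg : f (p + h *: e) @[h --> (0 : R)] --> f (p + 0 *: e).
    by apply: differentiable_continuous; apply/derivable1_diffP; exact: ex_derive.
  have h1 : \forall h \near (0 : R)^'+,
      is_derive (h : R) (1 : R) (fun s => f (p + s *: e)) (dg h) by exact: cvg_within hg.
  have h2 : f (p + h *: e) @[h --> (0 : R)^'+] --> f (p + 0 *: e).
    by apply: cvg_trans cg; apply: cvg_app; exact: cvg_within.
  have h3 : (dg h - 0) / h @[h --> (0 : R)^'+] --> k by have := dlim _ _ hk; rewrite dg0.
  move=> /(_ h1 h2 h3); apply: cvg_trans; apply: near_eq_cvg; near=> h.
  by rewrite /= scale0r addr0 mul0r subr0.
Unshelve. all: by end_near. Qed.

(** Along any line a Gaussian is the exponential of a quadratic polynomial, so all its difference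
    quotients are read off from the two coefficients [s1] and [s2]. *)
Lemma exp_line (f : pt -> R) p e (s1 s2 : R) :
  (forall h : R, f (p + h *: e) = f p * expR (s1 * h + s2 * h ^+ 2)) ->
  [/\ quot 1 f p e (f p * s1), diff2 f p e (f p * (s1 ^+ 2 + 2 * s2)) &
      s1 = 0 -> quot 2 f p e (f p * s2)].
Proof.
move=> fE.
pose dg h : R := f p * ((s1 + 2 * s2 * h) * expR (s1 * h + s2 * h ^+ 2)).
have [||h1 h2 h3] := @line_derive f p e dg (f p * (s1 ^+ 2 + 2 * s2)).
- near=> h; rewrite (_ : (fun s => _) = (fun h => f p * expR (s1 * h + s2 * h ^+ 2))).
    by apply: is_derive_eq; rewrite /dg /GRing.scale /=; ring.
  by apply/funext => s; exact: fE.
- rewrite /dg; apply: is_derive_eq.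
  by rewrite /GRing.scale /= !(mulr0, expr0n, addr0, expR0) /=; ring.
- have E0 : dg 0 = f p * s1 by rewrite /dg !(mulr0, expr0n, addr0, expR0) mulr1.
  split; [by rewrite -E0|by []|move=> s10].
  have -> : f p * s2 = f p * (s1 ^+ 2 + 2 * s2) / 2 by rewrite s10; field.
  by apply: h3; rewrite E0 s10 mulr0.
Unshelve. all: by end_near. Qed.

(** With [b0 < 0] and [b1 = ga = 0] it is the stationary bump used in [growth]; with [b1, ga > 0] it
    is the Tychonoff barrier of [gaussian_decay]. *)
Definition gauss (b0 b1 ga : R) x0 (y0 : R) : pt -> R := fun p =>
  expR ((b0 + b1 * p.1.1) * (sqn (p.1.2 - x0) + (p.2 - y0) ^+ 2) + ga * p.1.1).

(** The principal symbol |x|^2 + 2 y (a . x) + y^2, written as a sum of squares. *)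
Definition elliptic_form (a : 'rV[R]_N) x (y : R) : R :=
  \sum_(i < N) (x ord0 i + a ord0 i * y) ^+ 2 + ndy a * y ^+ 2.

(** The squared first derivatives of the exponent add up to the symbol at [(X, Y)]; its second
    derivatives give the trace, where the sum of [1 + a_i^2] plus [ndy] is N + 1. *)
Lemma gauss_defect_int (c : R) (a : 'rV[R]_N) b0 b1 ga x0 y0 p : 0 < p.2 ->
  let b := b0 + b1 * p.1.1 in
  let X := p.1.2 - x0 in let Y := p.2 - y0 in
  defect c a (gauss b0 b1 ga x0 y0) p
    (gauss b0 b1 ga x0 y0 p * (b1 * (sqn X + Y ^+ 2) + ga
       - 4 * b ^+ 2 * elliptic_form a X Y
       - 2 * b * (N%:R + 1 + c * Y / p.2))).
Proof.
case: p => -[t x] y /= y0p; set f := gauss _ _ _ _ _; set p := (t, x, y).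
set b := b0 + b1 * t; set X := x - x0; set Y := y - y0.
have ft (h : R) : f (p + h *: - dir_t R N) =
    f p * expR (- (b1 * (sqn X + Y ^+ 2) + ga) * h + 0 * h ^+ 2).
  rewrite /f /gauss /= -expRD; congr expR.
  rewrite !oppr0 !scaler0 !addr0 /GRing.scale /= -/X -/Y /b; ring.
have fy (h : R) : f (p + h *: dir_y R N) =
    f p * expR (2 * b * Y * h + b * h ^+ 2).
  rewrite /f /gauss /= -expRD; congr expR.
  rewrite !scaler0 !addr0 /GRing.scale /= -/X /Y /b; ring.
have fyN (h : R) : f (p + h *: - dir_y R N) =
    f p * expR (- (2 * b * Y) * h + b * h ^+ 2).
  rewrite /f /gauss /= -expRD; congr expR.
  rewrite !oppr0 !scaler0 !addr0 /GRing.scale /= -/X /Y /b; ring.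
have fx i (h : R) : f (p + h *: oblique a i) =
    f p * expR (2 * b * (X ord0 i + a ord0 i * Y) * h
       + b * (1 + a ord0 i ^+ 2) * h ^+ 2).
  rewrite /f /gauss /= -expRD; congr expR.
  rewrite !scaler0 !addr0 add0r [_ - x0]addrAC -/X sqn_line.
  rewrite /GRing.scale /= /Y /b; ring.
have [ht _ _] := exp_line ft.
have [hy hyy _] := exp_line fy.
have [hyN _ _] := exp_line fyN.
split=> [_|/= y0E]; last by rewrite y0E ltxx in y0p.
exists (f p * (b1 * (sqn X + Y ^+ 2) + ga)), (f p * (2 * b * Y)),
  (f p * ((2 * b * Y) ^+ 2 + 2 * b)),
  (fun i => f p * ((2 * b * (X ord0 i + a ord0 i * Y)) ^+ 2
     + 2 * (b * (1 + a ord0 i ^+ 2)))).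
split => //.
- by rewrite -mulrN.
- by split=> //; rewrite -mulrN.
- by move=> i; have [] := exp_line (fx i).
- rewrite -mulr_sumr big_split /= -mulr_sumr -mulr_sumr big_split /= sumr_const card_ord.
  rewrite (eq_bigr (fun i => 4 * b ^+ 2 * (X ord0 i + a ord0 i * Y) ^+ 2)); last first.
    by move=> i _; ring.
  rewrite -mulr_sumr /elliptic_form /ndy.
  set A := \sum_(_ < _) _; set B := \sum_(_ < _) _; field.
  by rewrite gt_eqF.
Qed.

(** The centre has [y0 = 0]: the Gaussian is then even in y and satisfies the Neumann condition
    required by [quot 2]. *)
Lemma gauss_defect_bd (c : R) (a : 'rV[R]_N) b0 b1 ga x0 p : p.2 = 0 ->
  let b := b0 + b1 * p.1.1 in
  let X := p.1.2 - x0 in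
  defect c a (gauss b0 b1 ga x0 0) p
    (gauss b0 b1 ga x0 0 p * (b1 * sqn X + ga
       - 4 * b ^+ 2 * sqn X - 2 * b * (N%:R + 1 + c))).
Proof.
case: p => -[t x] y /= ->; set f := gauss _ _ _ _ _; set p := (t, x, 0).
set b := b0 + b1 * t; set X := x - x0.
have ft (h : R) : f (p + h *: - dir_t R N) =
    f p * expR (- (b1 * sqn X + ga) * h + 0 * h ^+ 2).
  rewrite /f /gauss /= -expRD; congr expR.
  rewrite !oppr0 !scaler0 !addr0 /GRing.scale /= -/X /b; ring.
have fy (h : R) : f (p + h *: dir_y R N) =
    f p * expR (0 * h + b * h ^+ 2).
  rewrite /f /gauss /= -expRD; congr expR.
  rewrite !scaler0 !addr0 /GRing.scale /= -/X /b; ring.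
have fx i (h : R) : f (p + h *: dir_x R i) =
    f p * expR (2 * b * X ord0 i * h + b * h ^+ 2).
  rewrite /f /gauss /= -expRD; congr expR.
  rewrite !scaler0 !addr0 [_ - x0]addrAC -/X sqn_line /b; ring.
have [ht _ _] := exp_line ft.
have [_ _ /(_ erefl) hyy] := exp_line fy.
split=> [|_]; first by rewrite ltxx.
exists (f p * (b1 * sqn X + ga)), (f p * (2 * b)),
  (fun i => f p * ((2 * b * X ord0 i) ^+ 2 + 2 * b)).
split => //.
- by rewrite -mulrN.
- by rewrite (_ : _ / 2 = f p * b) //; field.
- by move=> i; have [] := exp_line (fx i).
- rewrite -mulr_sumr big_split /= sumr_const card_ord.
  rewrite (eq_bigr (fun i => 4 * b ^+ 2 * X ord0 i ^+ 2)); last by move=> i _; ring.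
  rewrite -mulr_sumr -/(sqn X); ring.
Qed.

End Barriers.

Section PolynomialBarriers.
Context (R : realType) (N : nat).
Notation pt := (R * 'rV[R]_N * R)%type.
Implicit Types (p e : pt) (x : 'rV[R]_N).

Lemma quadratic_line (f : pt -> R) p e (s1 s2 : R) :
  (forall h : R, f (p + h *: e) = f p + s1 * h + s2 * h ^+ 2) ->
  [/\ quot 1 f p e s1, diff2 f p e (2 * s2) & s1 = 0 -> quot 2 f p e s2].
Proof.
move=> fE; split=> [||s10].
- have : s1 + s2 * h @[h --> (0 : R)^'+] --> s1 + s2 * 0.
    apply: cvgD; first exact: cvg_cst.
    by apply: cvgM; [exact: cvg_cst|exact: cvg_within].
  rewrite mulr0 addr0; apply: cvg_trans; apply: near_eq_cvg; near=> h.
  have h0 : 0 < h by near: h; exact: nbhs_right_gt.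
  by rewrite fE; field; rewrite gt_eqF.
- apply: cvg_near_cst; near=> h.
  have h0 : 0 < h by near: h; exact: nbhs_right_gt.
  by rewrite -scaleNr !fE; field; rewrite gt_eqF.
- apply: cvg_near_cst; near=> h.
  have h0 : 0 < h by near: h; exact: nbhs_right_gt.
  by rewrite !fE s10; field; rewrite gt_eqF.
Unshelve. all: by end_near. Qed.

(* In the slice lemma this is the barrier [(1 - k |y - y0|)^2 - |x - x0|^2] on
   one side of the slice. *)
Definition parabola (A B0 B1 M : R) x0 : pt -> R := fun p =>
  A * sqn (p.1.2 - x0) + (B0 + B1 * p.2) ^+ 2 + M * p.1.1.

Lemma parabola_defect (c : R) (a : 'rV[R]_N) A B0 B1 M x0 p : 0 < p.2 ->
  defect c a (parabola A B0 B1 M x0) p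
    (M - (2 * A * N%:R + 2 * B1 ^+ 2 + c / p.2 * (2 * B1 * (B0 + B1 * p.2)))).
Proof.
case: p => -[t x] y /= y0p; set f := parabola _ _ _ _ _; set p := (t, x, y).
set X := x - x0; set Y := B0 + B1 * y.
have ft (h : R) : f (p + h *: - dir_t R N) = f p + (- M) * h + 0 * h ^+ 2.
  rewrite /f /parabola /= !oppr0 !scaler0 !addr0 /GRing.scale /=; ring.
have fy (h : R) : f (p + h *: dir_y R N) = f p + (2 * B1 * Y) * h + B1 ^+ 2 * h ^+ 2.
  rewrite /f /parabola /= !scaler0 !addr0 /GRing.scale /= /Y; ring.
have fyN (h : R) : f (p + h *: - dir_y R N) =
    f p + (- (2 * B1 * Y)) * h + B1 ^+ 2 * h ^+ 2.
  rewrite /f /parabola /= !oppr0 !scaler0 !addr0 /GRing.scale /= /Y; ring.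
have fx i (h : R) : f (p + h *: oblique a i) = f p +
    (2 * A * X ord0 i + 2 * B1 * Y * a ord0 i) * h +
    (A + B1 ^+ 2 * a ord0 i ^+ 2) * h ^+ 2.
  rewrite /f /parabola /= !scaler0 !addr0 add0r [_ - x0]addrAC -/X sqn_line.
  rewrite /GRing.scale /= /Y; ring.
have [ht _ _] := quadratic_line ft.
have [hy hyy _] := quadratic_line fy.
have [hyN _ _] := quadratic_line fyN.
split=> [_|/= y0E]; last by rewrite y0E ltxx in y0p.
exists M, (2 * B1 * Y), (2 * B1 ^+ 2),
  (fun i => 2 * (A + B1 ^+ 2 * a ord0 i ^+ 2)); split => //.
- by move=> i; have [] := quadratic_line (fx i).
- rewrite -mulr_sumr big_split /= sumr_const card_ord -mulr_sumr /ndy.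
  set B := \sum_(_ < _) _; field.
  by rewrite gt_eqF.
Qed.

(* For [E] large this is a supersolution in the thin cap [y <= eps (1 - |x|^2)],
   on whose upper face it dominates a multiple of [y ^- n]. *)
Definition cap (n : nat) (E : R) x0 : pt -> R := fun p =>
  let r := (1 - sqn (p.1.2 - x0))^-1 in
  2 * r ^+ n - E * p.2 ^+ 2 * r ^+ n.+2.

(** One computation serves [dir_x i] (with [al = 0]) and [oblique a i] (with [al = a_i]). Along the
    line the reciprocal [r] satisfies r' = r^2 (q + 2 h), so powers of [r] differentiate into powers
    of [r]. *)
Lemma cap_line n E x0 p e i (al : R) : 0 < 1 - sqn (p.1.2 - x0) ->
  e.1.2 = delta_mx ord0 i -> e.2 = al ->
  let r := (1 - sqn (p.1.2 - x0))^-1 in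
  let q := 2 * (p.1.2 - x0) ord0 i in
  diff2 (cap n.+1 E x0) p e
   (2 * (n.+1%:R * n.+2%:R * r ^+ n.+3 * q ^+ 2 + 2 * n.+1%:R * r ^+ n.+2)
    - E * (2 * al ^+ 2 * r ^+ n.+3 + 4 * al * p.2 * n.+3%:R * r ^+ n.+4 * q
      + p.2 ^+ 2 * (n.+3%:R * n.+4%:R * r ^+ n.+4.+1 * q ^+ 2
                    + 2 * n.+3%:R * r ^+ n.+4))).
Proof.
case: p => -[t x] y /=; case: e => -[et ex] ey /= s0 -> ->.
set X := x - x0 in s0 *; set r0 := (1 - _)^-1; set q := 2 * X ord0 i.
pose s (h : R) : R := 1 - sqn X - q * h - h ^+ 2.
pose r (h : R) : R := (s h)^-1.
pose dg (h : R) : R :=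
  2 * (n.+1%:R * r h ^+ n.+2 * (q + 2 * h))
  - E * (2 * al * (y + al * h) * r h ^+ n.+3
     + (y + al * h) ^+ 2 * (n.+3%:R * r h ^+ n.+4 * (q + 2 * h))).
have gE : (fun h => cap n.+1 E x0 ((t, x, y) + h *: (et, delta_mx ord0 i, al))) =
   (fun h => 2 * r h ^+ n.+1 - E * (y + al * h) ^+ 2 * r h ^+ n.+3).
  apply/funext => h; rewrite /cap /= [_ - x0]addrAC -/X sqn_line.
  rewrite /GRing.scale /= [h * al]mulrC.
  suff -> : 1 - (sqn X + 2 * X ord0 i * h + h ^+ 2) = s h by [].
  by rewrite /s /q; ring.
have s0E : s 0 = 1 - sqn X by rewrite /s; ring.
have cs : continuous s.
  move=> h; apply: cvgB; first apply: cvgB; first exact: cvg_cst.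
    by apply: cvgM; [exact: cvg_cst|exact: cvg_id].
  exact: exprn_continuous.
have ds h : is_derive (h : R) (1 : R) s (- (q + 2 * h)).
  by rewrite /s; apply: is_derive_eq; rewrite /GRing.scale /=; ring.
have dr h : s h != 0 -> is_derive (h : R) (1 : R) r (r h ^+ 2 * (q + 2 * h)).
  move=> sh; apply: (is_derive_eq (is_deriveV sh (ds h))); rewrite /GRing.scale /= /r; field.
  exact: sh.
have dX m h : s h != 0 -> is_derive (h : R) (1 : R) (fun h => r h ^+ m.+1)
    (m.+1%:R * r h ^+ m.+2 * (q + 2 * h)).
  move=> sh; have -> : (fun h => r h ^+ m.+1) = r ^+ m.+1 by apply/funext => ?; rewrite fctE.
  apply: (is_derive_eq (is_deriveX m.+1 (dr h sh))).
  by rewrite /GRing.scale /= -[m.+2]addn2 exprD; ring.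
have [||_ + _] := @line_derive R N (cap n.+1 E x0) (t, x, y) (et, delta_mx ord0 i, al) dg
   (2 * (n.+1%:R * n.+2%:R * r0 ^+ n.+3 * q ^+ 2 + 2 * n.+1%:R * r0 ^+ n.+2)
    - E * (2 * al ^+ 2 * r0 ^+ n.+3 + 4 * al * y * n.+3%:R * r0 ^+ n.+4 * q
      + y ^+ 2 * (n.+3%:R * n.+4%:R * r0 ^+ n.+4.+1 * q ^+ 2
                    + 2 * n.+3%:R * r0 ^+ n.+4))); last by [].
- have : \forall h \near (0 : R), 0 < s h.
    by apply: (cvgr_gt (s 0) (cs 0)); rewrite s0E.
  apply: filterS => h sh; have sh' := lt0r_neq0 sh.
  have d1 := dX n h sh'; have d2 := dX n.+2 h sh'.
  rewrite gE; apply: is_derive_eq; rewrite /dg /GRing.scale /=.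
  ring.
- have s0' : s 0 != 0 by rewrite s0E lt0r_neq0.
  have d1 := dX n.+1 0 s0'; have d2 := dX n.+2 0 s0'; have d3 := dX n.+3 0 s0'.
  have -> : r0 = r 0 by rewrite /r s0E.
  rewrite /dg; apply: is_derive_eq; rewrite /GRing.scale /=.
  ring.
Qed.

End PolynomialBarriers.

(** * Sup norm against Euclidean length, and bounds on the symbol *)

Section Norms.
Context (R : realType) (N : nat).
Implicit Types (x : 'rV[R]_N).

Lemma coord_le_norm x i : `|x ord0 i| <= `|x|.
Proof.
rewrite [leRHS]/Num.norm /= mx_normrE.
by apply/bigmax_geP; right => /=; exists (ord0, i).
Qed.

Lemma norm_le_coord x (r : R) : 0 <= r -> (forall i, `|x ord0 i| <= r) -> `|x| <= r.
Proof.
move=> r0 hx; rewrite [leLHS]/Num.norm /= mx_normrE.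
by apply/bigmax_leP; split=> // -[i j] _ /=; rewrite ord1.
Qed.

Lemma coord_sqn x i : x ord0 i ^+ 2 <= sqn x.
Proof.
rewrite /sqn (bigD1 i) //= lerDl; apply: sumr_ge0 => j _; exact: sqr_ge0.
Qed.

Lemma norm_sqn x : `|x| ^+ 2 <= sqn x.
Proof.
rewrite -[leRHS]sqr_sqrtr ?sqn_ge0 // ler_sqr ?nnegrE ?sqrtr_ge0 //.
apply: norm_le_coord; first exact: sqrtr_ge0.
by move=> i; rewrite -sqrtr_sqr ler_wsqrtr // coord_sqn.
Qed.

Lemma sqn_lt_norm x (r : R) : 0 <= r -> sqn x < r ^+ 2 -> `|x| < r.
Proof.
move=> r0 h; rewrite -(@ltr_pXn2r _ 2) ?nnegrE //.
exact: le_lt_trans (norm_sqn x) h.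
Qed.

Lemma sqn_le_norm x (r : R) : 0 <= r -> sqn x <= r ^+ 2 -> `|x| <= r.
Proof.
move=> r0 h; rewrite -(@ler_pXn2r _ 2) ?nnegrE //.
exact: le_trans (norm_sqn x) h.
Qed.

Lemma sqr_le_norm (y r : R) : 0 <= r -> y ^+ 2 <= r ^+ 2 -> `|y| <= r.
Proof.
by move=> r0 h; rewrite -(@ler_pXn2r _ 2) ?nnegrE // real_normK ?num_real.
Qed.

Lemma sqr_lt_norm (y r : R) : 0 <= r -> y ^+ 2 < r ^+ 2 -> `|y| < r.
Proof.
by move=> r0 h; rewrite -(@ltr_pXn2r _ 2) ?nnegrE // real_normK ?num_real.
Qed.

(** From x_i^2 <= 2 (x_i + a_i y)^2 + 2 a_i^2 y^2 one gets |x|^2 <= 2 S + 2 (1 - ndy) y^2.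
    Multiplying by [ndy <= 1] and adding [ndy * y ^+ 2] gives at most 3 (S + ndy y^2), whence the
    factor 1/3. *)
Lemma elliptic_ge (a : 'rV[R]_N) x y : 0 <= ndy a ->
  ndy a / 3 * (sqn x + y ^+ 2) <= elliptic_form a x y.
Proof.
move=> k0; rewrite /elliptic_form.
have k1 : ndy a <= 1 by rewrite /ndy gerBl sumr_ge0 // => i _; exact: sqr_ge0.
set S := \sum_(_ < _) _.
have S0 : 0 <= S by apply: sumr_ge0 => i _; exact: sqr_ge0.
have h : sqn x <= 2 * S + 2 * (1 - ndy a) * y ^+ 2.
  rewrite /S /ndy opprB addrCA subrr addr0 -mulrA mulr_suml !mulr_sumr -big_split /=.
  apply: ler_sum => i _.
  have := sqr_ge0 (x ord0 i + 2 * (a ord0 i * y)); lra.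
have y0 := sqr_ge0 y.
have : ndy a * sqn x <= ndy a * (2 * S + 2 * (1 - ndy a) * y ^+ 2) by apply: ler_wpM2l.
have : ndy a * S <= S by rewrite ler_piMl.
have : 0 <= ndy a ^+ 2 * y ^+ 2 by rewrite mulr_ge0 // sqr_ge0.
lra.
Qed.

Lemma elliptic_le (a : 'rV[R]_N) x y : 0 <= ndy a ->
  elliptic_form a x y <= 3 * (sqn x + y ^+ 2).
Proof.
move=> k0; rewrite /elliptic_form.
have k1 : ndy a <= 1 by rewrite /ndy gerBl sumr_ge0 // => i _; exact: sqr_ge0.
set S := \sum_(_ < _) _.
have h : S <= 2 * sqn x + 2 * (1 - ndy a) * y ^+ 2.
  rewrite /S /ndy /sqn opprB addrCA subrr addr0 -mulrA mulr_suml !mulr_sumr -big_split /=.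
  apply: ler_sum => i _.
  have := sqr_ge0 (x ord0 i - a ord0 i * y); lra.
have y0 := sqr_ge0 y; have x0 := sqn_ge0 x.
have : 0 <= ndy a * y ^+ 2 by rewrite mulr_ge0.
lra.
Qed.

End Norms.

Section Continuity.
Context (R : realType) (N : nat).
Notation pt := (R * 'rV[R]_N * R)%type.

Lemma continuousM_fun (S : topologicalType) (f g : S -> R) :
  continuous f -> continuous g -> continuous (fun z => f z * g z).
Proof. by move=> cf cg z; apply: cvgM; [exact: cf|exact: cg]. Qed.

Lemma continuousD_fun (S : topologicalType) (f g : S -> R) :
  continuous f -> continuous g -> continuous (fun z => f z + g z).
Proof. by move=> cf cg z; apply: cvgD; [exact: cf|exact: cg]. Qed.

Lemma continuous_sum (S : topologicalType) (I : Type) (s : seq I) (P : pred I)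
    (F : I -> S -> R) :
  (forall i, continuous (F i)) -> continuous (fun z => \sum_(i <- s | P i) F i z).
Proof.
move=> cF; elim: s => [|i s ih].
  have -> : (fun z => \sum_(i <- [::] | P i) F i z) = (fun=> 0).
    by apply/funext => z; rewrite big_nil.
  by move=> z; exact: cvg_cst.
have -> : (fun z => \sum_(j <- i :: s | P j) F j z) =
    (fun z => if P i then F i z + \sum_(j <- s | P j) F j z
              else \sum_(j <- s | P j) F j z).
  by apply/funext => z; rewrite big_cons.
by case: (P i) => //; exact: continuousD_fun.
Qed.

Lemma continuousX_fun (S : topologicalType) (f : S -> R) n :
  continuous f -> continuous (fun z => f z ^+ n).
Proof.
move=> cf; elim: n => [|n ih].
  by under eq_fun do rewrite expr0; move=> z; exact: cvg_cst.
by under eq_fun do rewrite exprS; exact: continuousM_fun.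
Qed.

Lemma continuous_t : continuous (fun p : pt => p.1.1).
Proof.
by move=> p; apply: (@cvg_comp _ _ _ fst fst (nbhs p) (nbhs p.1)); exact: cvg_fst.
Qed.

Lemma continuous_y : continuous (fun p : pt => p.2).
Proof. by move=> p; exact: cvg_snd. Qed.

Lemma continuous_x : continuous (fun p : pt => p.1.2).
Proof.
by move=> p; apply: (@cvg_comp _ _ _ fst snd (nbhs p) (nbhs p.1));
  [exact: cvg_fst|exact: cvg_snd].
Qed.

Lemma continuous_sqn x0 : continuous (fun p : pt => sqn (p.1.2 - x0)).
Proof.
rewrite /sqn; apply: continuous_sum => i; apply: continuousX_fun.
have -> : (fun p : pt => (p.1.2 - x0) ord0 i) =
    (fun p : pt => p.1.2 ord0 i + - x0 ord0 i).
  by apply/funext => p; rewrite !mxE.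
apply: continuousD_fun; last by move=> p; exact: cvg_cst.
move=> p; apply: (@cvg_comp _ _ _ (fun p : pt => p.1.2)
  (fun M : 'rV[R]_N => M ord0 i) (nbhs p) (nbhs p.1.2)).
  exact: continuous_x.
exact: coord_continuous.
Qed.

Lemma continuous_cst_fun (S : topologicalType) (k : R) : continuous (fun _ : S => k).
Proof. by move=> z; exact: cvg_cst. Qed.

Lemma parabola_continuous A B0 B1 M x0 : continuous (@parabola R N A B0 B1 M x0).
Proof.
have cst k := @continuous_cst_fun (pt : topologicalType) k.
apply: (continuousD_fun (continuousD_fun
  (continuousM_fun (cst A) (@continuous_sqn x0)) (@continuousX_fun _ _ 2
  (continuousD_fun (cst B0) (continuousM_fun (cst B1) continuous_y))))
  (continuousM_fun (cst M) continuous_t)).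
Qed.

Lemma gauss_continuous b0 b1 ga x0 y0 : continuous (@gauss R N b0 b1 ga x0 y0).
Proof.
pose E p : R := (b0 + b1 * p.1.1) * (sqn (p.1.2 - x0) + (p.2 - y0) ^+ 2) + ga * p.1.1.
have cE : continuous E.
  have cst k := @continuous_cst_fun (pt : topologicalType) k.
  exact: (continuousD_fun (continuousM_fun
    (continuousD_fun (cst b0) (continuousM_fun (cst b1) continuous_t))
    (continuousD_fun (@continuous_sqn x0) (@continuousX_fun _ _ 2
      (continuousD_fun continuous_y (cst (- y0))))))
    (continuousM_fun (cst ga) continuous_t)).
by move=> p; apply: (@continuous_comp _ _ _ E expR); [exact: cE|exact: continuous_expR].
Qed.

End Continuity.

(** * Propagation of lower bounds *)

Section Spread.
Context (R : realType) (N : nat) (c : R) (a : 'rV[R]_N) (T : R).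
Notation pt := (R * 'rV[R]_N * R)%type.
Implicit Types (p : pt) (x : 'rV[R]_N) (w : pt -> R).

(** There is no initial time, so backward translates in time are again solutions; continuity on the
    whole space spares any discussion of domains. *)
Definition solution w : Prop := continuous w /\
  forall p, p.1.1 <= T -> 0 <= p.2 -> defect c a w p 0.

Context (ndy_gt0 : 0 < ndy a) (c_gt : 0 < c + 1).

Lemma comparison_below (G : set pt) w (phi : pt -> R) :
  compact G -> solution w -> {within G, continuous phi} ->
  (forall p, G p -> p.1.1 <= T /\ 0 <= p.2) ->
  (forall p, G p -> w p < phi p ->
     (\forall q \near p, 0 <= q.2 -> q.1.1 <= p.1.1 -> G q) /\
     exists2 d, d < 0 & defect c a phi p d) ->
  forall p, G p -> phi p <= w p.
Proof.
move=> cG [cw dw] cphi hG hphi p Gp.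
have := @comparison R N c a G (fun q => -1 * w q) (fun q => -1 * phi q) (ltW ndy_gt0).
have c0 : 0 <= 1 + c by rewrite addrC ltW.
have cw' : continuous (fun q => -1 * w q).
  by move=> q; apply: cvgM; [exact: cvg_cst|exact: cw].
have cphi' : {within G, continuous (fun q => -1 * phi q)}.
  by move=> q; apply: cvgM; [exact: cvg_cst|exact: cphi].
move=> /(_ c0 cG cw' cphi').
have h1 q : G q -> 0 <= q.2 /\ defect c a (fun q => -1 * w q) q 0.
  move=> /hG[qT q0]; split => //.
  by have := defectZ (-1) (dw q qT q0); rewrite mulr0.
have h2 q : G q -> -1 * phi q < -1 * w q ->
    (\forall q' \near q, 0 <= q'.2 -> q'.1.1 <= q.1.1 -> G q') /\
    exists2 d, 0 < d & defect c a (fun q => -1 * phi q) q d.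
  move=> Gq; rewrite !mulN1r ltrN2 => /(hphi q Gq)[nG [d d0 hd]]; split=> //.
  by exists (-1 * d); [rewrite mulN1r oppr_gt0|exact: defectZ].
by move=> /(_ h1 h2 p Gp); rewrite !mulN1r lerN2.
Qed.

End Spread.

(** * From a slice to a ball *)

Section Slice.
Context (R : realType) (N : nat) (c : R) (a : 'rV[R]_N) (T : R).
Notation pt := (R * 'rV[R]_N * R)%type.
Implicit Types (p : pt) (x : 'rV[R]_N).
Context (ndy_gt0 : 0 < ndy a) (c_gt : 0 < c + 1).
Context (w : pt -> R) (w_sol : solution c a T w) (w_ge0 : forall p, 0 <= w p).

(** Chosen so that [slope ^+ 2 >= 2 * N + |c| * slope + 1]: the second y-derivative of the parabola
    then outweighs its x-Laplacian, the drift and the time term. *)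
Definition slope : R := 2 * N%:R + `|c| + 1.

Lemma slope_ge1 : 1 <= slope.
Proof. by rewrite /slope lerDr addr_ge0 ?normr_ge0 // mulr_ge0. Qed.

(* [s = 1] treats the points above the slice, [s = -1] those below. *)
Lemma slice_spread_sided (s rho t0 th : R) x0 (y0 yl yh m : R) :
  s ^+ 2 = 1 -> 0 < rho -> 4 * rho <= y0 -> 0 < m ->
  th <= T -> t0 + 2 * rho ^+ 2 <= th ->
  (forall y, yl <= y <= yh -> 0 <= s * (y - y0) <= rho / slope) ->
  (forall y, y = yl \/ y = yh -> s * (y - y0) = 0 \/ s * (y - y0) = rho / slope) ->
  (forall t x, t0 <= t <= T -> `|x - x0| <= rho -> m <= w (t, x, y0)) ->
  forall x y, yl <= y <= yh -> `|x - x0| <= rho ->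
  m * ((1 - slope / rho * (s * (y - y0))) ^+ 2 - sqn (x - x0) / rho ^+ 2)
    <= w (th, x, y).
Proof.
move=> s1 rho0 y0rho m0 thT t0th hy hyend hslice x y yy xx.
have k1 := slope_ge1; have k0 : 0 < slope by apply: lt_le_trans k1.
have sn : `|s| = 1.
  by move/eqP: s1; rewrite sqrf_eq1 => /orP[]/eqP ->; rewrite ?normrN normr1.
have rho2 : 0 < rho ^+ 2 by rewrite exprn_gt0.
(* The penalty [mu * (th - t)] reaches 1, the maximum of the parabola, once the elapsed time is
   [2 * rho ^+ 2]; this is the waiting time of the statement. *)
pose mu := 1 / (2 * rho ^+ 2).
have mu0 : 0 < mu by rewrite divr_gt0 // mulr_gt0.
pose A := - (1 / rho ^+ 2); pose B1 := - (slope * s / rho).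
pose B0 := 1 + slope * s * y0 / rho.
pose psi := @parabola R N A B0 B1 mu x0.
pose phi (p : pt) := m * (psi p + (- (mu * th))).
pose W (p : pt) := slope / rho * (s * (p.2 - y0)).
have psiE p : psi p - mu * th =
    (1 - W p) ^+ 2 - sqn (p.1.2 - x0) / rho ^+ 2 - mu * (th - p.1.1).
  by rewrite /psi /parabola /A /B0 /B1 /W; field; rewrite gt_eqF.
pose G := box t0 th x0 rho yl yh.
have W01 p : G p -> 0 <= W p <= 1.
  move=> [_ _ /hy/andP[h1 h2]]; have sr : 0 <= slope / rho by rewrite divr_ge0 // ltW.
  rewrite /W mulr_ge0 //=; apply: le_trans (ler_wpM2l sr h2) _.
  by rewrite mulrA divfK ?gt_eqF // mulfV ?gt_eqF.
have W0 p : s * (p.2 - y0) = 0 -> W p = 0 by rewrite /W => ->; rewrite mulr0.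
have W1 p : s * (p.2 - y0) = rho / slope -> W p = 1.
  by rewrite /W => ->; field; rewrite !gt_eqF.
have eqy0 y' : s * (y' - y0) = 0 -> y' = y0.
  move=> h; have : s ^+ 2 * (y' - y0) = 0 by rewrite expr2 -mulrA h mulr0.
  by rewrite s1 mul1r => /eqP; rewrite subr_eq0 => /eqP.
have ypos p : G p -> 3 * rho <= p.2.
  move=> [_ _ /hy/andP[h1 h2]].
  have : `|s * (p.2 - y0)| <= rho.
    rewrite ger0_norm // (le_trans h2) // ler_pdivrMr // ler_peMr // ltW //.
  have -> : `|s * (p.2 - y0)| = `|p.2 - y0|.
    by rewrite normrM sn mul1r.
  by rewrite ler_norml => /andP[]; lra.
suff H p : G p -> phi p <= w p.
  have := H (th, x, y); rewrite /phi psiE /= subrr mulr0 subr0 => H'.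
  apply: H'; split => //=; rewrite lexx andbT.
  by apply: le_trans t0th; rewrite lerDl mulr_ge0 // ltW.
have sqpos p := sqn_ge0 (p.1.2 - x0).
move: p; apply: (comparison_below ndy_gt0 c_gt _ w_sol).
- exact: box_compact.
- apply: continuous_subspaceT => p; apply: cvgM; first exact: cvg_cst.
  by apply: cvgD; [exact: parabola_continuous|exact: cvg_cst].
- move=> p Gp; have := ypos p Gp; case: Gp => /andP[_ h] _ _ h'; split; last by lra.
  exact: le_trans h thT.
- move=> p Gp wphi.
  have pt : p.1.1 <= th by case: Gp => /andP[].
  have pt0 : t0 <= p.1.1 by case: Gp => /andP[].
  have /andP[Wp0 Wp1] := W01 p Gp.
  have W2 : (1 - W p) ^+ 2 <= 1.
    by rewrite -[leRHS](expr1n _ 2) ler_sqr ?nnegrE //; lra.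
  have psi0 : 0 < psi p - mu * th.
    by rewrite -(pmulr_rgt0 _ m0); apply: le_lt_trans wphi.
  rewrite psiE in psi0.
  have mut : 0 <= mu * (th - p.1.1) by apply: mulr_ge0; [exact: ltW|rewrite subr_ge0].
  have sq0 : 0 <= sqn (p.1.2 - x0) / rho ^+ 2 by rewrite divr_ge0 // ltW.
  (* On the slice [phi <= m <= w] by hypothesis; at the other end [W = 1] makes the barrier
     nonpositive. *)
  have noend y' : y' = yl \/ y' = yh -> p.2 <> y'.
    move=> /hyend h E; rewrite -E in h; case: h => h; last first.
      by move: psi0; rewrite (W1 _ h) subrr expr0n /=; lra.
    have pE : p = (p.1.1, p.1.2, y0) by rewrite -(eqy0 _ h); case: (p) => -[].
    have : m <= w p.
      rewrite pE; apply: hslice; last by case: Gp.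
      by rewrite pt0 (le_trans pt).
    suff : phi p <= m by lra.
    by rewrite /phi -[leRHS]mulr1 ler_pM2l // psiE; lra.
  have /andP[yl0 yh0] : yl <= p.2 <= yh by case: Gp.
  split.
    apply: near_box => //.
    + rewrite lt_neqAle pt0 andbT; apply/eqP => tE.
      have : 1 <= mu * (th - p.1.1).
        by rewrite /mu mulrAC ler_pdivlMr ?mulr_gt0 // -tE; lra.
      by lra.
    + apply: sqn_lt_norm; first exact: ltW.
      have : sqn (p.1.2 - x0) / rho ^+ 2 < 1 by lra.
      by rewrite ltr_pdivrMr // mul1r.
    + by rewrite lt_neqAle yh0 andbT; apply/eqP; apply: noend; right.
    + left; rewrite lt_neqAle yl0 andbT eq_sym; apply/eqP; apply: noend; left=> //.
  exists (m * (mu - (2 * A * N%:R + 2 * B1 ^+ 2 + c / p.2 * (2 * B1 * (B0 + B1 * p.2))))).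
    rewrite pmulr_rlt0 //.
    have -> : B0 + B1 * p.2 = 1 - W p by rewrite /B0 /B1 /W; ring.
    set i2 := (rho ^+ 2)^-1; have i20 : 0 < i2 by rewrite invr_gt0.
    have -> : mu = i2 / 2 by rewrite /mu /i2; field; rewrite gt_eqF.
    have -> : A = - i2 by rewrite /A /i2 div1r.
    have -> : B1 ^+ 2 = slope ^+ 2 * i2.
      have -> : B1 ^+ 2 = s ^+ 2 * (slope ^+ 2 * i2).
        by rewrite /B1 /i2; field; rewrite gt_eqF.
      by rewrite s1 mul1r.
    have y3 := ypos p Gp; have yp : 0 < p.2 by apply: lt_le_trans y3; rewrite mulr_gt0.
    (* The factor 2/3 comes from [p.2 >= 3 * rho]: at this distance from y = 0 the drift scales like
       the second derivatives. *)
    have z : `|c / p.2 * (2 * B1 * (1 - W p))| <= 2 / 3 * `|c| * slope * i2.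
      have -> : `|c / p.2 * (2 * B1 * (1 - W p))| =
         2 * `|c| * slope * (1 - W p) / (p.2 * rho).
        rewrite /B1 !(normrM, normrN, normfV) sn (ger0_norm (_ : 0 <= 2)) //.
        rewrite (gtr0_norm yp) (gtr0_norm k0) (gtr0_norm rho0) (@ger0_norm _ (1 - W p)); last by lra.
        by field; rewrite !gt_eqF.
      have c0 := normr_ge0 c.
      rewrite ler_pdivrMr ?mulr_gt0 //.
      have h1 : 3 * rho ^+ 2 <= p.2 * rho by rewrite expr2 mulrA ler_pM2r.
      have -> : 2 / 3 * `|c| * slope * i2 * (p.2 * rho) =
         2 * `|c| * slope * (p.2 * rho / (3 * rho ^+ 2)).
        by rewrite /i2; field; rewrite gt_eqF.
      apply: ler_pM => //; last 1 first.
      - apply: (@le_trans _ _ 1); first by lra.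
        by rewrite ler_pdivlMr ?mulr_gt0 // mul1r.
      - by rewrite !mulr_ge0 // ltW.
      - by lra.
    move: z; set Z := c / p.2 * _ => z.
    have zl : - (2 / 3 * `|c| * slope * i2) <= Z.
      by move: z; rewrite ler_norml => /andP[].
    have hk : 2 * N%:R + `|c| * slope + 1 <= slope ^+ 2.
      rewrite [leRHS]expr2 {2}/slope.
      have N0 : (0 : R) <= N%:R by [].
      have : 2 * N%:R <= 2 * N%:R * slope by rewrite ler_peMr // mulr_ge0.
      by move: k1; rewrite mulrDl mulrDl; lra.
    have c0 := normr_ge0 c.
    have ck : 0 <= `|c| * slope by rewrite mulr_ge0 // ltW.
    have : (1 / 2 + 2 * N%:R - 2 * slope ^+ 2 + 2 / 3 * (`|c| * slope)) * i2 < 0.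
      by rewrite pmulr_llt0 //; have N0 : (0 : R) <= N%:R by []; lra.
    by lra.
  apply: defectZ; rewrite -[X in defect _ _ _ _ X]addr0; apply: defectD.
    by apply: parabola_defect; have := ypos p Gp; lra.
  exact: defect_cst.
Qed.

End Slice.

Section Growth.
Context (R : realType) (N : nat) (c : R) (a : 'rV[R]_N) (T : R).
Notation pt := (R * 'rV[R]_N * R)%type.
Implicit Types (p : pt) (x : 'rV[R]_N).
Context (ndy_gt0 : 0 < ndy a) (c_gt : 0 < c + 1).
Context (w : pt -> R) (w_sol : solution c a T w) (w_ge0 : forall p, 0 <= w p).
Notation slope := (slope N c).
Notation slope_ge1 := (slope_ge1 N c).

(** The bound persists up to time [T], so that it can serve as data on an inner ball in the next
    comparison. *)
Definition low (t0 : R) x0 (y0 rho m : R) : Prop := forall t x y,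
  t0 <= t <= T -> sqn (x - x0) + (y - y0) ^+ 2 <= rho ^+ 2 -> m <= w (t, x, y).

(** Up to a quarter of the height of the one-sided barriers, both are at least (3/4)^2 - 1/16 = 1/2
    times [m]. *)
Lemma slice_spread (rho t0 : R) x0 (y0 m : R) :
  0 < rho -> 4 * rho <= y0 -> 0 < m ->
  (forall t x, t0 <= t <= T -> `|x - x0| <= rho -> m <= w (t, x, y0)) ->
  low (t0 + 2 * rho ^+ 2) x0 y0 (rho / (4 * slope)) (m / 2).
Proof.
move=> rho0 y0rho m0 hslice t x y /andP[tt0 tT] hq.
have k1 := slope_ge1; have k0 : 0 < slope by apply: lt_le_trans k1.
have rk0 : 0 < rho / slope by rewrite divr_gt0.
have rk1 : rho / slope <= rho by rewrite ler_pdivrMr // ler_peMr // ltW.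
have E : rho / (4 * slope) = (rho / slope) / 4 by field; rewrite gt_eqF.
rewrite E in hq; set r := rho / slope in hq rk0 rk1.
have hx : sqn (x - x0) <= (r / 4) ^+ 2.
  by apply: le_trans hq; rewrite lerDl sqr_ge0.
have hy : `|y - y0| <= r / 4.
  apply: sqr_le_norm; first by rewrite divr_ge0 // ltW.
  by apply: le_trans hq; rewrite lerDr sqn_ge0.
have xr : `|x - x0| <= rho.
  have : `|x - x0| <= r / 4.
    by apply: sqn_le_norm hx; rewrite divr_ge0 // ltW.
  by lra.
have fin s : 0 <= s * (y - y0) <= r / 4 ->
  m / 2 <= m * ((1 - slope / rho * (s * (y - y0))) ^+ 2 - sqn (x - x0) / rho ^+ 2).
  move=> /andP[z0 z1]; rewrite ler_pM2l //.
  set z := s * (y - y0) in z0 z1 *.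
  have h1 : slope / rho * z <= 1 / 4.
    have -> : slope / rho = r^-1 by rewrite /r invf_div.
    by rewrite mulrC ler_pdivrMr //; lra.
  have h2 : sqn (x - x0) / rho ^+ 2 <= 1 / 16.
    rewrite ler_pdivrMr ?exprn_gt0 //; apply: le_trans hx _.
    have : r ^+ 2 <= rho ^+ 2 by rewrite ler_sqr ?nnegrE // ltW.
    have -> : (r / 4) ^+ 2 = r ^+ 2 / 16 by field.
    by lra.
  have h3 : (3 / 4) ^+ 2 <= (1 - slope / rho * z) ^+ 2.
    by rewrite ler_sqr ?nnegrE //; lra.
  by rewrite !expr2 in h3 *; lra.
move: hy; rewrite ler_norml => /andP[hy1 hy2].
have [yy|yy] := leP y0 y.
- have hs : 0 <= 1 * (y - y0) <= r / 4 by apply/andP; lra.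
  apply: le_trans (fin _ hs) _.
  apply: (slice_spread_sided ndy_gt0 c_gt w_sol w_ge0 (s := 1) (rho := rho) (t0 := t0) (yl := y0) (yh := y0 + r)) => //.
  + by rewrite expr1n.
  + by move=> y' /andP[h1 h2]; rewrite -/r; apply/andP; lra.
  + by move=> y' [->|->]; [left|right]; rewrite -?/r; ring.
  + by apply/andP; lra.
- have hs : 0 <= -1 * (y - y0) <= r / 4 by apply/andP; lra.
  apply: le_trans (fin _ hs) _.
  apply: (slice_spread_sided ndy_gt0 c_gt w_sol w_ge0 (s := -1) (rho := rho) (t0 := t0) (yl := y0 - r) (yh := y0)) => //.
  + by rewrite sqrrN expr1n.
  + by move=> y' /andP[h1 h2]; rewrite -/r; apply/andP; lra.
  + by move=> y' [->|->]; [right|left]; rewrite -?/r; ring.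
  + by apply/andP; lra.
Qed.

(** Decay rate for which exp(- steep |z|^2 / rho^2) is a subsolution at distance at least rho from
    its centre: [4 * steep * (ndy a / 3)], from the squared gradient, exceeds the trace and the
    drift by 1. *)
Definition steep : R := 3 * (2 * (N%:R + 1) + 6 * `|c| + 1) / (4 * ndy a) + 1.
(** The bump lowered by its value at radius 3 rho is still [loss] at radius 2 rho. The time penalty
    has rate [1 / (lag * rho ^+ 2)], hence exceeds the bump after a time [lag * rho ^+ 2]. *)
Definition lag : R := expR (9 * steep).
Definition loss : R := expR (- (4 * steep)) - expR (- (9 * steep)).

(** The lowered bump is positive only within radius 3 rho. Inside radius rho the hypothesis already
    gives the bound, so only the annulus in between needs a strict subsolution; [4 * rho <= y0]
    keeps that annulus in y > rho. *)
Lemma growth (rho t0 : R) x0 (y0 m : R) :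
  0 < rho -> 4 * rho <= y0 -> 0 < m -> low t0 x0 y0 rho m ->
  low (t0 + lag * rho ^+ 2) x0 y0 (2 * rho) (loss * m).
Proof.
move=> rho0 y0rho m0 hlow th x y /andP[t0th thT] hq.
have rho2 : 0 < rho ^+ 2 by rewrite exprn_gt0.
have K0 : 0 < 2 * (N%:R + 1) + 6 * `|c| + 1.
  have := normr_ge0 c; have : (0 : R) <= N%:R by [].
  by lra.
have lam1 : 1 < steep by rewrite /steep ltrDr divr_gt0 // mulr_gt0.
have lamE : 4 * steep * (ndy a / 3) >= 2 * (N%:R + 1) + 6 * `|c| + 1.
  have -> : 4 * steep * (ndy a / 3) =
     2 * (N%:R + 1) + 6 * `|c| + 1 + 4 / 3 * ndy a.
    by rewrite /steep; field; rewrite gt_eqF.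
  by rewrite lerDl mulr_ge0 // ltW.
set lam := steep in lam1 lamE.
set e9 := expR (- (9 * lam)); have e90 : 0 < e9 by exact: expR_gt0.
have lagE : lag * e9 = 1 by rewrite /lag /e9 -expRD subrr expR0.
pose mu := e9 / rho ^+ 2.
have mu0 : 0 < mu by rewrite divr_gt0.
pose b := - (lam / rho ^+ 2).
pose g := @gauss R N b 0 0 x0 y0.
pose tau := @parabola R N 0 0 0 mu x0.
pose phi (p : pt) := m * (g p + tau p + (- (e9 + mu * th))).
pose q (p : pt) := sqn (p.1.2 - x0) + (p.2 - y0) ^+ 2.
have gE p : g p = expR (- (lam * (q p / rho ^+ 2))).
  by rewrite /g /gauss; congr expR; rewrite /b /q; field; rewrite gt_eqF.
have phiE p : phi p = m * (g p - e9 - mu * (th - p.1.1)).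
  by rewrite /phi /tau /parabola; ring.
have q0 p : 0 <= q p by rewrite addr_ge0 ?sqn_ge0 ?sqr_ge0.
have lam0 : 0 < lam by apply: lt_trans lam1.
suff H p : box t0 th x0 (3 * rho) (y0 - 3 * rho) (y0 + 3 * rho) p -> phi p <= w p.
  have qb : q (th, x, y) / rho ^+ 2 <= 4.
    by rewrite ler_pdivrMr //; move: hq; rewrite exprMn /q /=; lra.
  have Gp : box t0 th x0 (3 * rho) (y0 - 3 * rho) (y0 + 3 * rho) (th, x, y).
    have r3 : (2 * rho) ^+ 2 <= (3 * rho) ^+ 2 by rewrite !exprMn; lra.
    split => /=.
    - rewrite lexx andbT; apply: le_trans t0th; rewrite lerDl mulr_ge0 //.
        exact: expR_ge0.
      exact: ltW.
    - apply: sqn_le_norm; first by rewrite mulr_ge0 // ltW.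
      apply: le_trans r3; apply: le_trans hq.
      by rewrite lerDl sqr_ge0.
    - rewrite -ler_distl; apply: sqr_le_norm; first by rewrite mulr_ge0 // ltW.
      apply: le_trans r3; apply: le_trans hq.
      by rewrite lerDr sqn_ge0.
  apply: le_trans (H _ Gp); rewrite phiE /= subrr mulr0 subr0 mulrC ler_pM2l //.
  by rewrite /loss -/lam -/e9 lerD2r gE ler_expR lerN2 [4 * _]mulrC ler_pM2l.
move: p; apply: (comparison_below ndy_gt0 c_gt _ w_sol).
- exact: box_compact.
- apply: continuous_subspaceT => p; apply: cvgM; first exact: cvg_cst.
  apply: cvgD; last exact: cvg_cst.
  by apply: cvgD; [exact: gauss_continuous|exact: parabola_continuous].
- move=> p [/andP[_ h] _ /andP[h1 _]]; split; last by lra.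
  exact: le_trans h thT.
- move=> p Gp wphi; case: (Gp) => /andP[pt0 pt] px /andP[py1 py2].
  have mut : 0 <= mu * (th - p.1.1) by apply: mulr_ge0; [exact: ltW|rewrite subr_ge0].
  have g0 : 0 < g p - e9 - mu * (th - p.1.1).
    by rewrite -(pmulr_rgt0 _ m0) -phiE; apply: le_lt_trans wphi.
  have g1 : g p <= 1 by rewrite gE -expR0 ler_expR oppr_le0 !mulr_ge0 // ?invr_ge0 ?ltW.
  have q9 : q p < 9 * rho ^+ 2.
    have : e9 < g p by lra.
    by rewrite gE ltr_expR ltrN2 mulrC ltr_pM2r // ltr_pdivrMr.
  have q1 : rho ^+ 2 < q p.
    rewrite ltNge; apply/negP => qp.
    have : m <= w p.
      have -> : p = (p.1.1, p.1.2, p.2) by case: (p) => -[].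
      by apply: hlow => //; rewrite pt0 (le_trans pt).
    suff : phi p <= m by lra.
    by rewrite phiE -[leRHS]mulr1 ler_pM2l //; lra.
  have sx := sqn_ge0 (p.1.2 - x0); have sy := sqr_ge0 (p.2 - y0).
  have ylt : `|p.2 - y0| < 3 * rho.
    apply: sqr_lt_norm; first by rewrite mulr_ge0 // ltW.
    by rewrite exprMn; move: q9; rewrite /q; lra.
  have yr : rho < p.2 by move: ylt; rewrite ltr_norml => /andP[]; lra.
  have y00 : 0 < p.2 by apply: lt_trans yr.
  split.
    apply: near_box => //.
    + rewrite lt_neqAle pt0 andbT; apply/eqP => tE.
      have : 1 <= mu * (th - p.1.1).
        rewrite /mu mulrAC ler_pdivlMr // mul1r -tE -[leLHS]mul1r -lagE.
        by rewrite mulrAC mulrC ler_pM2l //; lra.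
      by lra.
    + apply: sqn_lt_norm; first by rewrite mulr_ge0 // ltW.
      by rewrite exprMn; move: q9; rewrite /q; lra.
    + by move: ylt; rewrite ltr_norml => /andP[]; lra.
    + by left; move: ylt; rewrite ltr_norml => /andP[]; lra.
  have D := defectD (defectD (@gauss_defect_int R N c a b 0 0 x0 y0 p y00)
    (@parabola_defect R N c a 0 0 0 mu x0 p y00)) (defect_cst c a (- (e9 + mu * th)) p).
  have := defectZ m D; rewrite -/g; set d := m * _ => Dm.
  exists d; last exact: Dm.
  rewrite /d pmulr_rlt0 // !(mul0r, mulr0, addr0, add0r, expr0n, subr0) /=.
  set Y := p.2 - y0 in sy ylt *; set X := p.1.2 - x0 in sx *.
  have A1 : ndy a / 3 * rho ^+ 2 <= elliptic_form a X Y.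
    apply: le_trans (elliptic_ge _ _ (ltW ndy_gt0)).
    by rewrite ler_pM2l ?divr_gt0 // ltW.
  have cY : c * Y / p.2 <= 3 * `|c|.
    rewrite ler_pdivrMr //; apply: le_trans (ler_norm _) _; rewrite normrM.
    rewrite [3 * _]mulrC -mulrA; apply: ler_wpM2l => //; apply: ltW.
    by apply: lt_trans ylt _; rewrite ltr_pM2l.
  have gpos : 0 < g p by rewrite gE expR_gt0.
  have e9g : e9 < g p by lra.
  set B := elliptic_form a X Y in A1 *; set Z := c * Y / p.2 in cY *.
  pose i2 := (rho ^+ 2)^-1; have i20 : 0 < i2 by rewrite invr_gt0.
  have bE : b = - (lam * i2) by [].
  have muE : mu = e9 * i2 by [].
  have Bi : ndy a / 3 <= B * i2 by rewrite ler_pdivlMr.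
  (* The time penalty contributes [e9], which is below [g p] wherever the barrier is positive; the
     choice of [steep] makes the factor of [g p] at least 1. *)
  have -> : g p * (- (4 * b ^+ 2 * B) - 2 * b * (N%:R + 1 + Z)) + mu =
     i2 * (e9 - g p * lam * (4 * lam * (B * i2) - 2 * (N%:R + 1 + Z))).
    by rewrite bE muE; ring.
  rewrite pmulr_rlt0 // subr_lt0; apply: lt_le_trans e9g _.
  rewrite -mulrA; apply: ler_peMr; first exact: ltW.
  have : 4 * lam * (ndy a / 3) <= 4 * lam * (B * i2).
    by apply: ler_wpM2l => //; rewrite mulr_ge0 // ltW.
  have h1 (z : R) : 1 <= z -> 1 <= lam * z.
    move=> z1; apply: (le_trans z1); rewrite ler_peMl //; last exact: ltW.
    exact: le_trans z1.
  by move=> h2; apply: h1; lra.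
Qed.

End Growth.

(** * Chains of balls *)

Section Chain.
Context (R : realType) (N : nat) (c : R) (a : 'rV[R]_N) (T : R).
Notation pt := (R * 'rV[R]_N * R)%type.
Implicit Types (p : pt) (x : 'rV[R]_N).
Context (ndy_gt0 : 0 < ndy a) (c_gt : 0 < c + 1).

Lemma steep_ge1 : 1 <= steep c a.
Proof.
have h : 0 <= 2 * (N%:R + 1) + 6 * `|c| + 1.
  by have := normr_ge0 c; have : (0 : R) <= N%:R by []; lra.
by rewrite /steep lerDr divr_ge0 // mulr_ge0 // ltW.
Qed.

Lemma lag_ge1 : 1 <= lag c a.
Proof.
by rewrite /lag -expR0 ler_expR mulr_ge0 //; apply: le_trans steep_ge1.
Qed.

Lemma loss_gt0 : 0 < loss c a.
Proof. by rewrite /loss subr_gt0 ltr_expR ltrN2 ltr_pM2r ?ltr_nat // (lt_le_trans _ steep_ge1). Qed.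

Lemma loss_le1 : loss c a <= 1.
Proof.
rewrite /loss; have := expR_gt0 (- (9 * steep c a)).
have : expR (- (4 * steep c a)) <= 1.
  by rewrite -expR0 ler_expR oppr_le0 mulr_ge0 // (le_trans _ steep_ge1).
by lra.
Qed.

Section Walks.
Context (w : pt -> R) (w_sol : solution c a T w) (w_ge0 : forall p, 0 <= w p).
Notation low := (low T w).

Lemma low_sub t0 t0' x0 x0' (y0 y0' rho rho' m m' : R) :
  low t0 x0 y0 rho m -> t0 <= t0' -> m' <= m ->
  (forall x y, sqn (x - x0') + (y - y0') ^+ 2 <= rho' ^+ 2 ->
     sqn (x - x0) + (y - y0) ^+ 2 <= rho ^+ 2) ->
  low t0' x0' y0' rho' m'.
Proof.
move=> h tt mm hs t x y /andP[t1 t2] hq; apply: (le_trans mm); apply: h.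
  by rewrite t2 (le_trans tt).
exact: hs.
Qed.

(** Each step raises the centre by 4/5 r and takes the radius 6/5 r: since 4/5 + 6/5 = 2 the new
    ball lies in the doubled one, and 4 r + 4/5 r = 4 (6/5 r) keeps it at the required height. The
    times form a geometric sum, 3 + 1 <= 3 * 36/25, so the last radius controls the total. *)
Lemma climb J (rho t0 : R) x0 (y0 m : R) :
  0 < rho -> 4 * rho <= y0 -> 0 < m -> low t0 x0 y0 rho m ->
  let r := (6 / 5) ^+ J * rho in
  exists y1, [/\ 4 * r <= y1, y0 <= y1 <= y0 + 4 * r &
    low (t0 + 3 * lag c a * r ^+ 2) x0 y1 r (loss c a ^+ J * m)].
Proof.
move=> rho0 y0rho m0 hlow; have lag1 := lag_ge1.
have b0 : (0 : R) < 6 / 5 by [].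
elim: J => [|J [y1 [h1 /andP[h2 h3] h4]]] /=.
  rewrite !expr0 !mul1r; exists y0; split => //; first by apply/andP; lra.
  apply: low_sub hlow _ _ _ => //.
  by rewrite lerDl mulr_ge0 ?sqr_ge0 // mulr_ge0 //; lra.
set r := (6 / 5) ^+ J * rho in h1 h2 h3 h4 *.
have r0 : 0 < r by rewrite mulr_gt0 // exprn_gt0.
have -> : (6 / 5) ^+ J.+1 * rho = 6 / 5 * r by rewrite exprS mulrA.
exists (y1 + 4 / 5 * r); split; [by lra|by apply/andP; lra|].
have := growth ndy_gt0 c_gt w_sol w_ge0 r0 h1 _ h4.
move=> /(_ (mulr_gt0 (exprn_gt0 _ loss_gt0) m0)) /low_sub; apply.
- rewrite -addrA lerD2l.
  have : 0 <= lag c a * r ^+ 2 by rewrite mulr_ge0 ?sqr_ge0 //; lra.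
  have -> : (6 / 5 * r) ^+ 2 = 36 / 25 * r ^+ 2 by field.
  by lra.
- by rewrite exprS mulrA.
- move=> x y; set X := sqn _; have X0 : 0 <= X by exact: sqn_ge0.
  set Y := y - (y1 + 4 / 5 * r) => h.
  have -> : y - y1 = Y + 4 / 5 * r by rewrite /Y; ring.
  have Yr : Y <= 6 / 5 * r.
    apply: le_trans (ler_norm _) _; apply: sqr_le_norm; first by rewrite mulr_ge0 // ltW.
    by apply: le_trans h; rewrite lerDr.
  have Yr2 : r * Y <= r * (6 / 5 * r) by rewrite ler_pM2l.
  have : X + (Y + 4 / 5 * r) ^+ 2 = (X + Y ^+ 2) + 8 / 5 * (r * Y) + 16 / 25 * r ^+ 2.
    by field.
  have e1 : (6 / 5 * r) ^+ 2 = 36 / 25 * r ^+ 2 by field.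
  have e2 : (2 * r) ^+ 2 = 4 * r ^+ 2 by ring.
  have e3 : r * (6 / 5 * r) = 6 / 5 * r ^+ 2 by field.
  move: h Yr2; rewrite e1 e2 e3; lra.
Qed.

Lemma sqnD_le x x' (y y' r : R) :
  sqn x + y ^+ 2 <= r ^+ 2 -> sqn x' + y' ^+ 2 <= r ^+ 2 ->
  sqn (x + x') + (y + y') ^+ 2 <= (2 * r) ^+ 2.
Proof.
move=> h h'.
have : sqn (x + x') <= 2 * sqn x + 2 * sqn x'.
  rewrite /sqn !mulr_sumr -big_split /=; apply: ler_sum => i _; rewrite mxE.
  by have := sqr_ge0 (x ord0 i - x' ord0 i); lra.
by have := sqr_ge0 (y - y'); lra.
Qed.

(** Here doubling is spent on displacement: consecutive centres are at most s apart, so the next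
    ball of radius s lies in the doubled previous one. The centres lie on a segment, hence inherit
    the height condition from its ends. *)
Lemma walk n (s t0 : R) x0 x1 (y0 y1 m : R) :
  0 < s -> 4 * s <= y0 -> 4 * s <= y1 -> 0 < m -> (0 < n)%N ->
  sqn (x1 - x0) + (y1 - y0) ^+ 2 <= (n%:R * s) ^+ 2 ->
  low t0 x0 y0 s m ->
  low (t0 + n%:R * lag c a * s ^+ 2) x1 y1 s (loss c a ^+ n * m).
Proof.
move=> s0 sy0 sy1 m0 n0 hd hlow.
have nR : 0 < n%:R :> R by rewrite ltr0n.
pose xk k : 'rV[R]_N := x0 + (k%:R / n%:R) *: (x1 - x0).
pose yk k : R := y0 + (k%:R / n%:R) * (y1 - y0).
suff H k : (k <= n)%N ->
    low (t0 + k%:R * lag c a * s ^+ 2) (xk k) (yk k) s (loss c a ^+ k * m).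
  have := H n (leqnn n); rewrite /xk /yk divff ?gt_eqF // scale1r mul1r.
  by rewrite [x0 + _]addrC subrK [y0 + _]addrC subrK.
elim: k => [_|k ih kn].
  by rewrite /xk /yk !mul0r scale0r !addr0 expr0 mul1r.
have yk4 : 4 * s <= yk k.
  have -> : yk k = (1 - k%:R / n%:R) * y0 + (k%:R / n%:R) * y1 by rewrite /yk; ring.
  have k1 : k%:R / n%:R <= 1 :> R by rewrite ler_pdivrMr // mul1r ler_nat ltnW.
  have k0 : 0 <= k%:R / n%:R :> R by rewrite divr_ge0.
  have h1 : (1 - k%:R / n%:R) * (4 * s) <= (1 - k%:R / n%:R) * y0.
    by rewrite ler_wpM2l // subr_ge0.
  have h2 : (k%:R / n%:R) * (4 * s) <= (k%:R / n%:R) * y1 by rewrite ler_wpM2l.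
  by lra.
have := growth ndy_gt0 c_gt w_sol w_ge0 s0 yk4 _ (ih (ltnW kn)).
move=> /(_ (mulr_gt0 (exprn_gt0 _ loss_gt0) m0)) /low_sub; apply.
- by rewrite -addrA lerD2l -natr1 !mulrDl mul1r.
- by rewrite exprS mulrA.
- move=> x y h.
  have -> : x - xk k = (x - xk k.+1) + n%:R^-1 *: (x1 - x0).
    rewrite /xk -natr1 mulrDl scalerDl div1r.
    by apply/rowP => i; rewrite !mxE; ring.
  have -> : y - yk k = (y - yk k.+1) + n%:R^-1 * (y1 - y0).
    by rewrite /yk -natr1; ring.
  apply: sqnD_le h _.
  have -> : sqn (n%:R^-1 *: (x1 - x0)) = n%:R^-1 ^+ 2 * sqn (x1 - x0).
    by rewrite /sqn mulr_sumr; apply: eq_bigr => i _; rewrite mxE exprMn.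
  rewrite exprMn -mulrDr exprVn mulrC ler_pdivrMr ?exprn_gt0 //.
  by apply: (le_trans hd); rewrite exprMn mulrC.
Qed.

End Walks.

Lemma unbounded_expn (b K : R) : 1 < b -> exists n, K <= b ^+ n.
Proof.
move=> b1; pose d := b - 1; have d0 : 0 < d by rewrite subr_gt0.
have bern n : 1 + n%:R * d <= b ^+ n.
  elim: n => [|n ih]; first by rewrite mul0r addr0 expr0.
  rewrite exprS; have -> : b = 1 + d by rewrite /d; ring.
  apply: (@le_trans _ _ ((1 + d) * (1 + n%:R * d))).
    have h : 0 <= n%:R * d * d by rewrite !mulr_ge0 // ltW.
    by rewrite -natr1; lra.
  rewrite ler_wpM2l //; first by lra.
  by have -> : 1 + d = b by rewrite /d; ring.
exists (Num.trunc (K / d)).+1.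
apply: le_trans (bern _).
have := truncnS_gt (K / d); rewrite ltr_pdivrMr // => h.
by apply: ltW; apply: lt_trans h _; lra.
Qed.

End Chain.

(* A Harnack bound with constants independent of [w]: spread the slice to a ball
   (slice_spread), let the ball grow upwards to radius of order 1/r (climb) and
   carry it along a segment to (0, 1) in about r^2 steps (walk). *)
Lemma reach (R : realType) (N : nat) (c : R) (a : 'rV[R]_N) (T tau : R) :
  0 < ndy a -> 0 < c + 1 -> 0 < tau ->
  exists (C Lam : R) (n : nat), [/\ 0 < C, 1 <= Lam, (0 < n)%N &
  forall (w : R * 'rV[R]_N * R -> R) (ts : R) (x : 'rV[R]_N) (y m : R) (r : nat),
  solution c a T w -> (forall p, 0 <= w p) ->
  ts <= T - tau -> 0 < y -> 0 < m -> (0 < r)%N ->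
  sqn x + (y + 5) ^+ 2 <= r%:R ^+ 2 ->
  (forall t x', ts <= t <= T -> `|x' - x| <= 1 / 4 -> m <= w (t, x', y)) ->
  m * Num.min 1 y ^+ n <= C * Lam ^+ (r ^ 2) * w (T, 0, 1)].
Proof.
move=> ndy_gt0 c_gt tau0.
pose b : R := 6 / 5; have b1 : 1 < b by rewrite /b; lra.
have b0 : 0 < b by rewrite /b; lra.
have th0 := loss_gt0 c ndy_gt0; have th1 := loss_le1 c ndy_gt0.
set th := loss c a in th0 th1.
have L1 := lag_ge1 c ndy_gt0; set L := lag c a in L1.
have k1 := slope_ge1 N c; set k := slope N c in k1; have k0 : 0 < k by lra.
pose r0 : R := Num.min (1 / 4) (tau / 8).
have r00 : 0 < r0 by rewrite lt_min !divr_gt0.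
have r04 : r0 <= 1 / 4 by rewrite ge_min lexx.
have r08 : r0 <= tau / 8 by rewrite ge_min lexx orbT.
(* The exponent of y: with [th * b ^+ n.+1 >= 1], the loss [th ^+ J] of a climb is at least the
   power - (n + 1) of the enlargement [b ^+ J]. *)
have [n hn] := unbounded_expn th^-1 b1.
have {hn} thn : 1 <= th * b ^+ n.+1.
  rewrite -(mulfV (lt0r_neq0 th0)) ler_pM2l //; apply: (le_trans hn).
  by rewrite exprS ler_peMl ?exprn_ge0 // ltW.
(* A walk of [n0 * r ^ 2] steps of length 1 / (n0 r) lasts L / n0, at most tau / 12; [n0 >= 4] makes
   the balls small enough for the end point at height 1. *)
have [n0 n0E n04] : exists2 n0 : nat, 12 * L <= n0%:R * tau & 4 <= n0%:R :> R.
  exists (Num.trunc (12 * L / tau)).+4; last by rewrite (ler_nat R 4).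
  rewrite -ler_pdivrMr // ltW // (lt_le_trans (truncnS_gt _)) // ler_nat.
  by do 3!apply: leqW.
have n0p : (0 < n0)%N by rewrite -(ltr_nat R); lra.
pose al := b * (4 * k) / r0; have al0 : 0 < al by rewrite divr_gt0 // mulr_gt0 ?mulr_gt0.
exists (2 * al ^+ n.+1), (th^-1 ^+ n0), n.+1; split=> //.
- by rewrite mulr_gt0 // exprn_gt0.
- by rewrite exprn_ege1 // invf_ge1.
move=> w ts x y m r w_sol w_ge0 tsT y0 m0 rr0 hxy hsl.
have rR : 1 <= r%:R :> R by rewrite (ler_nat R 1).
(* The bound 1/4 is the width of the given slice, y / 4 the height condition, and tau / 8 keeps the
   waiting time short. *)
pose rs := Num.min r0 (y / 4).
have rs0 : 0 < rs by rewrite lt_min r00 divr_gt0.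
have rsr0 : rs <= r0 by rewrite ge_min lexx.
have rsy : rs <= y / 4 by rewrite ge_min lexx orbT.
have rsl : r0 * Num.min 1 y <= rs.
  rewrite le_min; apply/andP; split.
    by rewrite ler_piMr ?(ltW r00) // ge_min lexx.
  apply: (@le_trans _ _ (1 / 4 * y)); last by lra.
  have m1y : Num.min 1 y <= y by rewrite ge_min lexx orbT.
  have m01 : 0 <= Num.min 1 y by rewrite le_min ler01 ltW.
  by apply: ler_pM => //; exact: ltW.
pose rb := rs / (4 * k); have rb0 : 0 < rb by rewrite divr_gt0 // mulr_gt0.
have rbs : rb <= rs by rewrite ler_pdivrMr ?mulr_gt0 // ler_peMr ?(ltW rs0) //; lra.
have low1 : low T w (ts + 2 * rs ^+ 2) x y rb (m / 2).
  apply: (slice_spread ndy_gt0 c_gt w_sol w_ge0 rs0) => //; first by lra.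
  by move=> t x' tt xx; apply: hsl => //; lra.
pose s : R := (n0%:R * r%:R)^-1.
have nr4 : 4 <= n0%:R * r%:R :> R.
  by rewrite -[leLHS]mulr1; apply: ler_pM.
have s0 : 0 < s by rewrite invr_gt0; lra.
have s4 : 4 * s <= 1 by rewrite /s ler_pdivrMr ?mul1r //; lra.
(* The least number of enlargements leading from [rb] to at least [s]; minimality and [s <= 1] bound
   the enlargement. The starting radius is then shrunk to [rh], so that the climb ends exactly at
   [s]. *)
have [J hJ0 hJmin] : exists2 J, s <= rb * b ^+ J & b ^+ J <= b / rb.
  have exJ : exists J, s <= rb * b ^+ J.
    have [J hJ] := unbounded_expn (s / rb) b1; exists J.
    by move: hJ; rewrite ler_pdivrMr // mulrC.
  exists (ex_minn exJ); first by case: ex_minnP.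
  case: ex_minnP => -[|J] hJ Jmin.
    rewrite expr0 ler_pdivlMr // mul1r; lra.
  rewrite exprS ler_pM2l // -[leRHS]mul1r ler_pdivlMr // mulrC.
  have : rb * b ^+ J < s by rewrite ltNge; apply/negP => /Jmin; rewrite ltnn.
  by lra.
have bJ0 : 0 < b ^+ J by rewrite exprn_gt0.
pose rh := s / b ^+ J; have rh0 : 0 < rh by rewrite divr_gt0.
have rhb : rh <= rb by rewrite ler_pdivrMr.
have rhs : b ^+ J * rh = s by rewrite mulrC divfK // gt_eqF.
have low2 : low T w (ts + 2 * rs ^+ 2) x y rh (m / 2).
  apply: (low_sub low1) => // x' y' h; apply: (le_trans h).
  by rewrite ler_sqr ?nnegrE // ltW.
have m20 : 0 < m / 2 by rewrite divr_gt0.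
have rhy : 4 * rh <= y by clear - rhb rbs rsy; lra.
have [y1 [h1 /andP[h2 h3] low3]] :=
  climb ndy_gt0 c_gt w_sol w_ge0 J rh0 rhy m20 low2.
rewrite -/b rhs in h1 h3 low3.
pose n1 := (n0 * r ^ 2)%N.
have n10 : (0 < n1)%N by rewrite muln_gt0 n0p expn_gt0 rr0.
have n1s : n1%:R * s = r%:R.
  rewrite /n1 /s natrM natrX expr2 invfM.
  by field; rewrite !gt_eqF //; lra.
have thJ0 : 0 < th ^+ J * (m / 2) by rewrite mulr_gt0 // exprn_gt0.
(* The climb raises the centre by at most [4 * s <= 1]; the 5 in the hypothesis leaves room for this
   and for the target height 1. *)
have hd : sqn (0 - x) + (1 - y1) ^+ 2 <= (n1%:R * s) ^+ 2.
  rewrite n1s; apply: le_trans hxy.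
  have -> : sqn (0 - x) = sqn x.
    by rewrite /sqn; apply: eq_bigr => i _; rewrite !mxE sub0r sqrrN.
  by rewrite lerD2l -subr_ge0 subr_sqr mulr_ge0 //; clear - h2 h3 s4 y0; lra.
have sy1 : 4 * s <= 1 by [].
have low4 := walk ndy_gt0 c_gt w_sol w_ge0 s0 h1 sy1 thJ0 n10 hd low3.
have wT : th ^+ n1 * (th ^+ J * (m / 2)) <= w (T, 0, 1).
  apply: low4.
    rewrite lexx andbT.
    have q1 : 2 * rs ^+ 2 <= tau / 4.
      have h : rs * rs <= (1 / 4 : R) * (tau / 8).
        clear - rs0 rsr0 r04 r08.
        by apply: ler_pM; [exact: ltW|exact: ltW|lra|lra].
      by rewrite expr2; clear - tau0 h; lra.
    have sr : r%:R * s = n0%:R^-1.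
      by rewrite /s; clear - n04 rR; field; rewrite !gt_eqF //; lra.
    have n00 : 0 < n0%:R :> R by clear - n04; lra.
    have Ln : L / n0%:R <= tau / 12 by rewrite ler_pdivrMr //; clear - n0E; lra.
    have sL : n1%:R * L * s ^+ 2 <= tau / 4.
      have -> : n1%:R * L * s ^+ 2 = L * (n1%:R * s * s) by ring.
      by rewrite n1s sr; clear - Ln tau0; lra.
    have q2 : 3 * L * s ^+ 2 <= tau / 4.
      have s1 : s ^+ 2 <= r%:R * s by rewrite expr2 ler_pM2r //; clear - s4 rR s0; lra.
      have h : L * s ^+ 2 <= L * (r%:R * s) by rewrite ler_wpM2l //; clear - L1; lra.
      by move: h; rewrite sr => h; clear - Ln tau0 h; lra.
    by rewrite -/L; clear - sL q2 q1 tsT tau0; lra.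
  rewrite !subrr /sqn big1 ?add0r; last by move=> i _; rewrite mxE expr0n.
  by rewrite expr0n /= ?addr0 sqr_ge0.
have mal : Num.min 1 y * b ^+ J <= al.
  have m00 : 0 < Num.min 1 y by rewrite lt_min ltr01.
  apply: (@le_trans _ _ (Num.min 1 y * (b / rb))); first by rewrite ler_pM2l.
  rewrite mulrA ler_pdivrMr // /al /rb.
  have -> : b * (4 * k) / r0 * (rs / (4 * k)) = b * (rs / r0).
    by field; rewrite !gt_eqF // ?mulr_gt0.
  by rewrite mulrC ler_pM2l // ler_pdivlMr // mulrC.
(* The loss of the climb is traded for a power of y: [min 1 y * b ^+ J] is bounded by [al], and
   [th * b ^+ n.+1 >= 1]. *)
have mn : Num.min 1 y ^+ n.+1 <= th ^+ J * al ^+ n.+1.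
  have m00 : 0 <= Num.min 1 y by rewrite le_min ler01 ltW.
  apply: (@le_trans _ _ (th ^+ J * (Num.min 1 y * b ^+ J) ^+ n.+1)); last first.
    rewrite ler_pM2l ?exprn_gt0 //; apply: lerXn2r => //; rewrite nnegrE ?(ltW al0) //.
    by rewrite mulr_ge0 // ltW.
  have -> : th ^+ J * (Num.min 1 y * b ^+ J) ^+ n.+1 =
     Num.min 1 y ^+ n.+1 * (th * b ^+ n.+1) ^+ J.
    by rewrite !exprMn -!exprM [(J * _)%N]mulnC; ring.
  by rewrite ler_peMr ?exprn_ge0 // exprn_ege1.
have thn1 : 0 < th ^+ n1 by rewrite exprn_gt0.
have -> : (th^-1 ^+ n0) ^+ (r ^ 2) = (th ^+ n1)^-1.
  by rewrite -exprM exprVn /n1.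
rewrite mulrAC ler_pdivlMr //.
apply: (@le_trans _ _ (m * (th ^+ J * al ^+ n.+1) * th ^+ n1)).
  by rewrite ler_pM2r // ler_pM2l.
have -> : m * (th ^+ J * al ^+ n.+1) * th ^+ n1 =
   2 * al ^+ n.+1 * (th ^+ n1 * (th ^+ J * (m / 2))).
  by move: (th ^+ n1) (th ^+ J) (al ^+ n.+1) => A1 A2 A3; field.
by rewrite ler_pM2l // mulr_gt0 // exprn_gt0.
Qed.

(** * The extended solution *)

Section LineDerivatives.
Context (R : realType) (N : nat).
Notation pt := (R * 'rV[R]_N * R)%type.
Implicit Types (Q : set pt) (u : pt -> R) (p q v : pt).

Lemma mvt_signed (g dg : R -> R) (d k : R) :
  (forall s, `|s| < d -> is_derive (s : R) (1 : R) g (dg s)) -> `|k| < d ->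
  exists2 s, `|s| <= `|k| & g k - g 0 = dg s * k.
Proof.
move=> hg kd.
have cg s : `|s| < d -> {for s, continuous g}.
  move=> sd; have hs := hg s sd.
  by apply: differentiable_continuous; apply/derivable1_diffP; exact: ex_derive.
have [k0|k0|<-] := ltgtP 0 k.
- have [||s] := @MVT R g dg 0 k k0.
  + move=> s; rewrite in_itv /= => /andP[s0 sk]; apply: hg.
    by rewrite gtr0_norm // (lt_trans sk) // (le_lt_trans (ler_norm _) kd).
  + apply: continuous_in_subspaceT => s; rewrite inE /= in_itv /= => /andP[s0 sk].
    apply: cg; rewrite ger0_norm // (le_lt_trans sk) //.
    exact: le_lt_trans (ler_norm _) kd.
  rewrite in_itv /= subr0 => /andP[s0 sk] E; exists s => //.
  by rewrite !gtr0_norm // ltW.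
- have [||s] := @MVT R g dg k 0 k0.
  + move=> s; rewrite in_itv /= => /andP[s0 sk]; apply: hg.
    rewrite ltr0_norm //; move: kd; rewrite (ltr0_norm k0); lra.
  + apply: continuous_in_subspaceT => s; rewrite inE /= in_itv /= => /andP[s0 sk].
    apply: cg; rewrite ler0_norm //; move: kd; rewrite (ltr0_norm k0); lra.
  rewrite in_itv /= sub0r => /andP[s0 sk] E; exists s.
    by rewrite !ltr0_norm // lerN2 ltW.
  by rewrite -opprB E mulrN opprK.
- by exists 0; rewrite ?subrr ?mulr0.
Qed.

Lemma derivable_in_cvg Q u v p : derivable_in Q u v p ->
  h^-1 * (u (p + h *: v) - u p) @[h --> within [set h : R | Q (p + h *: v)] 0^'] -->
  D_in Q v u p.
Proof. by []. Qed.

Lemma quot_D_in Q u v p : derivable_in Q u v p ->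
  (\forall h \near (0 : R)^'+, Q (p + h *: v)) -> quot 1 u p v (D_in Q v u p).
Proof.
move=> /derivable_in_cvg hd hQ.
have : h^-1 * (u (p + h *: v) - u p) @[h --> (0 : R)^'+] --> D_in Q v u p.
  apply: cvg_trans hd; apply: cvg_app => A hA.
  have hA' : \forall h \near (0 : R)^'+, Q (p + h *: v) -> A h.
    case: hA => e /= e0 hA; exists e => //= h he h0 Qh.
    by apply: hA => //; rewrite gt_eqF.
  by near=> h; apply: (near hA' h) => //; near: h.
apply: cvg_trans; apply: near_eq_cvg; near=> h.
by rewrite expr1 mulrC.
Unshelve. all: by end_near. Qed.

Lemma quot_D_inN Q u v p : derivable_in Q u v p ->
  (\forall h \near (0 : R)^'+, Q (p - h *: v)) -> quot 1 u p (- v) (- D_in Q v u p).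
Proof.
move=> /derivable_in_cvg hd hQ.
have : (- h)^-1 * (u (p + (- h) *: v) - u p) @[h --> (0 : R)^'+] --> D_in Q v u p.
  have hN : - h @[h --> (0 : R)^'+] --> within [set h : R | Q (p + h *: v)] 0^'.
    move=> A [e /= e0 hA].
    have hA' : \forall h \near (0 : R)^'+, Q (p - h *: v) -> A (- h).
      exists e => //= h he h0 Qh; apply: hA => //=.
      - by move: he; rewrite /= !sub0r opprK normrN.
      - by rewrite oppr_eq0 gt_eqF.
      - by rewrite scaleNr.
    by apply: filterS2 hQ hA' => h Qh; exact.
  exact: (@cvg_comp _ _ _ (fun h : R => - h)
    (fun h => h^-1 * (u (p + h *: v) - u p)) _ _ _ hN hd).
move=> H; apply: cvg_trans (cvgN H); apply: near_eq_cvg; near=> h.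
by rewrite /= ?fctE expr1 scaleNr scalerN invrN mulNr opprK mulrC.
Unshelve. all: by end_near. Qed.

Lemma line_is_derive_at Q u v p (h : R) :
  (\forall k \near (0 : R), Q (p + h *: v + k *: v)) ->
  derivable_in Q u v (p + h *: v) ->
  is_derive (h : R) (1 : R) (fun s => u (p + s *: v)) (D_in Q v u (p + h *: v)).
Proof.
move=> hQ /derivable_in_cvg H.
have E : k^-1 *: (u (p + (k *: (1 : R) + h) *: v) - u (p + h *: v)) @[k --> (0 : R)^'] -->
    D_in Q v u (p + h *: v).
  have : k^-1 * (u (p + h *: v + k *: v) - u (p + h *: v)) @[k --> (0 : R)^'] -->
      D_in Q v u (p + h *: v).
    apply: cvg_trans H; apply: cvg_app => A hA.
    have hA' : \forall k \near (0 : R)^', Q (p + h *: v + k *: v) -> A k by [].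
    have hk : \forall k \near (0 : R)^', Q (p + h *: v + k *: v).
      by apply: cvg_within; exact: hQ.
    by apply: filterS2 hk hA' => k Qk; exact.
  apply: cvg_trans; apply: near_eq_cvg; near=> k.
  have -> : k *: (1 : R) = k by rewrite /GRing.scale /= mulr1.
  by rewrite [k + h]addrC scalerDl addrA.
split; first by apply/cvg_ex; eexists; exact: E.
exact: cvg_lim E.
Unshelve. all: by end_near. Qed.

Lemma line_is_derive Q u v p (d : R) :
  (forall h : R, `|h| < d -> Q (p + h *: v)) ->
  (forall q, Q q -> derivable_in Q u v q) ->
  forall h, `|h| < d ->
    is_derive (h : R) (1 : R) (fun s => u (p + s *: v)) (D_in Q v u (p + h *: v)).
Proof.
move=> hQ hd h hh; apply: line_is_derive_at; last by apply: hd; exact: hQ.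
have d0 : 0 < d - `|h| by rewrite subr_gt0.
have hk0 : \forall k \near (0 : R), `|k| < d - `|h| by exact: nbhs0_lt.
move: hk0; apply: filterS => k kd; rewrite -addrA -scalerDl; apply: hQ.
by apply: le_lt_trans (ler_normD _ _) _; move: kd; rewrite ltrBrDl.
Qed.

Lemma diff2_D_in Q u v p (d : R) : 0 < d ->
  (forall h : R, `|h| < d -> Q (p + h *: v)) ->
  (forall q, Q q -> derivable_in Q u v q) ->
  (forall q, Q q -> derivable_in Q (D_in Q v u) v q) ->
  diff2 u p v (D_in Q v (D_in Q v u) p).
Proof.
move=> d0 hQ hd hdd.
have h1 := line_is_derive hQ hd; have h2 := line_is_derive hQ hdd.
have E0 : p + 0 *: v = p by rewrite scale0r addr0.
have [||_ + _] := @line_derive R N u p v (fun h => D_in Q v u (p + h *: v))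
  (D_in Q v (D_in Q v u) p); last by [].
- have hk0 : \forall k \near (0 : R), `|k| < d by exact: nbhs0_lt.
  by move: hk0; apply: filterS; exact: h1.
- by have := h2 0; rewrite normr0 E0; apply.
Qed.

(** The mean value theorem along [v'] for the increment of [u] over [h *: v], then along [v] for the
    derivative [D_in Q v' u]. *)
Lemma mixed_difference Q u v v' p (d h k : R) :
  (forall h k : R, `|h| < d -> `|k| < d -> Q (p + h *: v + k *: v')) ->
  (forall q, Q q -> derivable_in Q u v' q) ->
  (forall q, Q q -> derivable_in Q (D_in Q v' u) v q) ->
  `|h| < d -> `|k| < d ->
  exists s r, [/\ `|s| <= `|h|, `|r| <= `|k| &
    u (p + h *: v + k *: v') - u (p + h *: v) - u (p + k *: v') + u p =
    h * k * D_in Q v (D_in Q v' u) (p + s *: v + r *: v')].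
Proof.
move=> hQ hd hdd hh kd.
have d0 : `|0 : R| < d by rewrite normr0; apply: le_lt_trans kd.
have l1 := @line_is_derive Q u v' (p + h *: v) d (fun k => hQ h k hh) hd.
have hQ0 k' : `|k'| < d -> Q (p + k' *: v').
  by move=> kd'; have := hQ 0 k' d0 kd'; rewrite scale0r addr0.
have l2 := @line_is_derive Q u v' p d hQ0 hd.
pose g s := u (p + h *: v + s *: v') - u (p + s *: v').
have [|r rk rE] := @mvt_signed g
  (fun s => D_in Q v' u (p + h *: v + s *: v') - D_in Q v' u (p + s *: v')) d k _ kd.
  move=> s sd; have := l1 s sd; have := l2 s sd => h2 h1.
  exact: is_deriveB.
have rd : `|r| < d by apply: le_lt_trans kd.
have hQr h' : `|h'| < d -> Q (p + r *: v' + h' *: v).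
  by move=> hd'; rewrite addrAC; apply: hQ.
have l3 := @line_is_derive Q (D_in Q v' u) v (p + r *: v') d hQr hdd.
have [s sh sE] := @mvt_signed (fun s => D_in Q v' u (p + r *: v' + s *: v)) _ d h l3 hh.
exists s, r; split => //.
move: rE sE; rewrite /g !scale0r !addr0 [p + r *: v' + h *: v]addrAC => rE sE.
rewrite [p + s *: v + _]addrAC.
transitivity (u (p + h *: v + k *: v') - u (p + k *: v') - (u (p + h *: v) - u p)).
  by ring.
by rewrite rE sE; ring.
Qed.

End LineDerivatives.

Section ObliqueDifferences.
Context (R : realType) (N : nat) (c : R) (a : 'rV[R]_N).
Notation pt := (R * 'rV[R]_N * R)%type.
Implicit Types (p q v : pt).

Lemma within_cont_line (Q : set pt) (M : pt -> R) p v v' (d : R) :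
  0 < d -> {within Q, continuous M} -> Q p ->
  (forall h k : R, `|h| < d -> `|k| < d -> Q (p + h *: v + k *: v')) ->
  forall e, 0 < e -> exists2 r, 0 < r & forall h k, `|h| < r -> `|k| < r ->
    `|M (p + h *: v + k *: v') - M p| <= e.
Proof.
move=> d0 /subspace_continuousP cM Qp hQ e e0.
have /cvgrPdist_le /(_ e e0) H := cM p Qp.
have cl : (p + hk.1 *: v + hk.2 *: v') @[hk --> ((0, 0) : R * R)] --> p.
  have -> : p = p + (0 : R) *: v + (0 : R) *: v' by rewrite !scale0r !addr0.
  apply: cvgD; first apply: cvgD.
  - by rewrite scale0r scale0r !addr0; exact: cvg_cst.
  - by apply: cvgZl; exact: cvg_fst.
  - by apply: cvgZl; exact: cvg_snd.
have /nbhs_ballP [r /= r0 hr] := cl _ H.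
exists (Num.min r d); first by rewrite lt_min r0.
move=> h k; rewrite !lt_min => /andP[hr1 hd] /andP[kr1 kd].
rewrite distrC; apply: (hr (h, k)).
  by split; rewrite /ball /= sub0r normrN.
exact: hQ.
Qed.

Lemma diff2_scale (f : pt -> R) p v k al :
  diff2 f p v k -> diff2 f p (al *: v) (al ^+ 2 * k).
Proof.
move=> hk; have [->|al0] := eqVneq al 0.
  apply: cvg_near_cst; near=> h.
  by rewrite scale0r scaler0 addr0 subr0 expr0n /= mul0r; ring.
have al0' : 0 < `|al| by rewrite normr_gt0.
have cN : `|al| * h @[h --> (0 : R)^'+] --> (0 : R)^'+.
  move=> A [e /= e0 hA]; exists (e / `|al|); first by rewrite /= divr_gt0.
  move=> h /=; rewrite sub0r normrN ltr_pdivlMr // => he h0.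
  apply: hA; last by rewrite mulr_gt0.
  by rewrite /= sub0r normrN normrM normr_id mulrC.
have := @cvg_comp _ _ _ (fun h : R => `|al| * h)
    (fun h => (f (p + h *: v) + f (p - h *: v) - 2 * f p) / h ^+ 2) _ _ _ cN hk.
move=> H; apply: cvg_trans (cvgM (cvg_cst (al ^+ 2)) H); apply: near_eq_cvg; near=> h.
have h0 : 0 < h by near: h; exact: nbhs_right_gt.
rewrite ?fctE /= !scalerA exprMn real_normK ?num_real //.
have -> : f (p + (h * al) *: v) + f (p - (h * al) *: v) =
  f (p + (`|al| * h) *: v) + f (p - (`|al| * h) *: v).
  have [ap|an] := leP 0 al; first by rewrite ger0_norm // mulrC.
  by rewrite ltr0_norm // mulNr mulrC scaleNr opprK addrC.
by field; rewrite al0 gt_eqF.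
Unshelve. all: by end_near. Qed.

(** The oblique second difference is the sum of those along [v] and [al *: v'] and of the mixed
    differences at (h, al h) and (-h, -al h). Each of the latter is a value of the mixed derivative
    at a nearby point, and continuity of that derivative gives the limit. *)
Lemma diff2_oblique (Q : set pt) (u : pt -> R) p v v' (d al : R) :
  0 < d ->
  (forall h k : R, `|h| < d -> `|k| < d -> Q (p + h *: v + k *: v')) ->
  (forall q, Q q -> derivable_in Q u v' q) ->
  (forall q, Q q -> derivable_in Q (D_in Q v' u) v q) ->
  {within Q, continuous (D_in Q v (D_in Q v' u))} ->
  forall k k', diff2 u p v k -> diff2 u p v' k' ->
  diff2 u p (v + al *: v')
    (k + al ^+ 2 * k' + 2 * al * D_in Q v (D_in Q v' u) p).
Proof.
move=> d0 hQ hd hdd cM k k' hk hk'.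
have Qp : Q p by have := hQ 0 0; rewrite normr0 !scale0r !addr0; apply.
set M := D_in Q v (D_in Q v' u).
pose D h k := u (p + h *: v + k *: v') - u (p + h *: v) - u (p + k *: v') + u p.
have DE (s : R) : `|s| = 1 ->
    D (s * h) (s * (h * al)) / h ^+ 2 @[h --> (0 : R)^'+] --> al * M p.
  move=> s1; apply/cvgrPdist_le => e e0.
  have e1 : 0 < e / (`|al| + 1) by rewrite divr_gt0 // ltr_wpDl.
  have [r r0 hr] := within_cont_line d0 cM Qp hQ e1.
  pose m := Num.min r d / (`|al| + 1).
  have m0 : 0 < m by rewrite divr_gt0 ?lt_min ?r0 // ltr_wpDl.
  near=> h.
  have h0 : 0 < h by near: h; exact: nbhs_right_gt.
  have hm : h < m by near: h; exact: nbhs_right_lt.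
  have hm' : h * (`|al| + 1) < Num.min r d by rewrite -ltr_pdivlMr // ltr_wpDl.
  have al0 := normr_ge0 al.
  have nh : `|s * h| = h by rewrite normrM s1 mul1r gtr0_norm.
  have nk : `|s * (h * al)| = h * `|al| by rewrite normrM s1 mul1r normrM gtr0_norm.
  have hal : 0 <= h * `|al| by rewrite mulr_ge0 // ltW.
  have h1 : h < Num.min r d by move: hm'; rewrite mulrDr mulr1; lra.
  have h2 : h * `|al| < Num.min r d by move: hm'; rewrite mulrDr mulr1; lra.
  move: h1 h2; rewrite !lt_min => /andP[hr1 hd1] /andP[hr2 hd2].
  have [||z [w [zh wk E]]] := mixed_difference hQ hd hdd (h := s * h) (k := s * (h * al)).
  - by rewrite nh.
  - by rewrite nk.
  rewrite /D E -/M; have -> : s * h * (s * (h * al)) = s ^+ 2 * al * h ^+ 2 by ring.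
  have -> : s ^+ 2 = 1 by rewrite -real_normK ?num_real // s1 expr1n.
  rewrite mul1r mulrAC mulfK ?gt_eqF ?exprn_gt0 // -mulrBr normrM distrC.
  have := hr z w; rewrite nh in zh; rewrite nk in wk.
  move=> /(_ (le_lt_trans zh hr1) (le_lt_trans wk hr2)) hz.
  apply: (@le_trans _ _ (`|al| * (e / (`|al| + 1)))); first by rewrite ler_wpM2l.
  by rewrite mulrA ler_pdivrMr ?ltr_wpDl // mulrC ler_pM2l // lerDl.
have H1 := DE 1 (normr1 _).
have N1 : `|-1 : R| = 1 by rewrite normrN normr1.
have H2 := DE (-1) N1.
have -> : k + al ^+ 2 * k' + 2 * al * M p =
  k + al ^+ 2 * k' + al * M p + al * M p by ring.
apply: cvg_trans (cvgD (cvgD (cvgD hk (diff2_scale (al := al) hk')) H1) H2).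
apply: near_eq_cvg; near=> h.
rewrite ?fctE /= /D !mulN1r !mul1r !scaleNr !scalerDr !scalerA opprD !addrA.
by ring.
Unshelve. all: by end_near. Qed.

Lemma quot_eq n (f g : pt -> R) p v k : f p = g p ->
  (\forall h \near (0 : R)^'+, f (p + h *: v) = g (p + h *: v)) ->
  quot n g p v k -> quot n f p v k.
Proof.
move=> fp hfg; apply: cvg_trans; apply: near_eq_cvg.
by apply: filterS hfg => h ->; rewrite fp.
Qed.

Lemma diff2_eq (f g : pt -> R) p v k : f p = g p ->
  (\forall h \near (0 : R)^'+, f (p + h *: v) = g (p + h *: v)) ->
  (\forall h \near (0 : R)^'+, f (p - h *: v) = g (p - h *: v)) ->
  diff2 g p v k -> diff2 f p v k.
Proof.
move=> fp hfg hfg'; apply: cvg_trans; apply: near_eq_cvg.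
by apply: filterS2 hfg hfg' => h -> ->; rewrite fp.
Qed.

(** [defect] never looks forward in time, so this covers t = 0 itself, where the extension by 0 is
    glued to [u]. *)
Lemma defect_past0 (f : pt -> R) p :
  (forall q, q.1.1 <= p.1.1 -> f q = 0) -> defect c a f p 0.
Proof.
move=> f0.
have fp : f p = 0 by apply: f0.
have Q n v : v.1.1 <= 0 -> quot n f p v 0.
  move=> v0; apply: cvg_near_cst; near=> h.
  have h0 : 0 < h by near: h; exact: nbhs_right_gt.
  rewrite fp f0 ?subrr ?mul0r //= gerDl.
  by rewrite /GRing.scale /= pmulr_rle0.
have D v : v.1.1 = 0 -> diff2 f p v 0.
  move=> v0; apply: cvg_near_cst; near=> h.
  rewrite fp !f0 /= ?v0 ?scaler0 ?subr0 ?addr0 //.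
  by rewrite mulr0 subrr mul0r.
split=> _.
- exists 0, 0, 0, (fun=> 0); rewrite oppr0; split.
  + by apply: Q => /=; rewrite oppr_le0.
  + by split; apply: Q => //=; rewrite oppr0.
  + exact: D.
  + by move=> i; apply: D => /=; rewrite scaler0 addr0.
  + by rewrite big1 // !mulr0 !addr0 subr0.
- exists 0, 0, (fun=> 0); rewrite oppr0 mul0r; split.
  + by apply: Q => /=; rewrite oppr_le0.
  + exact: Q.
  + by move=> i; exact: D.
  + by rewrite big1 // !mulr0 !addr0 subr0.
Unshelve. all: by end_near. Qed.

End ObliqueDifferences.

Lemma cvg_sumr (R : realType) (S : Type) (F : set_system S) (FF : Filter F)
    (I : Type) (s : seq I) (f : I -> S -> R) (l : I -> R) :
  (forall i, f i z @[z --> F] --> l i) ->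
  \sum_(i <- s) f i z @[z --> F] --> \sum_(i <- s) l i.
Proof.
move=> hf; elim: s => [|i s ih].
  by rewrite big_nil; apply: cvg_near_cst; near=> z; rewrite big_nil.
rewrite big_cons; apply: cvg_trans (cvgD (hf i) ih); apply: near_eq_cvg.
by near=> z; rewrite big_cons.
Unshelve. all: by end_near. Qed.

Lemma at_right_unique (R : realType) (f : R -> R) (l l' : R) :
  f h @[h --> 0^'+] --> l -> f h @[h --> 0^'+] --> l' -> l = l'.
Proof.
move=> h1 h2; rewrite -(cvg_lim (@Rhausdorff R) h1).
exact: (cvg_lim (@Rhausdorff R) h2).
Qed.

Section Extension.
Context (R : realType) (N : nat) (c : R) (a : 'rV[R]_N) (T : R) (hT : 0 < T).
Notation pt := (R * 'rV[R]_N * R)%type.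
Implicit Types (p q v : pt).
Context (u : pt -> R) (u_C12 : C12 `]0, T] u)
  (u_C0 : {within cyl `[0, T], continuous u})
  (u_ge0 : forall p, cyl `[0, T] p -> 0 <= u p)
  (u_eq : solves_parabolic c a `]0, T] u)
  (u_init : forall (x : 'rV[R]_N) (y : R), 0 <= y -> u (0, x, y) = 0)
  (u_neumann : neumann c `]0, T] u).

Let Q : set pt := cyl `]0, T].

Definition clamp (p : pt) : pt :=
  (Num.min (Num.max p.1.1 0) T, p.1.2, Num.max p.2 0).

(* [u] vanishes at time 0, so constant extension in time and across [y = 0]
   yields a function which is continuous on the whole space. *)
Definition extension (p : pt) : R := u (clamp p).

Lemma clamp_cyl p : cyl `[0, T] (clamp p).
Proof.
split; rewrite /= ?in_itv /= ?le_max ?lexx ?orbT //.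
by rewrite le_min le_max lexx orbT (ltW hT) /= ge_min lexx orbT.
Qed.

Lemma clamp_id p : 0 <= p.1.1 <= T -> 0 <= p.2 -> clamp p = p.
Proof.
case: p => -[t x] y /= /andP[t0 tT] y0.
by rewrite /clamp /= (max_idPl t0) (min_idPl tT) (max_idPl y0).
Qed.

Lemma extension_ge0 p : 0 <= extension p.
Proof. by apply: u_ge0; exact: clamp_cyl. Qed.

Lemma extension_past p : p.1.1 <= 0 -> extension p = 0.
Proof.
move=> t0; rewrite /extension /clamp (max_idPr t0) (min_idPl (ltW hT)).
by apply: u_init; rewrite le_max lexx orbT.
Qed.

Lemma extension_id p : 0 <= p.1.1 <= T -> 0 <= p.2 -> extension p = u p.
Proof. by move=> h1 h2; rewrite /extension clamp_id. Qed.

Lemma clamp_continuous : continuous clamp.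
Proof.
have cst (k : R) : continuous (fun _ : pt => k) by move=> q; exact: cvg_cst.
have ct : continuous (fun p : pt => Num.min (Num.max p.1.1 0) T).
  move=> p; apply: (@continuous_min _ _ (fun p : pt => Num.max p.1.1 0) (fun=> T)).
    apply: (@continuous_max _ _ (fun p : pt => p.1.1) (fun=> 0)).
      exact: continuous_t.
    exact: cst.
  exact: cst.
have cy : continuous (fun p : pt => Num.max p.2 0).
  move=> p; apply: (@continuous_max _ _ (fun p : pt => p.2) (fun=> 0)).
    exact: continuous_y.
  exact: cst.
by move=> p; exact: (cvg_pair (cvg_pair (ct p) (@continuous_x R N p)) (cy p)).
Qed.

Lemma extension_continuous : continuous extension.
Proof.
move=> p; move/subspace_continuousP : u_C0 => /(_ _ (clamp_cyl p)) H A /H hA.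
have : nbhs p (clamp @^-1` _) := @clamp_continuous p _ hA.
apply: filterS => q hq; apply: hq.
exact: clamp_cyl.
Qed.

Lemma Q_in p : 0 < p.1.1 <= T -> 0 <= p.2 -> Q p.
Proof. by move=> h1 h2; split=> //=; rewrite in_itv. Qed.

Lemma Q_time p : Q p -> 0 < p.1.1 <= T.
Proof. by case=> /=; rewrite in_itv. Qed.

Lemma Q_y p : Q p -> 0 <= p.2.
Proof. by case. Qed.

Lemma extension_Q p : Q p -> extension p = u p.
Proof.
move=> Qp; apply: extension_id; last exact: Q_y.
by have /andP[/ltW -> ->] := Q_time Qp.
Qed.

Let Dt := D_in Q (dir_t R N) u.
Let Dy := D_in Q (dir_y R N) u.
Let Dyy := D_in Q (dir_y R N) Dy.
Let Dxx i := D_in Q (dir_x R i) (D_in Q (dir_x R i) u).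
Let Dxy i := D_in Q (dir_x R i) Dy.

Lemma der_t q : Q q -> derivable_in Q u (dir_t R N) q.
Proof. by case: u_C12 => _ [H _] _ _; exact: H. Qed.

Lemma der_y q : Q q -> derivable_in Q u (dir_y R N) q.
Proof. by case: u_C12 => _ _ H _; have [h _] := H None; exact: h. Qed.

Lemma der_x i q : Q q -> derivable_in Q u (dir_x R i) q.
Proof. by case: u_C12 => _ _ H _; have [h _] := H (Some i); exact: h. Qed.

Lemma der_yy q : Q q -> derivable_in Q Dy (dir_y R N) q.
Proof. by case: u_C12 => _ _ _ H; have [h _] := H None None; exact: h. Qed.

Lemma der_xx i q : Q q -> derivable_in Q (D_in Q (dir_x R i) u) (dir_x R i) q.
Proof. by case: u_C12 => _ _ _ H; have [h _] := H (Some i) (Some i); exact: h. Qed.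

Lemma der_xy i q : Q q -> derivable_in Q Dy (dir_x R i) q.
Proof. by case: u_C12 => _ _ _ H; have [h _] := H (Some i) None; exact: h. Qed.

Lemma cont_y : {within Q, continuous Dy}.
Proof. by case: u_C12 => _ _ H _; have [_ h] := H None; exact: h. Qed.

Lemma cont_yy : {within Q, continuous Dyy}.
Proof. by case: u_C12 => _ _ _ H; have [_ h] := H None None; exact: h. Qed.

Lemma cont_xx i : {within Q, continuous (Dxx i)}.
Proof. by case: u_C12 => _ _ _ H; have [_ h] := H (Some i) (Some i); exact: h. Qed.

Lemma cont_xy i : {within Q, continuous (Dxy i)}.
Proof. by case: u_C12 => _ _ _ H; have [_ h] := H (Some i) None; exact: h. Qed.

Lemma Q_x p i h : Q p -> Q (p + h *: dir_x R i).
Proof.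
move=> Qp; apply: Q_in; rewrite /= !scaler0 !addr0; [exact: Q_time|exact: Q_y].
Qed.

Lemma Q_dy p h : Q p -> 0 <= p.2 + h -> Q (p + h *: dir_y R N).
Proof.
move=> Qp h0; apply: Q_in; rewrite /= ?scaler0 ?addr0; first exact: Q_time.
by rewrite /GRing.scale /= mulr1.
Qed.

Lemma Q_dy_near p : Q p -> \forall h \near (0 : R)^'+, Q (p + h *: dir_y R N).
Proof.
move=> Qp; have G : \forall h \near (0 : R)^'+, 0 < h by exact: nbhs_right_gt.
apply: filterS G => h h0; apply: Q_dy => //.
by rewrite addr_ge0 ?(ltW h0) //; exact: Q_y.
Qed.

Lemma Q_t p : Q p -> \forall h \near (0 : R)^'+, Q (p - h *: dir_t R N).
Proof.
move=> Qp; have /andP[t0 tT] := Q_time Qp; near=> h.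
have h0 : 0 < h by near: h; exact: nbhs_right_gt.
have ht : h < p.1.1 by near: h; exact: nbhs_right_lt.
apply: Q_in; rewrite /= ?scaler0 ?subr0; last exact: Q_y.
by rewrite /GRing.scale /= mulr1 subr_gt0 ht /= lerBlDr (le_trans tT) // lerDl ltW.
Unshelve. all: by end_near. Qed.

Lemma right_limit (M : pt -> R) p : {within Q, continuous M} -> Q p -> p.2 = 0 ->
  M (p + y *: dir_y R N) @[y --> (0 : R)^'+] --> M p.
Proof.
move=> /subspace_continuousP cM Qp p0 A /(cM p Qp) hA.
have H := near_line (dir_y R N) hA.
have G : \forall h \near (0 : R)^'+, 0 < h by exact: nbhs_right_gt.
apply: filterS2 H G => h H h0; apply: H; apply: Q_dy => //.
by rewrite p0 add0r ltW.
Qed.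

Lemma quot_ext_t p : Q p -> quot 1 extension p (- dir_t R N) (- Dt p).
Proof.
move=> Qp; have hQ := Q_t Qp.
apply: quot_eq (quot_D_inN (der_t Qp) hQ); first exact: extension_Q.
by apply: filterS hQ => h; rewrite scalerN; exact: extension_Q.
Qed.

Lemma extension_defect_int p : Q p -> 0 < p.2 -> defect_int c a extension p 0.
Proof.
move=> Qp y0; have p0 := extension_Q Qp.
have hy h : `|h| < p.2 -> Q (p + h *: dir_y R N).
  by rewrite ltr_norml => /andP[h1 h2]; apply: Q_dy => //; move: h1; lra.
have hxy i h k : `|h| < p.2 -> `|k| < p.2 ->
    Q (p + h *: dir_x R i + k *: dir_y R N).
  move=> _; rewrite ltr_norml => /andP[h1 h2]; apply: Q_dy; first exact: Q_x.
  by rewrite /= scaler0 addr0; move: h1; lra.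
have small : \forall h \near (0 : R)^'+, 0 < h < p.2.
  near=> h; apply/andP; split; near: h; [exact: nbhs_right_gt|exact: nbhs_right_lt].
have qy : \forall h \near (0 : R)^'+, Q (p + h *: dir_y R N).
  by apply: filterS small => h /andP[h0 hp]; apply: hy; rewrite gtr0_norm.
have qyN : \forall h \near (0 : R)^'+, Q (p - h *: dir_y R N).
  apply: filterS small => h /andP[h0 hp]; rewrite -scaleNr; apply: hy.
  by rewrite normrN gtr0_norm.
have ext (P : R -> pt) : (\forall h \near (0 : R)^'+, Q (P h)) ->
    \forall h \near (0 : R)^'+, extension (P h) = u (P h).
  by apply: filterS => h; exact: extension_Q.
exists (Dt p), (Dy p), (Dyy p),
  (fun i => Dxx i p + a ord0 i ^+ 2 * Dyy p + 2 * a ord0 i * Dxy i p); split.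
- exact: quot_ext_t.
- split; first by apply: quot_eq (quot_D_in (der_y Qp) qy) => //; exact: ext.
  apply: quot_eq (quot_D_inN (der_y Qp) qyN) => //.
  by apply: filterS (ext _ qyN) => h; rewrite scalerN.
- apply: (diff2_eq p0 (ext _ qy) (ext _ qyN)).
  exact: (diff2_D_in y0 hy der_y der_yy).
- move=> i.
  have dxx : diff2 u p (dir_x R i) (Dxx i p).
    apply: (diff2_D_in y0 _ (der_x (i := i)) (der_xx (i := i))).
    by move=> h _; exact: Q_x.
  have dyy : diff2 u p (dir_y R N) (Dyy p).
    exact: (diff2_D_in y0 hy der_y der_yy).
  have D := diff2_oblique y0 (hxy i) der_y (der_xy (i := i)) (cont_xy (i := i))
    (al := a ord0 i) dxx dyy.
  have ob : \forall h \near (0 : R)^'+, Q (p + h *: oblique a i) /\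
      Q (p - h *: oblique a i).
    have e0 : 0 < p.2 / (`|a ord0 i| + 1) by rewrite divr_gt0 // ltr_wpDl.
    near=> h.
    have h0 : 0 < h by near: h; exact: nbhs_right_gt.
    have h1 : `|h * a ord0 i| < p.2.
      have : h < p.2 / (`|a ord0 i| + 1) by near: h; exact: nbhs_right_lt.
      rewrite ltr_pdivlMr ?ltr_wpDl // mulrDr mulr1 normrM [`|h|]gtr0_norm //.
      by apply: le_lt_trans; rewrite lerDl ltW.
    move: h1; rewrite ltr_norml => /andP[h1 h2].
    rewrite /oblique -scaleNr !scalerDr !scalerA !addrA; split.
      apply: Q_dy; first exact: Q_x.
      by rewrite /= scaler0 addr0; move: h1; lra.
    apply: Q_dy; first exact: Q_x.
    by rewrite /= scaler0 addr0 mulNr; move: h2; lra.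
  apply: diff2_eq D => //; apply: ext; first by apply: filterS ob => h [].
  by apply: filterS ob => h [].
- have := u_eq; rewrite /solves_parabolic => /(_ p.1.1 p.1.2) [].
    by rewrite /= in_itv /=; exact: Q_time.
  move=> /(_ p.2 y0) E _.
  have pE : p = (p.1.1, p.1.2, p.2) by case: (p) => -[].
  rewrite -pE in E; rewrite /Dt E /Lop -/Q -/Dy -/Dyy.
  (* The oblique directions produce |a|^2 [Dyy], which [ndy * Dyy] completes to [Dyy]. *)
  have -> : \sum_i (Dxx i p + a ord0 i ^+ 2 * Dyy p + 2 * a ord0 i * Dxy i p) =
     \sum_i Dxx i p + (\sum_i a ord0 i ^+ 2) * Dyy p
     + 2 * \sum_i a ord0 i * Dxy i p.
    rewrite !big_split /= -mulr_suml; congr (_ + _ + _).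
    by rewrite mulr_sumr; apply: eq_bigr => i _; rewrite mulrA.
  rewrite /ndy; ring.
Unshelve. all: by end_near. Qed.

(** For [c = 0] this is the Neumann condition. For [c] nonzero, [Lop] and all its second-order terms
    have finite limits at the boundary, hence so does (c / y) [Dy], and multiplication by y / c
    gives 0. *)
Lemma Dy_zero p : Q p -> p.2 = 0 -> Dy p = 0.
Proof.
move=> Qp y0; have pE : p = (p.1.1, p.1.2, 0) by rewrite -y0; case: (p) => -[].
have shift y : (p.1.1, p.1.2, y) = p + y *: dir_y R N.
  move: y0; case: (p) => -[t x] y' /= ->.
  by congr (_, _, _); rewrite /= ?scaler0 ?addr0 ?add0r // /GRing.scale /= mulr1.
have lim := right_limit cont_y Qp y0.
have tI : `]0, T]%classic p.1.1 by rewrite /= in_itv /=; exact: Q_time.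
have [c0|c0] := eqVneq c 0.
  have H := u_neumann p.1.2 tI.
  apply: (at_right_unique _ H).
  apply: cvg_trans lim; apply: near_eq_cvg; near=> y.
  by rewrite c0 powRr0 mul1r shift.
have [_ H] := u_eq p.1.2 tI.
pose Z y := \sum_i Dxx i (p + y *: dir_y R N) +
  2 * (\sum_i a ord0 i * Dxy i (p + y *: dir_y R N)) + Dyy (p + y *: dir_y R N).
have hZ : Z y @[y --> (0 : R)^'+] --> 
   \sum_i Dxx i p + 2 * (\sum_i a ord0 i * Dxy i p) + Dyy p.
  apply: cvgD; last exact: (right_limit cont_yy).
  apply: cvgD; first by apply: cvg_sumr => i; exact: (right_limit (@cont_xx i)).
  apply: cvgM; first exact: cvg_cst.
  apply: cvg_sumr => i; apply: cvgM; first exact: cvg_cst.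
  exact: (right_limit (@cont_xy i)).
have hy : y / c @[y --> (0 : R)^'+] --> (0 : R).
  have : y / c @[y --> (0 : R)^'+] --> 0 / c.
    by apply: cvgM; [exact: cvg_within|exact: cvg_cst].
  by rewrite mul0r.
have := cvgM hy (cvgB H hZ); rewrite mul0r => G.
apply: (at_right_unique _ (G _ _)).
apply: cvg_trans lim; apply: near_eq_cvg; near=> y.
have y1 : 0 < y by near: y; exact: nbhs_right_gt.
have yE : (p + y *: dir_y R N).2 = y.
  by rewrite /= y0 add0r /GRing.scale /= mulr1.
rewrite ?fctE /Lop -/Q -/Dy -/Dyy /Z shift yE -/(Dyy _) -/(Dy _).
rewrite -[\sum_i D_in _ _ _ _]/(\sum_i Dxx i (p + y *: dir_y R N)).
rewrite -[\sum_i a _ _ * D_in _ _ _ _]/(\sum_i a ord0 i * Dxy i (p + y *: dir_y R N)).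
by field; rewrite c0 gt_eqF.
Unshelve. all: by end_near. Qed.

Lemma Dxy_zero i p : Q p -> p.2 = 0 -> Dxy i p = 0.
Proof.
move=> Qp y0.
have qx : \forall h \near (0 : R)^'+, Q (p + h *: dir_x R i).
  by near=> h; exact: Q_x.
apply: (at_right_unique (quot_D_in (der_xy (i := i) Qp) qx)).
apply: cvg_near_cst; near=> h.
have e1 : Dy (p + h *: dir_x R i) = 0.
  by apply: Dy_zero; [exact: Q_x|rewrite /= scaler0 addr0].
by rewrite e1 (Dy_zero Qp y0) subrr mul0r.
Unshelve. all: by end_near. Qed.

(** As [Dy] vanishes on the boundary, [Dy / y] is a difference quotient tending to [Dyy], and the
    mixed derivatives vanish by tangential differentiation; this is the origin of the weight
    [1 + c]. *)
Lemma boundary_equation p : Q p -> p.2 = 0 ->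
  Dt p = \sum_i Dxx i p + (1 + c) * Dyy p.
Proof.
move=> Qp y0.
have shift y : (p.1.1, p.1.2, y) = p + y *: dir_y R N.
  move: y0; case: (p) => -[t x] y' /= ->.
  by congr (_, _, _); rewrite /= ?scaler0 ?addr0 ?add0r // /GRing.scale /= mulr1.
have tI : `]0, T]%classic p.1.1 by rewrite /= in_itv /=; exact: Q_time.
have [_ H] := u_eq p.1.2 tI.
have qy : \forall h \near (0 : R)^'+, Q (p + h *: dir_y R N).
  exact: Q_dy_near.
have hq := quot_D_in (der_yy Qp) qy.
have hZ : \sum_i Dxx i (p + y *: dir_y R N) +
    2 * (\sum_i a ord0 i * Dxy i (p + y *: dir_y R N)) + Dyy (p + y *: dir_y R N) +
    c * ((Dy (p + y *: dir_y R N) - Dy p) / y ^+ 1) @[y --> (0 : R)^'+] -->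
   \sum_i Dxx i p + 2 * (\sum_i a ord0 i * Dxy i p) + Dyy p + c * Dyy p.
  apply: cvgD; last by apply: cvgM; [exact: cvg_cst|exact: hq].
  apply: cvgD; last exact: (right_limit cont_yy).
  apply: cvgD; first by apply: cvg_sumr => i; exact: (right_limit (@cont_xx i)).
  apply: cvgM; first exact: cvg_cst.
  apply: cvg_sumr => i; apply: cvgM; first exact: cvg_cst.
  exact: (right_limit (@cont_xy i)).
have p0E : (p.1.1, p.1.2, 0) = p by rewrite -y0; case: (p) => -[].
rewrite p0E in H.
have -> : \sum_i Dxx i p + (1 + c) * Dyy p =
    \sum_i Dxx i p + 2 * (\sum_i a ord0 i * Dxy i p) + Dyy p + c * Dyy p.
  have -> : \sum_i a ord0 i * Dxy i p = 0.
    by apply: big1 => i _; rewrite Dxy_zero // mulr0.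
  by ring.
apply: (at_right_unique H).
apply: cvg_trans hZ; apply: near_eq_cvg; near=> y.
have yE : (p + y *: dir_y R N).2 = y.
  by rewrite /= y0 add0r /GRing.scale /= mulr1.
rewrite ?fctE /Lop -/Q -/Dy -/Dyy shift yE -/(Dyy _) -/(Dy _).
rewrite -[\sum_i D_in _ _ _ _]/(\sum_i Dxx i (p + y *: dir_y R N)).
rewrite -[\sum_i a _ _ * D_in _ _ _ _]/(\sum_i a ord0 i * Dxy i (p + y *: dir_y R N)).
by rewrite (Dy_zero Qp y0) subr0 expr1; ring.
Unshelve. all: by end_near. Qed.

Lemma extension_defect_bd p : Q p -> p.2 = 0 -> defect_bd c extension p 0.
Proof.
move=> Qp y0; have p0 := extension_Q Qp.
have qy : \forall h \near (0 : R)^'+, Q (p + h *: dir_y R N).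
  exact: Q_dy_near.
exists (Dt p), (Dyy p), (fun i => Dxx i p); split.
- exact: quot_ext_t.
- apply: (quot_eq (g := u)) => //.
    by apply: filterS qy => h; exact: extension_Q.
  have E0 : p + 0 *: dir_y R N = p by rewrite scale0r addr0.
  have := @taylor2_right R (fun s => u (p + s *: dir_y R N))
    (fun s => Dy (p + s *: dir_y R N)) 0 (Dyy p) _ _ _.
  have h1 : \forall h \near (0 : R)^'+, is_derive (h : R) (1 : R)
      (fun s => u (p + s *: dir_y R N)) (Dy (p + h *: dir_y R N)).
    near=> h.
    have h0 : 0 < h by near: h; exact: nbhs_right_gt.
    apply: line_is_derive_at; last by apply: der_y; near: h; exact: qy.
    have hk0 : \forall k \near (0 : R), `|k| < h by exact: nbhs0_lt.
    move: hk0; apply: filterS => s; rewrite ltr_norml => /andP[s1 s2].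
    rewrite -addrA -scalerDl; apply: Q_dy => //; rewrite y0 add0r.
    by move: s1; lra.
  have h2 : u (p + h *: dir_y R N) @[h --> (0 : R)^'+] --> u (p + 0 *: dir_y R N).
    rewrite E0; apply: (right_limit _ Qp y0).
    by case: u_C12.
  have h3 : (Dy (p + h *: dir_y R N) - 0) / h @[h --> (0 : R)^'+] --> Dyy p.
    apply: cvg_trans (quot_D_in (der_yy Qp) qy); apply: near_eq_cvg; near=> h.
    by rewrite (Dy_zero Qp y0) expr1.
  move=> /(_ h1 h2 h3); apply: cvg_trans; apply: near_eq_cvg; near=> h.
  by rewrite E0 mul0r subr0.
- move=> i.
  have qx h : Q (p + h *: dir_x R i) by exact: Q_x.
  apply: (diff2_eq p0).
  + by near=> h; exact: extension_Q.
  + by near=> h; rewrite -scaleNr; exact: extension_Q.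
  + exact: (diff2_D_in ltr01 (fun h _ => qx h) (der_x (i := i)) (der_xx (i := i))).
- by rewrite boundary_equation // subrr.
Unshelve. all: by end_near. Qed.

Lemma extension_solution : solution c a T extension.
Proof.
split; first exact: extension_continuous.
move=> p pT p0; have [t0|t0] := leP p.1.1 0.
  apply: defect_past0 => q qt; apply: extension_past; exact: le_trans t0.
have Qp : Q p by apply: Q_in => //; rewrite t0.
by split => [y0|y0]; [exact: extension_defect_int|exact: extension_defect_bd].
Qed.

End Extension.

(** * Riemann sums and Gaussian growth *)

Section Lattice.
Context (R : realType) (N : nat).
Notation pt := (R * 'rV[R]_N * R)%type.
Implicit Types (p q : pt) (x : 'rV[R]_N).

(** Only [p] is confined to [K]: in [bracket] the second node may leave the compact box. *)
Lemma uniform_on_compact (f : pt -> R) (K : set pt) (e : R) :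
  compact K -> continuous f -> 0 < e ->
  exists2 d, 0 < d & forall p q, K p -> `|q - p| < d -> `|f q - f p| <= e.
Proof.
move=> cK cf e0.
have /compact_near_coveringP/(_ R (0 : R)^'+ (fun d p =>
    forall q, `|q - p| < d -> `|f q - f p| <= e)) H := cK.
have [|d /= d0 hd] := H _ _.
  move=> p _.
  have /cvgrPdist_le /(_ (e / 2)) := cf p.
  rewrite divr_gt0 // => /(_ isT) /nbhs_normP [r /= r0 hr].
  have r20 : 0 < r / 2 by rewrite divr_gt0.
  exists (ball p (r / 2), [set d : R | 0 < d < r / 2]).
    split => /=; first exact: nbhsx_ballx.
    exists (r / 2) => //= z /=; rewrite sub0r normrN => hz z0.
    by rewrite z0 /= (le_lt_trans (ler_norm _)).
  move=> [q d] /= []; rewrite -ball_normE /= => pq /andP[_ dr] q' qq'.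
  have h1 : `|f p - f q| <= e / 2 by apply: hr => /=; apply: lt_trans pq _; lra.
  have h2 : `|f p - f q'| <= e / 2.
    apply: hr => /=; have -> : p - q' = (p - q) + - (q' - q) by rewrite opprB addrA subrK.
    apply: le_lt_trans (ler_normD _ _) _; rewrite normrN; lra.
  have -> : f q' - f q = (f p - f q) - (f p - f q') by ring.
  by apply: le_trans (ler_normB _ _) _; lra.
have d20 : 0 < d / 2 by rewrite divr_gt0.
exists (d / 2) => // p q Kp; apply: (hd (d / 2)) => //=.
by rewrite sub0r normrN gtr0_norm //; lra.
Qed.

Lemma bounded_on_compact (f : pt -> R) (K : set pt) :
  compact K -> continuous f -> exists S, forall p, K p -> f p <= S.
Proof.
move=> cK cf; have [K0|/set0P K0] := eqVneq K set0.
  by exists 0 => p; rewrite K0.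
have [|m _ hm] := compact_EVT_max K0 cK (f := f); first exact: continuous_subspaceT.
by exists (f m) => p Kp; apply: hm; exact/mem_set.
Qed.

Lemma pt_norm_lt p (d : R) : `|p.1.1| < d -> `|p.1.2| < d -> `|p.2| < d -> `|p| < d.
Proof.
by move=> h1 h2 h3; rewrite !prod_normE /= !gt_max h1 h2 h3.
Qed.

(** Time shifts point to the past, where the equation still holds; the offset [o] lets the spatial
    box start at - o / n; y is left unshifted because of [c / y]. *)
Definition node (n o k : nat) (j : 'I_N -> nat) : pt :=
  (- (k%:R / n%:R), \row_i (((j i)%:R - o%:R) / n%:R), 0).

(* A Riemann sum of the space-time integral of [v] over a box of side [M / n];
   unlike the integral it is a finite sum of translates, hence again a solution. *)
Definition lattice (v : pt -> R) (n K M o : nat) : pt -> R := fun p =>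
  n%:R^-1 ^+ N.+1 * \sum_(k < K) \sum_(j : {ffun 'I_N -> 'I_M})
    v (p + node n o k (fun i => j i)).

Lemma lattice_ge0 v n K M o p : (forall q, 0 <= v q) -> 0 <= lattice v n K M o p.
Proof.
move=> v0; rewrite mulr_ge0 ?exprn_ge0 ?invr_ge0 //.
by apply: sumr_ge0 => k _; apply: sumr_ge0.
Qed.

Lemma lattice_le v n K M o p S : (forall k (j : {ffun 'I_N -> 'I_M}), (k < K)%N ->
    v (p + node n o k (fun i => j i)) <= S) ->
  lattice v n K M o p <= n%:R^-1 ^+ N.+1 * (K%:R * (M ^ N)%:R) * S.
Proof.
move=> h; rewrite /lattice -mulrA ler_wpM2l ?exprn_ge0 ?invr_ge0 //.
apply: (@le_trans _ _ (\sum_(k < K) \sum_(j : {ffun 'I_N -> 'I_M}) S)).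
  by apply: ler_sum => k _; apply: ler_sum => j _; apply: h.
rewrite !sumr_const card_ffun !card_ord.
by rewrite -[_ *+ K]mulr_natl -[S *+ _]mulr_natl mulrA.
Qed.

Lemma lattice_past v n K M o p :
  (forall q, q.1.1 <= p.1.1 -> q.2 = p.2 -> v q = 0) -> lattice v n K M o p = 0.
Proof.
move=> v0; rewrite /lattice big1 ?mulr0 // => k _; apply: big1 => j _; apply: v0.
  by rewrite /= gerDl oppr_le0 divr_ge0.
by rewrite /= addr0.
Qed.

Lemma lattice_solution c (a : 'rV[R]_N) T v n K M o :
  solution c a T v -> solution c a T (lattice v n K M o).
Proof.
move=> [cv dv]; split.
  apply: continuousM_fun; first exact: continuous_cst_fun.
  apply: continuous_sum => k; apply: continuous_sum => j p.
  apply: (@continuous_comp _ _ _ (fun p => p + node n o k (fun i => j i)) v).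
    by apply: cvgD; [exact: cvg_id|exact: cvg_cst].
  exact: cv.
move=> p pT p0; rewrite -[0](mulr0 (n%:R^-1 ^+ N.+1)); apply: defectZ.
apply: defect_sum => k _; apply: defect_sum => j _.
apply: defect_shift => //; apply: dv => /=; last by rewrite addr0.
by apply: le_trans pT; rewrite gerDl oppr_le0 divr_ge0.
Qed.

Section Bracket.
Context (v : pt -> R) (v_cont : continuous v) (v_ge0 : forall p, 0 <= v p).

Lemma floor_nat (s : R) (n : nat) : 0 <= s -> (0 < n)%N ->
  let k := Num.trunc (s * n%:R) in 0 <= s - k%:R / n%:R < n%:R^-1.
Proof.
move=> s0 n0 /=; have nR : 0 < n%:R :> R by rewrite ltr0n.
have h1 : (Num.trunc (s * n%:R))%:R <= s * n%:R.
  by rewrite truncn_le // mulr_ge0 // ltW.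
have h2 := truncnS_gt (s * n%:R).
rewrite subr_ge0 ler_pdivrMr // h1 /= ltrBlDr.
rewrite -ltr_pdivlMr // -natr1 mulrDl div1r addrC in h2.
exact: h2.
Qed.

Lemma shift_lt (j n c : nat) : (j < n)%N -> (c <= 2 * n)%N -> (j + (2 * n - c) < 3 * n)%N.
Proof. lia. Qed.

Lemma sum_inj_le (I J : finType) (f : I -> J) (F : J -> R) :
  injective f -> (forall j, 0 <= F j) -> \sum_i F (f i) <= \sum_j F j.
Proof.
move=> fi F0; have -> : \sum_i F (f i) = \sum_(j in imset f (mem I)) F j.
  rewrite big_imset /=; last by move=> i i' _ _; exact: fi.
  by apply: eq_bigl => i.
rewrite [leRHS](bigID (fun j => j \in imset f (mem I))) /= lerDl.
by apply: sumr_ge0.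
Qed.

(* Every node of the small box at [(ts, xs)] is within one mesh width of a node
   of the large box at [(t, x)], injectively: this turns the value at a point
   into a lower bound on a whole slice and for all later times. *)
Lemma bracket (T : R) (B : nat) (r e : R) : T <= B%:R -> 0 < e ->
  exists n0, forall n, (n0 <= n)%N -> (0 < n)%N ->
  forall ts xs y, 0 <= ts <= T -> `|xs| <= r -> 0 <= y <= r ->
  forall t x, ts <= t <= T -> `|x - xs| <= 1 / 4 ->
  lattice v n (n * B).+1 n 0 (ts, xs, y) - e <=
  lattice v n (n * B).+1.*2 (3 * n) n (t, x, y).
Proof.
move=> TB e0.
(* Bounds the total weight K / n of the small box, so that an error [e / W] at each node adds up to
   at most [e]. *)
pose W : R := (B%:R + 1).
have W0 : 0 < W by rewrite ltr_wpDl.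
have [d d0 hd] := uniform_on_compact
  (@box_compact R N (- W - 1) T 0 (r + 2) 0 r) v_cont (divr_gt0 e0 W0).
exists (Num.trunc d^-1).+4 => n hn n0 ts xs y /andP[ts0 tsT] xr /andP[y0 yr].
move=> t x /andP[tst tT] xx.
have nR : 0 < n%:R :> R by rewrite ltr0n.
have nd : n%:R^-1 < d.
  rewrite -[d]invrK ltf_pV2 ?posrE ?invr_gt0 //.
  apply: lt_le_trans (truncnS_gt _) _; rewrite ler_nat; apply: leq_trans hn.
  by do 3!apply: leqW.
have n4 : (4 <= n)%N by apply: leq_trans hn.
set K := (n * B).+1.
pose kap := Num.trunc ((t - ts) * n%:R).
have tts : 0 <= t - ts by rewrite subr_ge0.
have /andP[k1 k2] : 0 <= (t - ts) - kap%:R / n%:R < n%:R^-1 by exact: floor_nat.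
have kapK : (kap < K)%N.
  rewrite /K ltnS -(ler_nat R) natrM; move: k1; rewrite subr_ge0 ler_pdivrMr //.
  move=> h; apply: (le_trans h); rewrite mulrC ler_pM2l //; lra.
have xi i : -1 <= (x - xs) ord0 i <= 1.
  by rewrite -ler_norml (le_trans (coord_le_norm _ _)) //; lra.
(* The added 1 makes the rounded number nonnegative. Node [j] of the small box is matched with
   [j + (2 * n - c i)]: after the offset [n] its position is x + j/n + 1 - c/n, within 1/n of xs +
   j/n. *)
pose c i := Num.trunc (((x - xs) ord0 i + 1) * n%:R).
have c0 i : 0 <= (x - xs) ord0 i + 1 by have /andP[] := xi i; lra.
have cE i : 0 <= ((x - xs) ord0 i + 1) - (c i)%:R / n%:R < n%:R^-1 by exact: floor_nat.
have c2 i : (c i <= 2 * n)%N.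
  rewrite -(ler_nat R) natrM; have /andP[h _] := cE i.
  move: h; rewrite subr_ge0 ler_pdivrMr // => h; apply: (le_trans h).
  by rewrite ler_pM2r //; have /andP[] := xi i; lra.
have fk (k : 'I_K) : (k + kap < K.*2)%N.
  by rewrite -addnn; apply: leq_trans (_ : (k + K)%N <= _)%N; rewrite ?ltn_add2l // leq_add2r ltnW.
pose f (k : 'I_K) : 'I_(K.*2) := Ordinal (fk k).
have gj (j : {ffun 'I_N -> 'I_n}) i : (j i + (2 * n - c i) < 3 * n)%N.
  exact: shift_lt (ltn_ord _) (c2 i).
pose g (j : {ffun 'I_N -> 'I_n}) : {ffun 'I_N -> 'I_(3 * n)} :=
  [ffun i => Ordinal (gj j i)].
have finj : injective f.
  by move=> k k' /(congr1 val) /= /addIn /val_inj.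
have ginj : injective g.
  move=> j j' /ffunP E; apply/ffunP => i; have := E i; rewrite !ffunE.
  by move=> /(congr1 val) /= /addIn /val_inj.
have term (k : 'I_K) (j : {ffun 'I_N -> 'I_n}) :
    v ((ts, xs, y) + node n 0 k (fun i => j i)) - e / W <=
    v ((t, x, y) + node n n (f k) (fun i => g j i)).
  set p := (ts, xs, y) + _; set q := (t, x, y) + _.
  suff : `|v q - v p| <= e / W by rewrite ler_norml => /andP[]; lra.
  apply: hd.
    have kW : k%:R / n%:R <= W.
      rewrite ler_pdivrMr // /W; apply: (@le_trans _ _ (n * B).+1%:R).
        by rewrite ler_nat ltnW.
      have n1 : 1 <= n%:R :> R by rewrite (ler_nat R 1).
      by rewrite -natr1 natrM; lra.
    have kn0 : 0 <= k%:R / n%:R :> R by rewrite divr_ge0.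
    split => /=.
    - by apply/andP; lra.
    - rewrite subr0; apply: le_trans (ler_normD _ _) _; apply: lerD => //.
      apply: norm_le_coord => // i; rewrite mxE subr0 ger0_norm ?divr_ge0 //.
      rewrite ler_pdivrMr // mulrC; apply: (@le_trans _ _ n%:R).
        by rewrite ler_nat ltnW.
      by rewrite ler_peMr // (ler_nat R 1).
    - by rewrite addr0 y0.
  apply: pt_norm_lt => /=.
  - have -> : t - (k + kap)%:R / n%:R - (ts - k%:R / n%:R) = t - ts - kap%:R / n%:R.
      by rewrite natrD; ring.
    by rewrite ger0_norm // (lt_trans k2).
  - apply: le_lt_trans nd; apply: norm_le_coord => [|i].
      by rewrite invr_ge0.
    rewrite !mxE /= ffunE /= natrD natrB // natrM subr0.
    have := cE i; rewrite !mxE => /andP[e1 e2].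
    have -> : x ord0 i + ((j i)%:R + (2 * n%:R - (c i)%:R) - n%:R) / n%:R -
      (xs ord0 i + (j i)%:R / n%:R) = x ord0 i - xs ord0 i + 1 - (c i)%:R / n%:R.
      by field; rewrite gt_eqF.
    by rewrite ger0_norm // ltW.
  - by rewrite !addr0 subrr normr0.
rewrite lerBlDr /lattice.
set F := n%:R^-1 ^+ N.+1; have F0 : 0 <= F by rewrite exprn_ge0 // invr_ge0.
set S1 := \sum_(k < K) _; set S2 := \sum_(k < K.*2) _.
have hS : S1 - (K%:R * (n ^ N)%:R) * (e / W) <= S2.
  apply: (@le_trans _ _ (\sum_(k < K) \sum_(j : {ffun 'I_N -> 'I_n})
      v ((t, x, y) + node n n (f k) (fun i => g j i)))).
    have -> : S1 - (K%:R * (n ^ N)%:R) * (e / W) =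
      \sum_(k < K) \sum_(j : {ffun 'I_N -> 'I_n})
        (v ((ts, xs, y) + node n 0 k (fun i => j i)) - e / W).
      have <- : \sum_(k < K) \sum_(j : {ffun 'I_N -> 'I_n}) e / W =
          K%:R * (n ^ N)%:R * (e / W).
        rewrite !sumr_const card_ffun !card_ord.
        by rewrite -[_ *+ K]mulr_natl -[_ *+ (n ^ N)]mulr_natl mulrA.
      by rewrite /S1 -sumrB; apply: eq_bigr => k _; rewrite -sumrB.
    by apply: ler_sum => k _; apply: ler_sum => j _.
  apply: le_trans (sum_inj_le (F := fun k : 'I_(K.*2) =>
    \sum_(j : {ffun 'I_N -> 'I_(3 * n)}) v ((t, x, y) + node n n k (fun i => j i)))
    finj _); last by move=> k; apply: sumr_ge0.
  apply: ler_sum => k _.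
  exact: (sum_inj_le (F := fun j : {ffun 'I_N -> 'I_(3 * n)} =>
    v ((t, x, y) + node n n (f k) (fun i => j i))) ginj).
have hF : F * ((K%:R * (n ^ N)%:R) * (e / W)) <= e.
  have FE : F * (K%:R * (n ^ N)%:R) = K%:R / n%:R.
    rewrite /F exprS natrX exprVn; field.
    by rewrite gt_eqF // expf_neq0 // gt_eqF.
  rewrite [F * (_ * _)]mulrA FE.
  have KW : K%:R / n%:R <= W.
    rewrite ler_pdivrMr // /K /W -natr1 natrM mulrDl mul1r mulrC lerD2l.
    by rewrite (ler_nat R 1).
  have := ler_wpM2r (ltW (divr_gt0 e0 W0)) KW.
  by rewrite [W * _]mulrC divfK // gt_eqF.
have := ler_wpM2l F0 hS; rewrite mulrBr; lra.
Qed.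

End Bracket.
End Lattice.

(** * Growth of the Riemann sums away from y = 0 *)

Section LatticeGrowth.
Context (R : realType) (N : nat).
Notation pt := (R * 'rV[R]_N * R)%type.
Implicit Types (p q : pt) (x : 'rV[R]_N).

(** The total weight of a box of fixed size, bounded uniformly in the mesh. *)
Lemma lattice_weight (n B m k : nat) : (0 < n)%N ->
  (n%:R^-1 : R) ^+ N.+1 * (((n * B).+1 * k)%:R * ((m * n) ^ N)%:R) <=
  (B%:R + 1) * k%:R * (m ^ N)%:R.
Proof.
move=> n0; have nR : 0 < n%:R :> R by rewrite ltr0n.
have -> : (n%:R^-1 : R) ^+ N.+1 * (((n * B).+1 * k)%:R * ((m * n) ^ N)%:R) =
   ((n * B).+1%:R / n%:R) * k%:R * (m ^ N)%:R.
  rewrite exprS !natrX !natrM exprMn exprVn; field.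
  by rewrite gt_eqF // expf_neq0 // gt_eqF.
apply: ler_wpM2r => //; apply: ler_wpM2r => //.
rewrite ler_pdivrMr // -natr1 natrM mulrDl mul1r mulrC lerD2l.
by rewrite (ler_nat R 1).
Qed.

Notation half v n B := (lattice v n (n * B).+1 n 0).

(* The bound from [reach], divided by the bounded value at [(T, 0, 1)]. *)
Lemma slice_growth (c : R) (a : 'rV[R]_N) (T tau : R) (B : nat) (v : pt -> R) :
  0 < ndy a -> 0 < c + 1 -> 0 < tau -> 0 < T -> T <= B%:R ->
  solution c a T v -> (forall p, 0 <= v p) ->
  (forall q, q.1.1 <= 0 -> v q = 0) ->
  exists (C Lam : R) (m : nat), [/\ 0 < C, 1 <= Lam &
    forall r : R, exists n0, forall n, (n0 <= n)%N -> (0 < n)%N ->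
    forall ts x y (k : nat), 0 <= ts <= T - tau -> `|x| <= r -> 0 < y <= r ->
      (0 < k)%N -> sqn x + (y + 5) ^+ 2 <= k%:R ^+ 2 ->
      half v n B (ts, x, y) * Num.min 1 y ^+ m.+1 <= C * Lam ^+ (k ^ 2)].
Proof.
move=> k0 c0 tau0 T0 TB v_sol v0 vpast.
have [C1 [Lam [m [C10 Lam1 m0 hreach]]]] := reach T k0 c0 tau0.
(* The nodes of the large box around (T, 0, 1) have x-coordinates in [-1, 2] and height 1; those at
   negative times carry the value 0, so a compact set suffices for every mesh. *)
have [S hS] : exists2 S, 0 < S & forall p, p.1.1 <= T -> `|p.1.2| <= 2 -> p.2 = 1 ->
    v p <= S.
  have [S hS] := bounded_on_compact (@box_compact R N 0 T 0 2 1 1) v_sol.1.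
  exists (Num.max S 1); first by rewrite lt_max ltr01 orbT.
  move=> p pT p2 p1; rewrite le_max; apply/orP.
  have [pt|pt] := leP p.1.1 0; first by right; rewrite vpast.
  by left; apply: hS; split; rewrite ?subr0 ?p1 ?lexx // (ltW pt).
move=> S0.
pose S' : R := (B%:R + 1) * 2 * (3 ^ N)%:R * S.
have S'0 : 0 < S'.
  by rewrite /S' !mulr_gt0 ?ltr0n ?expn_gt0 // ltr_wpDl.
exists (2 * C1 * S' + 2), Lam, m.-1; split=> //.
  by rewrite addr_gt0 // !mulr_gt0.
rewrite prednK // => r.
have [n0 hn0] := bracket v_sol.1 v0 r TB ltr01.
exists n0 => n hn n1 ts x y k /andP[ts0 tsT] xr /andP[y0 yr] kk0 hk.
have LamP : 1 <= Lam ^+ (k ^ 2) by rewrite exprn_ege1.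
have m01 : 0 <= Num.min 1 y <= 1 by rewrite le_min ler01 (ltW y0) /= ge_min lexx.
have mm1 : Num.min 1 y ^+ m <= 1 by case/andP: m01 => h1 h2; rewrite exprn_ile1.
have mm0 : 0 <= Num.min 1 y ^+ m by case/andP: m01 => h1 h2; rewrite exprn_ge0.
set H := half v n B (ts, x, y).
have H0 : 0 <= H by exact: lattice_ge0.
have CS0 : 0 <= 2 * C1 * S' by rewrite !mulr_ge0 // ltW.
(* Absorbs the error 1 of [bracket]: above 2 one has H <= 2 (H - 1). *)
have [H2|H2] := leP H 2.
  apply: (@le_trans _ _ 2).
    by apply: (@le_trans _ _ (H * 1)); [rewrite ler_wpM2l|rewrite mulr1].
  apply: (@le_trans _ _ ((2 * C1 * S' + 2) * 1)); first by lra.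
  by rewrite ler_wpM2l // addr_ge0.
set F := lattice v n (n * B).+1.*2 (3 * n) n.
have Fsol : solution c a T F by exact: lattice_solution.
have F0 p : 0 <= F p by exact: lattice_ge0.
have H1 : 0 < H - 1 by lra.
have tsT' : ts <= T by lra.
have := hreach F ts x y (H - 1) k Fsol F0 tsT y0 H1 kk0 hk.
have hsl t x' : ts <= t <= T -> `|x' - x| <= 1 / 4 -> H - 1 <= F (t, x', y).
  by move=> ht hx; apply: hn0 => //; rewrite ?ts0 ?tsT' ?(ltW y0).
move=> /(_ hsl) hF.
have FS : F (T, 0, 1) <= S'.
  have hb : forall k (j : {ffun 'I_N -> 'I_(3 * n)}), (k < (n * B).+1.*2)%N ->
      v ((T, 0, 1) + node R n n k (fun i => j i)) <= S.
    move=> k' j _; apply: S0 => /=; last by rewrite addr0.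
      by rewrite gerDl oppr_le0 divr_ge0.
    have nR : 0 < n%:R :> R by rewrite ltr0n.
    rewrite add0r; apply: norm_le_coord => // i; rewrite mxE.
    rewrite normrM normfV [`|n%:R|]gtr0_norm // ler_pdivrMr //.
    rewrite ler_distl; apply/andP; split.
      apply: (@le_trans _ _ 0) => //; lra.
    apply: (@le_trans _ _ (3 * n)%:R); first by rewrite ler_nat ltnW.
    by rewrite natrM; lra.
  apply: (le_trans (lattice_le hb)); rewrite /S'.
  apply: ler_wpM2r; first exact: ltW.
  by rewrite -muln2; exact: lattice_weight.
have hF2 : (H - 1) * Num.min 1 y ^+ m <= C1 * Lam ^+ (k ^ 2) * S'.
  by apply: (le_trans hF); rewrite ler_wpM2l // mulr_ge0 ?exprn_ge0 ?(ltW C10) // (le_trans ler01).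
have HH : H * Num.min 1 y ^+ m <= 2 * ((H - 1) * Num.min 1 y ^+ m).
  by rewrite mulrA ler_wpM2r //; lra.
have LL : 0 <= 2 * Lam ^+ (k ^ 2) by rewrite mulr_ge0 // (le_trans ler01).
by lra.
Qed.

End LatticeGrowth.

(** * Bound up to the boundary *)

Section CapBound.
Context (R : realType) (N : nat).
Notation pt := (R * 'rV[R]_N * R)%type.
Implicit Types (p q : pt) (x : 'rV[R]_N).

(** Half of the gain 2 E (1 + c) from the curvature in y pays for the x-derivatives of 2 r^(n+1)
    with 1 to spare. The other half pays for the mixed derivatives, by the first bound in
    [cap_width]; the second bound there keeps [cap] above r^(n+1). *)
Definition cap_curv (c : R) (n : nat) : R :=
  (8 * n.+1%:R * n.+2%:R + 4 * n.+1%:R * N%:R + 1) / (1 + c).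
Definition cap_width (c : R) (n : nat) : R :=
  Num.min ((1 + c) / (8 * n.+3%:R * (N%:R + 1))) (1 / (cap_curv c n + 1)).

Lemma cap_curv_gt0 c n : 0 < c + 1 -> 0 < cap_curv c n.
Proof.
move=> c0; have h : 0 <= 8 * n.+1%:R * n.+2%:R + 4 * n.+1%:R * N%:R :> R.
  by rewrite addr_ge0 // !mulr_ge0.
by apply: divr_gt0; [exact: ltr_wpDl|rewrite addrC].
Qed.

Lemma cap_width_gt0 c n : 0 < c + 1 -> 0 < cap_width c n.
Proof.
move=> c0; have E0 := cap_curv_gt0 n c0.
rewrite lt_min; apply/andP; split; last by rewrite divr_gt0 // ltr_wpDl // ltW.
have N0 : 0 < N%:R + 1 :> R by exact: ltr_wpDl.
by apply: divr_gt0; [rewrite addrC|rewrite !mulr_gt0].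
Qed.

Lemma cap_width_le1 c n : 0 < c + 1 -> cap_width c n <= 1.
Proof.
move=> c0; have E0 := cap_curv_gt0 n c0.
rewrite ge_min; apply/orP; right; rewrite ler_pdivrMr; first by rewrite mul1r lerDr ltW.
by rewrite ltr_wpDl // ltW.
Qed.

Lemma coef_le1 (a : 'rV[R]_N) i : 0 <= ndy a -> `|a ord0 i| <= 1.
Proof.
move=> k0; apply: sqr_le_norm => //; rewrite expr1n.
by apply: le_trans (coord_sqn a i) _; move: k0; rewrite /ndy subr_ge0.
Qed.

(* The second derivatives of [cap] summed with the weights of the operator;
   [z] stands for [y / (1 - |x|^2)] and the common factor is divided out. *)
Lemma cap_estimate (c : R) (a X : 'rV[R]_N) (n : nat) (s z : R) :
  0 < ndy a -> 0 < c + 1 -> 0 <= s <= 1 -> 0 <= z <= cap_width c n -> sqn X <= 1 ->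
  let E := cap_curv c n in
  \sum_i (8 * n.+1%:R * n.+2%:R * X ord0 i ^+ 2 + 4 * n.+1%:R * s
     - E * (2 * a ord0 i ^+ 2 + 8 * a ord0 i * n.+3%:R * z * X ord0 i))
  - 2 * E * (ndy a + c) <= -1.
Proof.
move=> k0 c0 /andP[s0 s1] /andP[z0 z1] X1 /=; set E := cap_curv c n.
have E0 : 0 < E := cap_curv_gt0 n c0.
have zw : z * (8 * n.+3%:R * (N%:R + 1)) <= 1 + c.
  have : z <= (1 + c) / (8 * n.+3%:R * (N%:R + 1)).
    by apply: (le_trans z1); rewrite ge_min lexx.
  by rewrite ler_pdivlMr // !mulr_gt0 // ltr_wpDl.
have h1 : \sum_i (8 * n.+1%:R * n.+2%:R * X ord0 i ^+ 2 + 4 * n.+1%:R * s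
     - E * (2 * a ord0 i ^+ 2 + 8 * a ord0 i * n.+3%:R * z * X ord0 i)) <=
   \sum_i (8 * n.+1%:R * n.+2%:R * X ord0 i ^+ 2 + 4 * n.+1%:R
     + (- (2 * E * a ord0 i ^+ 2) + E * (8 * n.+3%:R * z))).
  apply: ler_sum => i _.
  have ai := coef_le1 i (ltW k0).
  have Xi : `|X ord0 i| <= 1.
    by apply: sqr_le_norm => //; rewrite expr1n; apply: le_trans (coord_sqn _ _) X1.
  have aX : - (a ord0 i * X ord0 i) <= 1.
    apply: le_trans (ler_norm _) _; rewrite normrN normrM -[leRHS]mulr1.
    by apply: ler_pM.
  have hE : E * (8 * n.+3%:R * z) * - (a ord0 i * X ord0 i) <= E * (8 * n.+3%:R * z) * 1.
    apply: ler_wpM2l => //; apply: mulr_ge0; [exact: ltW|exact: mulr_ge0].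
  have hs : 4 * n.+1%:R * s <= 4 * n.+1%:R * 1 by rewrite ler_wpM2l // mulr_ge0.
  by lra.
apply: le_trans (lerD h1 (lexx _)) _.
have -> : \sum_i (8 * n.+1%:R * n.+2%:R * X ord0 i ^+ 2 + 4 * n.+1%:R
     + (- (2 * E * a ord0 i ^+ 2) + E * (8 * n.+3%:R * z))) =
   8 * n.+1%:R * n.+2%:R * sqn X + N%:R * (4 * n.+1%:R) + (- (2 * E * sqn a) +
     N%:R * (E * (8 * n.+3%:R * z))).
  rewrite !big_split /= sumrN /sqn !mulr_sumr !sumr_const card_ord.
  by rewrite [N%:R * (4 * _)]mulr_natl [N%:R * (E * _)]mulr_natl.
have -> : ndy a = 1 - sqn a by [].
have hX : 8 * n.+1%:R * n.+2%:R * sqn X <= 8 * n.+1%:R * n.+2%:R * 1.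
  by rewrite ler_wpM2l // !mulr_ge0.
have hz : E * (z * (8 * n.+3%:R * (N%:R + 1))) <= E * (1 + c) by rewrite ler_pM2l.
have EE : E * (1 + c) = 8 * n.+1%:R * n.+2%:R + 4 * n.+1%:R * N%:R + 1.
  by rewrite /E /cap_curv divfK // addrC gt_eqF.
have hz2 : 0 <= E * (z * (8 * n.+3%:R)).
  by apply: mulr_ge0; [exact: ltW|exact: mulr_ge0].
move: hX hz EE hz2; lra.
Qed.

End CapBound.

Section CapComparison.
Context (R : realType) (N : nat).
Notation pt := (R * 'rV[R]_N * R)%type.
Implicit Types (p q : pt) (x : 'rV[R]_N).

(** The retained second-order terms scale like r^(n+3) once y is measured in units of 1 / r, which
    reduces the claim to [cap_estimate]. Evenness in y gives the Neumann condition. *)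
Lemma cap_defect (c : R) (a : 'rV[R]_N) (n : nat) x0 p :
  0 < ndy a -> 0 < c + 1 ->
  let s := 1 - sqn (p.1.2 - x0) in
  0 < s -> 0 <= p.2 <= cap_width N c n * s ->
  exists2 d, 0 < d & defect c a (cap n.+1 (cap_curv N c n) x0) p d.
Proof.
move=> k0 c0 /= s0 /andP[y0 ys].
set E := cap_curv N c n; have E0 : 0 < E := cap_curv_gt0 N n c0.
set X := p.1.2 - x0; set s := 1 - sqn X; rewrite -/X -/s in s0 ys.
pose r := s^-1; have r0 : 0 < r by rewrite invr_gt0.
have sr : r * s = 1 by rewrite mulVf // gt_eqF.
have s1 : s <= 1 by rewrite /s gerBl sqn_ge0.
have X1 : sqn X <= 1 by move: s0; rewrite /s subr_gt0 => /ltW.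
pose z := p.2 * r.
have z01 : 0 <= z <= cap_width N c n.
  by rewrite mulr_ge0 ?(ltW r0) //= ler_pdivrMr.
have s01 : 0 <= s <= 1 by rewrite s1 ltW.
have est := cap_estimate k0 c0 s01 z01 X1.
set f := cap n.+1 E x0.
have ft (h : R) : f (p + h *: - dir_t R N) = f p + 0 * h + 0 * h ^+ 2.
  by rewrite /f /cap /= !oppr0 !scaler0 !addr0 !mul0r !addr0.
have [qt _ _] := quadratic_line ft.
have rn : 0 < r ^+ n.+3 by rewrite exprn_gt0.
have fy (h : R) : f (p + h *: dir_y R N) =
    f p + (- (2 * E * p.2 * r ^+ n.+3)) * h + (- (E * r ^+ n.+3)) * h ^+ 2.
  rewrite /f /cap /= !scaler0 !addr0 -/X -/s -/r /GRing.scale /=; ring.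
have fyN (h : R) : f (p + h *: - dir_y R N) =
    f p + (2 * E * p.2 * r ^+ n.+3) * h + (- (E * r ^+ n.+3)) * h ^+ 2.
  rewrite /f /cap /= !oppr0 !scaler0 !addr0 -/X -/s -/r /GRing.scale /=; ring.
have [qy qyy qy2] := quadratic_line fy.
have [qyN _ _] := quadratic_line fyN.
pose K (al : R) i := 2 * (n.+1%:R * n.+2%:R * r ^+ n.+3 * (2 * X ord0 i) ^+ 2
      + 2 * n.+1%:R * r ^+ n.+2)
    - E * (2 * al ^+ 2 * r ^+ n.+3 + 4 * al * p.2 * n.+3%:R * r ^+ n.+4 * (2 * X ord0 i)
      + p.2 ^+ 2 * (n.+3%:R * n.+4%:R * r ^+ n.+4.+1 * (2 * X ord0 i) ^+ 2
                    + 2 * n.+3%:R * r ^+ n.+4)).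
have Kle (al : R) i : K al i <= r ^+ n.+3 *
   (8 * n.+1%:R * n.+2%:R * X ord0 i ^+ 2 + 4 * n.+1%:R * s
     - E * (2 * al ^+ 2 + 8 * al * n.+3%:R * z * X ord0 i)).
  have r2 : r ^+ n.+2 = r ^+ n.+3 * s by rewrite [r ^+ n.+3]exprS mulrAC sr mul1r.
  (* These terms enter with a minus sign and only help a supersolution. *)
  have drop : 0 <= E * (p.2 ^+ 2 * (n.+3%:R * n.+4%:R * r ^+ n.+4.+1 * (2 * X ord0 i) ^+ 2
                    + 2 * n.+3%:R * r ^+ n.+4)).
    apply: mulr_ge0; first exact: ltW.
    apply: mulr_ge0; first exact: sqr_ge0.
    have rk m : 0 <= r ^+ m by rewrite exprn_ge0 // ltW.
    apply: addr_ge0; last by apply: mulr_ge0; [exact: mulr_ge0|exact: rk].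
    by apply: mulr_ge0; [apply: mulr_ge0; [exact: mulr_ge0|exact: rk]|exact: sqr_ge0].
  rewrite /K r2.
  have e4 : r ^+ n.+4 = r * r ^+ n.+3 by rewrite exprS.
  have -> : 4 * al * p.2 * n.+3%:R * r ^+ n.+4 * (2 * X ord0 i) =
     r ^+ n.+3 * (8 * al * n.+3%:R * z * X ord0 i).
    by rewrite e4 /z; ring.
  by move: drop; set D := p.2 ^+ 2 * _; lra.
have hr := ler_wpM2l (ltW rn) est; rewrite -/E in hr.
move: y0; rewrite le_eqVlt => /orP[/eqP/esym y0|y0].
(* At y = 0 the plain x-directions are used; the |a|^2 in the estimate joins [ndy] to make the
   coefficient [1 + c]. *)
- exists (0 - (\sum_i K 0 i + (1 + c) * (2 * - (E * r ^+ n.+3)))).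
    have z0 : z = 0 by rewrite /z y0 mul0r.
    have E1 : \sum_i (8 * n.+1%:R * n.+2%:R * X ord0 i ^+ 2 + 4 * n.+1%:R * s
       - E * (2 * a ord0 i ^+ 2 + 8 * a ord0 i * n.+3%:R * z * X ord0 i)) =
      \sum_i (8 * n.+1%:R * n.+2%:R * X ord0 i ^+ 2 + 4 * n.+1%:R * s) - 2 * E * sqn a.
      rewrite /sqn mulr_sumr -sumrB; apply: eq_bigr => i _; rewrite z0; ring.
    have h1 : \sum_i K 0 i <= r ^+ n.+3 *
       \sum_i (8 * n.+1%:R * n.+2%:R * X ord0 i ^+ 2 + 4 * n.+1%:R * s).
      rewrite mulr_sumr; apply: ler_sum => i _; apply: le_trans (Kle 0 i) _.
      by rewrite ler_pM2l //; lra.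
    move: hr h1 rn; rewrite E1 /ndy -/(sqn a).
    set S1 := \sum_i K _ _; set S2 := \sum_i _; lra.
  split=> [|_]; first by rewrite y0 ltxx.
  exists 0, (2 * - (E * r ^+ n.+3)), (K 0); split => //.
  + by rewrite oppr0.
  + have -> : 2 * - (E * r ^+ n.+3) / 2 = - (E * r ^+ n.+3) by field.
    by apply: qy2; rewrite y0 mulr0 mul0r oppr0.
  + move=> i; have := @cap_line R N n E x0 p (dir_x R i) i 0 s0 erefl erefl; exact.
- exists (0 - (\sum_i K (a ord0 i) i + ndy a * (2 * - (E * r ^+ n.+3)) +
      c / p.2 * - (2 * E * p.2 * r ^+ n.+3))).
    have h1 : \sum_i K (a ord0 i) i <= r ^+ n.+3 *
       \sum_i (8 * n.+1%:R * n.+2%:R * X ord0 i ^+ 2 + 4 * n.+1%:R * s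
       - E * (2 * a ord0 i ^+ 2 + 8 * a ord0 i * n.+3%:R * z * X ord0 i)).
      by rewrite mulr_sumr; apply: ler_sum => i _; exact: Kle.
    have -> : c / p.2 * - (2 * E * p.2 * r ^+ n.+3) = - (2 * E * r ^+ n.+3 * c).
      by field; rewrite gt_eqF.
    move: hr h1 rn; set S1 := \sum_i K _ _; set S2 := \sum_i _; lra.
  split=> [_|h]; last by rewrite h ltxx in y0.
  exists 0, (- (2 * E * p.2 * r ^+ n.+3)), (2 * - (E * r ^+ n.+3)),
    (fun i => K (a ord0 i) i); split => //.
  + by rewrite oppr0.
  + by rewrite opprK.
  + move=> i; apply: (@cap_line R N n E x0 p (oblique a i) i (a ord0 i) s0) => /=.
      by rewrite scaler0 addr0.
    by rewrite add0r /GRing.scale /= mulr1.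
Qed.

Lemma cap_continuous n E x0 p : 0 < 1 - sqn (p.1.2 - x0) ->
  {for p, continuous (@cap R N n E x0)}.
Proof.
move=> s0.
have cr : {for p, continuous (fun q : pt => (1 - sqn (q.1.2 - x0))^-1)}.
  apply: cvgV; first by rewrite gt_eqF.
  by apply: cvgB; [exact: cvg_cst|exact: continuous_sqn].
have cX m : {for p, continuous (fun q : pt => (1 - sqn (q.1.2 - x0))^-1 ^+ m)}.
  apply: (@continuous_comp _ _ _ (fun q : pt => (1 - sqn (q.1.2 - x0))^-1)
    (fun s : R => s ^+ m)); first exact: cr.
  exact: exprn_continuous.
apply: cvgB; first by apply: cvgM; [exact: cvg_cst|exact: cX].
apply: cvgM; last exact: cX.
apply: cvgM; first exact: cvg_cst.
exact: (@continuousX_fun _ _ _ 2 (@continuous_y R N)).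
Qed.

End CapComparison.

Section RemoveSingularity.
Context (R : realType) (N : nat).
Notation pt := (R * 'rV[R]_N * R)%type.
Implicit Types (p q : pt) (x : 'rV[R]_N).

(** On the upper face y = ep (1 - |x - x0|^2) the singular bound Bd / y^(n+1) equals D r^(n+1),
    which the barrier dominates. At the rim the barrier blows up while [w] stays bounded, and no
    data are needed on y = 0. Above [x0] the barrier is at most 2 D, with a constant that does not
    see the bound of [w]. *)
Lemma cap_bound (c : R) (a : 'rV[R]_N) (T : R) (w : pt -> R) (n : nat) (th : R) x0 (Bd : R) :
  0 < ndy a -> 0 < c + 1 -> solution c a T w -> 0 <= th <= T -> 0 < Bd ->
  (forall x y, 0 <= y -> w (0, x, y) = 0) ->
  (forall t x y, 0 <= t <= th -> sqn (x - x0) <= 1 -> 0 < y <= 1 ->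
     w (t, x, y) * y ^+ n.+1 <= Bd) ->
  forall y, 0 <= y <= cap_width N c n ->
  w (th, x0, y) <= 2 * (Bd / cap_width N c n ^+ n.+1).
Proof.
move=> k0 c0 w_sol /andP[th0 thT] Bd0 winit wbd y /andP[y0 yw].
set E := cap_curv N c n; have E0 : 0 < E := cap_curv_gt0 N n c0.
set ep := cap_width N c n in yw *; have ep0 : 0 < ep := cap_width_gt0 N n c0.
have ep1 : ep <= 1 := cap_width_le1 N n c0.
pose D := Bd / ep ^+ n.+1; have D0 : 0 < D by rewrite divr_gt0 // exprn_gt0.
rewrite -/D.
have [Mx hMx] := bounded_on_compact (@box_compact R N 0 th x0 1 0 1) w_sol.1.
pose M' := Num.max Mx 0; have M'0 : 0 <= M' by rewrite le_max lexx orbT.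
(* Cuts off the rim where the barrier, at least D / dl = D + M' + 1, already exceeds the maximum of
   [w]. *)
pose dl := D / (D + M' + 1).
have dd : 0 < D + M' + 1 by lra.
have dl0 : 0 < dl by rewrite divr_gt0.
have dl1 : dl <= 1 by rewrite ler_pdivrMr // mul1r; lra.
pose s (p : pt) := 1 - sqn (p.1.2 - x0).
have cs : continuous s.
  by move=> q; apply: cvgB; [exact: cvg_cst|exact: continuous_sqn].
pose G := box 0 th x0 1 0 1 `&` [set p : pt | dl <= s p] `&` [set p | p.2 <= ep * s p].
have cG : compact G.
  apply: (@subclosed_compact _ _ (box 0 th x0 1 0 1)); last by move=> p [[]].
    apply: closedI; first apply: closedI.
    - exact: (compact_closed (@norm_hausdorff _ _) (@box_compact R N 0 th x0 1 0 1)).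
    - have -> : [set p : pt | dl <= s p] = s @^-1` [set z | dl <= z] by [].
      by apply: closed_comp; [move=> q _; exact: cs|exact: closed_ge].
    - have -> : [set p : pt | p.2 <= ep * s p] =
        (fun p : pt => ep * s p - p.2) @^-1` [set z | 0 <= z].
        by apply/seteqP; split=> p /=; rewrite subr_ge0.
      apply: closed_comp; last exact: closed_ge.
      move=> q _; apply: cvgB; last exact: continuous_y.
      by apply: cvgM; [exact: cvg_cst|exact: cs].
  exact: box_compact.
have sG p : G p -> 0 < s p <= 1.
  move=> [[_ /= h] _]; rewrite (lt_le_trans dl0 h) /=.
  by rewrite /s gerBl sqn_ge0.
pose phi p := D * cap n.+1 E x0 p.
have phi_ge p : G p -> D * (s p)^-1 ^+ n.+1 <= phi p.
  move=> Gp; have /andP[s0 s1] := sG p Gp; case: (Gp) => [[[_ _ /andP[py0 py1]] /= hs] /= hy].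
  rewrite /phi /cap -/(s p) ler_pM2l //.
  set r := (s p)^-1; have r0 : 0 < r by rewrite invr_gt0.
  have yr : p.2 * r <= ep by rewrite ler_pdivrMr.
  have yr0 : 0 <= p.2 * r by rewrite mulr_ge0 // ltW.
  have Eep : ep * (E + 1) <= 1.
    have : ep <= 1 / (E + 1) by rewrite /ep /cap_width ge_min lexx orbT.
    by rewrite ler_pdivlMr // ltr_wpDl // ltW.
  have yr2 : (p.2 * r) ^+ 2 <= ep ^+ 2 by rewrite ler_sqr ?nnegrE // ltW.
  have ep2 : ep ^+ 2 <= ep by rewrite expr2 ler_piMr // ltW.
  have Ey : E * (p.2 * r) ^+ 2 <= 1.
    apply: (@le_trans _ _ (E * ep)); last by lra.
    by rewrite ler_pM2l // (le_trans yr2).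
  have -> : E * p.2 ^+ 2 * r ^+ n.+3 = E * (p.2 * r) ^+ 2 * r ^+ n.+1.
    by rewrite [r ^+ n.+3]exprS [r ^+ n.+2]exprS; ring.
  have := ler_wpM2r (ltW (exprn_gt0 n.+1 r0)) Ey; lra.
suff H p : G p -> w p <= phi p.
  have Gp : G (th, x0, y).
    have ss : s (th, x0, y) = 1.
      rewrite /s /= subrr /sqn big1 ?subr0 // => i _; rewrite mxE expr0n //.
    split; [split|]; rewrite /= ?ss ?mulr1 //.
    by split; rewrite /= ?subrr ?normr0 ?th0 ?lexx // y0 (le_trans yw).
  apply: (le_trans (H _ Gp)); rewrite /phi /cap /= mulrC ler_pM2r //.
  have -> : sqn (x0 - x0) = 0 by rewrite subrr /sqn big1 // => i _; rewrite mxE expr0n.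
  rewrite subr0 invr1 !expr1n !mulr1 gerBl mulr_ge0 ?sqr_ge0 //; exact: ltW.
move: p; apply: (comparison (c := c) (a := a)) => //.
- exact: ltW.
- by rewrite addrC ltW.
- exact: w_sol.1.
- apply/subspace_continuousP => p Gp; apply: cvgM; first exact: cvg_cst.
  apply: cvg_trans (_ : cap n.+1 E x0 q @[q --> p] --> cap n.+1 E x0 p).
    by apply: cvg_app; exact: cvg_within.
  by apply: cap_continuous; have /andP[] := sG p Gp.
- move=> p [[[/andP[_ pt] _ /andP[py0 _]] _] _]; split => //.
  by apply: w_sol.2 => //; exact: le_trans thT.
- move=> p Gp wphi; have /andP[s0 s1] := sG p Gp.
  have ge := phi_ge p Gp; have wlt : D * (s p)^-1 ^+ n.+1 < w p by apply: le_lt_trans wphi.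
  case: (Gp) => [[bp /= hs] /= hy]; case: (bp) => /andP[pt0 pt] px /andP[py0 py1].
  have pE : p = (p.1.1, p.1.2, p.2) by case: (p) => -[].
  have rn0 : 0 < (s p)^-1 ^+ n.+1 by rewrite exprn_gt0 // invr_gt0.
  have sx1 : sqn (p.1.2 - x0) < 1 by move: s0; rewrite /s subr_gt0.
  have hs' : dl < s p.
    rewrite lt_neqAle hs andbT; apply/eqP => E1.
    have : w p <= Mx by apply: hMx.
    have : M' <= D * (s p)^-1 ^+ n.+1.
      rewrite -E1; apply: (@le_trans _ _ (D * dl^-1)).
        by rewrite /dl invf_div mulrC divfK ?gt_eqF //; lra.
      rewrite ler_pM2l // exprS ler_peMr ?invr_ge0 ?(ltW dl0) //.
      by rewrite exprn_ege1 // invf_ge1.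
    have : Mx <= M' by rewrite le_max lexx.
    by lra.
  have hy' : p.2 < ep * s p.
    rewrite lt_neqAle hy andbT; apply/eqP => E1.
    have py : 0 < p.2 by rewrite E1 mulr_gt0.
    have := wbd p.1.1 p.1.2 p.2; rewrite -pE pt0 pt py py1 (ltW sx1).
    move=> /(_ isT isT isT) h.
    have h2 : D * (s p)^-1 ^+ n.+1 * p.2 ^+ n.+1 = Bd.
      rewrite E1 exprMn /D exprVn; field.
      by rewrite !expf_neq0 ?gt_eqF.
    have : D * (s p)^-1 ^+ n.+1 * p.2 ^+ n.+1 < w p * p.2 ^+ n.+1.
      by rewrite ltr_pM2r // exprn_gt0.
    by rewrite h2; lra.
  split.
    have nb : \forall q \near p, 0 <= q.2 -> q.1.1 <= p.1.1 -> box 0 th x0 1 0 1 q.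
      apply: near_box => //.
      + rewrite lt_neqAle pt0 andbT; apply/eqP => t0.
        have : w p = 0 by rewrite pE -t0; exact: winit.
        have : 0 < D * (s p)^-1 ^+ n.+1 by rewrite mulr_gt0.
        by lra.
      + by apply: sqn_lt_norm; rewrite ?expr1n.
      + apply: (lt_le_trans hy'); rewrite -[leRHS]mul1r.
        apply: ler_pM => //; exact: ltW.
      + by right.
    have ns : \forall q \near p, dl < s q by apply: (cvgr_gt (s p) (cs p)).
    have ny : \forall q \near p, 0 < ep * s q - q.2.
      have cc : (ep * s q - q.2) @[q --> p] --> ep * s p - p.2.
        apply: cvgB; last exact: continuous_y.
        by apply: cvgM; [exact: cvg_cst|exact: cs].
      by apply: (cvgr_gt _ cc); rewrite subr_gt0.
    near=> q => q0 qt; split; first split.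
    - by move: q0 qt; near: q.
    - by apply: ltW; near: q.
    - by rewrite /= -subr_ge0; apply: ltW; near: q.
  have [|d d0 hd] := cap_defect (n := n) (x0 := x0) (p := p) k0 c0 s0.
    by rewrite py0.
  by exists (D * d); [rewrite mulr_gt0|exact: defectZ].
Unshelve. all: by end_near. Qed.

End RemoveSingularity.

(** * Uniqueness *)

Section Uniqueness.
Context (R : realType) (N : nat).
Notation pt := (R * 'rV[R]_N * R)%type.
Implicit Types (p q : pt) (x : 'rV[R]_N).
Notation half v n B := (lattice v n (n * B).+1 n 0).

(** Rounding the square root of Z up costs at most (sqrt Z + 1)^2 <= 2 Z + 2, and Lam <= exp Lam. *)
Lemma expn_le_exp (Lam Z : R) : 1 <= Lam -> 0 <= Z -> exists k : nat,
  [/\ (0 < k)%N, Z <= k%:R ^+ 2 & Lam ^+ (k ^ 2) <= expR (Lam * (2 * Z + 2))].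
Proof.
move=> L1 Z0; set z := Num.sqrt Z; have z0 : 0 <= z by exact: sqrtr_ge0.
have zE : z ^+ 2 = Z by rewrite sqr_sqrtr.
exists (Num.trunc z).+1; set k := Num.trunc z; split => //.
  by rewrite -zE ler_sqr ?nnegrE // ltW // truncnS_gt.
have kz : k.+1%:R <= z + 1 by rewrite -natr1 lerD2r truncn_le.
have k2 : k.+1%:R ^+ 2 <= 2 * Z + 2.
  apply: (@le_trans _ _ ((z + 1) ^+ 2)); first by rewrite ler_sqr ?nnegrE // addr_ge0.
  by rewrite -zE; have := sqr_ge0 (z - 1); lra.
apply: (@le_trans _ _ (expR Lam ^+ (k.+1 ^ 2))).
  apply: lerXn2r; rewrite ?nnegrE ?expR_ge0 ?(le_trans ler01) //.
  by apply: le_trans (expR_ge1Dx Lam); rewrite lerDr.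
rewrite -expRM_natl ler_expR mulrC natrX ler_pM2l //; exact: lt_le_trans L1.
Qed.

Lemma gaussian_bound (c : R) (a : 'rV[R]_N) (T tau : R) (B : nat) (v : pt -> R) :
  0 < ndy a -> 0 < c + 1 -> 0 < tau -> 0 < T -> T <= B%:R ->
  solution c a T v -> (forall p, 0 <= v p) ->
  (forall q, q.1.1 <= 0 -> v q = 0) ->
  exists C Ga : R, [/\ 0 < C, 0 < Ga &
    forall r : R, 0 <= r -> exists n0, forall n, (n0 <= n)%N -> (0 < n)%N ->
    forall ts x y, 0 <= ts <= T - tau -> `|x| <= r -> 0 <= y <= r ->
      half v n B (ts, x, y) <= C * expR (Ga * (sqn x + y ^+ 2))].
Proof.
move=> k0 c0 tau0 T0 TB v_sol v0 vpast.
have [C0 [Lam [m [C00 Lam1 hgrow]]]] := slice_growth k0 c0 tau0 T0 TB v_sol v0 vpast.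
set ep := cap_width N c m; have ep0 : 0 < ep := cap_width_gt0 N m c0.
have ep1 : ep <= 1 := cap_width_le1 N m c0.
have epm : 0 < ep ^+ m.+1 by rewrite exprn_gt0.
(* Both constants come from Lam (2 Z + 2) with Z = 2 |x|^2 + 2 y^2 + 60. *)
exists (2 * (C0 / ep ^+ m.+1) * expR (Lam * 122)), (4 * Lam); split.
- by rewrite mulr_gt0 ?expR_gt0 // mulr_gt0 // divr_gt0.
- by rewrite mulr_gt0 // (lt_le_trans ltr01).
move=> r r0; have [n0 hn0] := hgrow (r + 1).
exists n0 => n hn n1 ts x y /andP[ts0 tsT] xr /andP[y0 yr].
have sx0 := sqn_ge0 x; have y20 := sqr_ge0 y.
(* One Z serves both cases: (y + 5)^2 <= 2 y^2 + 50 away from the boundary, and 2 |x|^2 + 2 + 36 for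
   the points of the unit cylinder used by [cap_bound], which is also why the growth bound is taken
   at radius [r + 1]. *)
have Z0 : 0 <= 2 * sqn x + 2 * y ^+ 2 + 60 by lra.
have [k [kk0 hk hL]] := expn_le_exp Lam1 Z0.
have -> : 2 * (C0 / ep ^+ m.+1) * expR (Lam * 122) * expR (4 * Lam * (sqn x + y ^+ 2)) =
    2 * (C0 * expR (Lam * (2 * (2 * sqn x + 2 * y ^+ 2 + 60) + 2)) / ep ^+ m.+1).
  have -> : Lam * (2 * (2 * sqn x + 2 * y ^+ 2 + 60) + 2) =
      Lam * 122 + 4 * Lam * (sqn x + y ^+ 2) by ring.
  by rewrite expRD; ring.
set Ex := expR _ in hL *.
have Bd0 : 0 < C0 * Ex by rewrite mulr_gt0 // expR_gt0.
have [yep|yep] := leP y ep.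
- have tsT' : 0 <= ts <= T by rewrite ts0; lra.
  apply: (@cap_bound R N c a T _ m ts x (C0 * Ex) k0 c0) => //.
  + exact: lattice_solution.
  + move=> x' y' _; apply: lattice_past => q qt _; exact: vpast.
  + move=> t x' y' /andP[t0 tts] hx' /andP[y'0 y'1].
    have tT : 0 <= t <= T - tau by rewrite t0; lra.
    have x'r : `|x'| <= r + 1.
      rewrite -[x'](subrK x) addrC; apply: le_trans (ler_normD _ _) _; apply: lerD => //.
      by apply: sqn_le_norm; rewrite ?expr1n.
    have y'r : 0 < y' <= r + 1 by rewrite y'0; lra.
    have hk' : sqn x' + (y' + 5) ^+ 2 <= k%:R ^+ 2.
      apply: le_trans hk.
      have h1 : sqn x' <= 2 * sqn x + 2.
        have : sqn (x' - x) + 0 ^+ 2 <= 1 ^+ 2 by rewrite expr0n expr1n addr0.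
        have hh : sqn x' <= 2 * sqn (x' - x) + 2 * sqn x.
          rewrite /sqn !mulr_sumr -big_split /=; apply: ler_sum => i _; rewrite !mxE.
          by have := sqr_ge0 (x' ord0 i - x ord0 i - x ord0 i); lra.
        by lra.
      have h2 : (y' + 5) ^+ 2 <= 6 ^+ 2 by rewrite ler_sqr ?nnegrE //; lra.
      by lra.
    have := hn0 n hn n1 t x' y' k tT x'r y'r kk0 hk'.
    rewrite (min_idPr y'1) => h; apply: (le_trans h); rewrite ler_pM2l //.
  + by rewrite y0.
- have yr' : 0 < y <= r + 1 by rewrite (lt_trans ep0 yep); lra.
  have xr' : `|x| <= r + 1 by lra.
  have tT : 0 <= ts <= T - tau by rewrite ts0.
  have hk' : sqn x + (y + 5) ^+ 2 <= k%:R ^+ 2.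
    by apply: le_trans hk; have := sqr_ge0 (y - 5); lra.
  have h := hn0 n hn n1 ts x y k tT xr' yr' kk0 hk'.
  set H := half v n B _ in h *; have H0 : 0 <= H by exact: lattice_ge0.
  have h2 : H * ep ^+ m.+1 <= C0 * Ex.
    apply: le_trans (_ : H * Num.min 1 y ^+ m.+1 <= _); last first.
      by apply: (le_trans h); rewrite ler_pM2l.
    rewrite ler_wpM2l //; apply: lerXn2r; rewrite ?nnegrE ?(ltW ep0) //.
      by rewrite le_min ler01 (ltW (lt_trans ep0 yep)).
    by rewrite le_min ep1 ltW.
  apply: (@le_trans _ _ (C0 * Ex / ep ^+ m.+1)); first by rewrite ler_pdivlMr.
  have h3 : 0 <= C0 * Ex / ep ^+ m.+1 by apply: divr_ge0; exact: ltW.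
  by lra.
Qed.

(** The barrier has rate at least Ga + 1 and prefactor exp(- r^2), so it dominates the assumed
    growth as soon as |x|^2 + y^2 >= r^2. A violation is therefore interior, and at a fixed point
    the bound tends to 0 as r grows. *)
Lemma gaussian_decay (c : R) (a : 'rV[R]_N) (T : R) (w : pt -> R) (C Ga t1 t2 r : R) :
  0 < ndy a -> 0 < c + 1 -> solution c a T w -> 0 < C -> 0 < Ga ->
  0 <= t1 <= t2 -> t2 <= T -> t2 <= t1 + 1 / (48 * (Ga + 1)) ->
  (forall x y, 0 <= y -> w (t1, x, y) = 0) ->
  (forall t x y, t1 <= t <= t2 -> `|x| <= r -> 0 <= y <= r ->
     w (t, x, y) <= C * expR (Ga * (sqn x + y ^+ 2))) ->
  forall x y, `|x| <= r -> 0 <= y <= r ->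
  w (t2, x, y) <= C * expR (- r ^+ 2) * expR (2 * (Ga + 1) * (sqn x + y ^+ 2)
     + (4 * (Ga + 1) * (N%:R + 1 + `|c|) + 1) * T).
Proof.
move=> k0 c0 w_sol C0 Ga0 /andP[t10 t12] t2T t2tau winit wbd x y xr /andP[y0 yr].
set al := Ga + 1; have al0 : 0 < al by rewrite /al; lra.
(* The rate runs from [al] to at most [2 * al] in time 1 / (48 al). The gradient term is at most 4
   (2 al)^2 * 3 = 48 al^2 times |x|^2 + y^2, exactly what [b1] compensates; [ga] compensates the
   trace and the drift. *)
pose b1 := 48 * al ^+ 2; pose b0 := al - b1 * t1.
pose ga := 4 * al * (N%:R + 1 + `|c|) + 1.
have cc := normr_ge0 c; have NN : 0 <= N%:R :> R by [].
have ga0 : 0 < ga.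
  by rewrite /ga ltr_wpDl // mulr_ge0 ?mulr_ge0 ?(ltW al0) // !addr_ge0.
have b10 : 0 < b1 by rewrite mulr_gt0 // exprn_gt0.
have bE t : b0 + b1 * t = al + b1 * (t - t1) by rewrite /b0; ring.
have bl t : t1 <= t <= t2 -> al <= b0 + b1 * t <= 2 * al.
  move=> /andP[tt1 tt2]; rewrite bE lerDl mulr_ge0 ?(ltW b10) ?subr_ge0 //=.
  have h : b1 * (t - t1) <= b1 * (1 / (48 * al)) by rewrite ler_pM2l //; lra.
  have : b1 * (1 / (48 * al)) = al by rewrite /b1; field; rewrite gt_eqF.
  by lra.
pose D := C * expR (- r ^+ 2); have D0 : 0 < D by rewrite mulr_gt0 // expR_gt0.
rewrite -/D -/ga.
pose g := @gauss R N b0 b1 ga 0 0.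
pose qf (p : pt) := sqn p.1.2 + p.2 ^+ 2.
have qf0 p : 0 <= qf p by rewrite addr_ge0 ?sqn_ge0 ?sqr_ge0.
have gE p : g p = expR ((b0 + b1 * p.1.1) * qf p + ga * p.1.1).
  by rewrite /g /gauss !subr0.
pose phi p := D * g p.
pose G := box t1 t2 (0 : 'rV[R]_N) r 0 r.
have gge p : G p -> expR (al * qf p) <= g p.
  move=> [/andP[p1 p2] _ _]; rewrite gE ler_expR.
  have /andP[h _] : al <= b0 + b1 * p.1.1 <= 2 * al by apply: bl; rewrite p1.
  have : al * qf p <= (b0 + b1 * p.1.1) * qf p by rewrite ler_wpM2r.
  have : 0 <= ga * p.1.1 by rewrite mulr_ge0 ?(ltW ga0) // (le_trans t10).
  by lra.
suff H p : G p -> w p <= phi p.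
  have Gp : G (t2, x, y) by split; rewrite /= ?subr0 ?t12 ?lexx ?y0.
  apply: (le_trans (H _ Gp)); rewrite /phi ler_pM2l // gE ler_expR /=.
  have /andP[_ h] : al <= b0 + b1 * t2 <= 2 * al by apply: bl; rewrite t12 lexx.
  have := ler_wpM2r (qf0 (t2, x, y)) h; rewrite /qf /=.
  have : ga * t2 <= ga * T by rewrite ler_pM2l.
  by lra.
move: p; apply: (comparison (c := c) (a := a)) => //.
- exact: ltW.
- by rewrite addrC ltW.
- exact: box_compact.
- exact: w_sol.1.
- apply: continuous_subspaceT => p; apply: cvgM; first exact: cvg_cst.
  exact: gauss_continuous.
- move=> p [/andP[_ pt] _ /andP[py _]]; split => //.
  by apply: w_sol.2 => //; exact: le_trans t2T.
- move=> p Gp wphi; have hge := gge p Gp.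
  case: (Gp) => /andP[p1 p2] px /andP[py pyr]; rewrite subr0 in px.
  have pE : p = (p.1.1, p.1.2, p.2) by case: (p) => -[].
  have wlow : D * expR (al * qf p) < w p.
    by apply: le_lt_trans wphi; rewrite ler_pM2l.
  have ex0 : 0 < D * expR (al * qf p) by rewrite mulr_gt0 // expR_gt0.
  have wup : w p <= C * expR (Ga * qf p).
    by rewrite pE; apply: wbd => //; [rewrite p1|rewrite py].
  have qr : qf p < r ^+ 2.
    have : expR (al * qf p - r ^+ 2) < expR (Ga * qf p).
      rewrite -(ltr_pM2l C0); apply: lt_le_trans wup; apply: le_lt_trans wlow.
      by rewrite /D -mulrA -expRD [- _ + _]addrC.
    by rewrite ltr_expR /al; lra.
  have r0 : 0 <= r by apply: le_trans pyr.
  have sx := sqn_ge0 p.1.2; have sy := sqr_ge0 p.2.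
  split.
    apply: near_box => //.
    + rewrite lt_neqAle p1 andbT; apply/eqP => tE.
      have : w p = 0 by rewrite pE -tE; exact: winit.
      by lra.
    + rewrite subr0; apply: sqn_lt_norm => //; apply: le_lt_trans qr.
      by rewrite /qf lerDl.
    + rewrite -(ger0_norm py); apply: sqr_lt_norm => //; apply: le_lt_trans qr.
      by rewrite /qf lerDr.
    + by right.
  have gp : 0 < g p by rewrite gE expR_gt0.
  have /andP[bl1 bl2] : al <= b0 + b1 * p.1.1 <= 2 * al by apply: bl; rewrite p1.
  set b := b0 + b1 * p.1.1 in bl1 bl2.
  have b2 : 4 * b ^+ 2 * (3 * qf p) <= b1 * qf p.
    have : b ^+ 2 <= (2 * al) ^+ 2 by rewrite ler_sqr ?nnegrE //; lra.
    move=> h; have := ler_wpM2r (qf0 p) h; rewrite /b1; lra.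
  have hga Z : Z <= N%:R + 1 + `|c| -> 2 * b * Z < ga.
    move=> hZ; have bp : 0 < b by lra.
    have h1 : 2 * b * Z <= 2 * b * (N%:R + 1 + `|c|) by rewrite ler_wpM2l // mulr_ge0 // ltW.
    have h2 : b * (N%:R + 1 + `|c|) <= 2 * al * (N%:R + 1 + `|c|).
      by rewrite ler_wpM2r // !addr_ge0.
    by rewrite /ga; lra.
  have cN := ler_norm c.
  move: py; rewrite le_eqVlt => /orP[/eqP/esym py|py].
  + have := gauss_defect_bd c a b0 b1 ga 0 py; rewrite -/g -/b subr0 => hd.
    exists (D * (g p * (b1 * sqn p.1.2 + ga - 4 * b ^+ 2 * sqn p.1.2
       - 2 * b * (N%:R + 1 + c)))); last exact: defectZ.
    rewrite mulr_gt0 // mulr_gt0 //.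
    have : 2 * b * (N%:R + 1 + c) < ga by apply: hga; lra.
    have : 0 <= 4 * b ^+ 2 * sqn p.1.2 by rewrite mulr_ge0 // mulr_ge0 // sqr_ge0.
    by move: b2; rewrite /qf py expr0n /= addr0; lra.
  + have := gauss_defect_int c a b0 b1 ga 0 0 py; rewrite -/g -/b !subr0 => hd.
    exists (D * (g p * (b1 * (sqn p.1.2 + p.2 ^+ 2) + ga
       - 4 * b ^+ 2 * elliptic_form a p.1.2 p.2
       - 2 * b * (N%:R + 1 + c * p.2 / p.2)))); last exact: defectZ.
    rewrite mulr_gt0 // mulr_gt0 // mulfK ?gt_eqF //.
    have : 2 * b * (N%:R + 1 + c) < ga by apply: hga; lra.
    have hA := elliptic_le p.1.2 p.2 (ltW k0).
    have : 4 * b ^+ 2 * elliptic_form a p.1.2 p.2 <= 4 * b ^+ 2 * (3 * qf p).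
      by rewrite ler_wpM2l // mulr_ge0 // sqr_ge0.
    by move: b2; rewrite /qf; lra.
Qed.

End Uniqueness.

(** * Vanishing of the extended solution *)

Section Vanishing.
Context (R : realType) (N : nat).
Notation pt := (R * 'rV[R]_N * R)%type.
Implicit Types (p q : pt) (x : 'rV[R]_N).
Notation half v n B := (lattice v n (n * B).+1 n 0).

(** On a mesh 1 / (q0 n), the first n nodes in each direction fill a cube of side 1 / q0 in which
    [v] exceeds half its value at [p]. Its weight is the same for all [n], hence the restriction to
    multiples of [q0]. *)
Lemma lattice_lower (v : pt -> R) (B : nat) p :
  continuous v -> (forall q, 0 <= v q) -> 0 < v p -> (0 < B)%N ->
  exists (k : R) (q0 : nat), [/\ 0 < k, (0 < q0)%N &
    forall n, (0 < n)%N -> k <= half v (q0 * n)%N B p].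
Proof.
move=> cv v0 vp B0.
have vp2 : 0 < v p / 2 by rewrite divr_gt0.
have /cvgrPdist_le /(_ _ vp2) /nbhs_ballP [d /= d0 hd] := cv p.
pose q0 := (Num.trunc d^-1).+1.
have q0R : 0 < q0%:R :> R by rewrite ltr0n.
have qd : q0%:R^-1 < d.
  by rewrite -[d]invrK ltf_pV2 ?posrE ?invr_gt0 //; exact: truncnS_gt.
exists (q0%:R^-1 ^+ N.+1 * (v p / 2)), q0; split => //.
  by rewrite mulr_gt0 // exprn_gt0 // invr_gt0.
move=> n n0; have nR : 0 < n%:R :> R by rewrite ltr0n.
have qn : (n <= q0 * n)%N by rewrite leq_pmull.
have nK : (n <= (q0 * n * B).+1)%N.
  by apply: leqW; apply: (leq_trans qn); rewrite leq_pmulr.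
pose f := widen_ord nK.
pose g (j : {ffun 'I_N -> 'I_n}) : {ffun 'I_N -> 'I_(q0 * n)} :=
  [ffun i => widen_ord qn (j i)].
have finj : injective f by move=> k k' /(congr1 val) /= /val_inj.
have ginj : injective g.
  move=> j j' /ffunP E; apply/ffunP => i; have := E i; rewrite !ffunE.
  by move=> /(congr1 val) /= /val_inj.
have small (k : nat) : (k < n)%N -> `|k%:R / (q0 * n)%:R : R| < d.
  move=> kn; apply: lt_trans qd; rewrite ger0_norm ?divr_ge0 // natrM.
  rewrite ltr_pdivrMr ?mulr_gt0 // mulrA mulVf ?gt_eqF // mul1r.
  by rewrite ltr_nat.
have term (k : 'I_n) (j : {ffun 'I_N -> 'I_n}) :
    v p / 2 <= v (p + node R (q0 * n) 0 (f k) (fun i => g j i)).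
  set z := node _ _ _ _ _.
  suff : `|v p - v (p + z)| <= v p / 2 by rewrite ler_norml => /andP[]; lra.
  apply: hd; rewrite -ball_normE /= opprD addrA subrr sub0r normrN.
  apply: pt_norm_lt => /=.
  - by rewrite normrN; exact: small.
  - apply: le_lt_trans qd; apply: norm_le_coord => [|i]; first by rewrite invr_ge0.
    rewrite mxE /= ffunE /= subr0 ger0_norm ?divr_ge0 // natrM.
    rewrite ler_pdivrMr ?mulr_gt0 // mulrA mulVf ?gt_eqF // mul1r.
    by rewrite ler_nat ltnW.
  - by rewrite normr0.
rewrite /lattice.
have hS : (n%:R * (n ^ N)%:R) * (v p / 2) <=
    \sum_(k < (q0 * n * B).+1) \sum_(j : {ffun 'I_N -> 'I_(q0 * n)})
      v (p + node R (q0 * n) 0 k (fun i => j i)).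
  apply: (@le_trans _ _ (\sum_(k < n) \sum_(j : {ffun 'I_N -> 'I_n})
      v (p + node R (q0 * n) 0 (f k) (fun i => g j i)))).
    have <- : \sum_(k < n) \sum_(j : {ffun 'I_N -> 'I_n}) v p / 2 =
        n%:R * (n ^ N)%:R * (v p / 2).
      rewrite !sumr_const card_ffun !card_ord.
      by rewrite -[_ *+ n]mulr_natl -[_ *+ (n ^ N)]mulr_natl mulrA.
    by apply: ler_sum => k _; apply: ler_sum => j _.
  apply: le_trans (sum_inj_le (F := fun k : 'I_(q0 * n * B).+1 =>
    \sum_(j : {ffun 'I_N -> 'I_(q0 * n)}) v (p + node R (q0 * n) 0 k (fun i => j i)))
    finj _); last by move=> k; apply: sumr_ge0.
  apply: ler_sum => k _.
  exact: (sum_inj_le (F := fun j : {ffun 'I_N -> 'I_(q0 * n)} =>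
    v (p + node R (q0 * n) 0 (f k) (fun i => j i))) ginj).
have F0 : 0 <= ((q0 * n)%:R^-1 : R) ^+ N.+1 by rewrite exprn_ge0 // invr_ge0.
apply: le_trans (ler_wpM2l F0 hS).
rewrite [leRHS]mulrA ler_pM2r // natrM invfM exprMn natrX -exprS -mulrA.
by rewrite -exprMn mulVf ?gt_eqF // expr1n mulr1.
Qed.

(** Induction over time steps [t1], whose length depends only on [Ga]. The nodes look backwards, so
    the sums vanish at the start of each step. If [v] were positive at a point, its sums there would
    stay above [ka] for arbitrarily fine meshes, while the decay estimate puts them below [ka]:
    first [r] is fixed, then the mesh. *)
Lemma vanish (c : R) (a : 'rV[R]_N) (T tau : R) (B : nat) (v : pt -> R) :
  0 < ndy a -> 0 < c + 1 -> 0 < tau -> 0 < T -> T <= B%:R ->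
  solution c a T v -> (forall p, 0 <= v p) ->
  (forall q, q.1.1 <= 0 -> v q = 0) ->
  forall q, q.1.1 <= T - tau -> 0 <= q.2 -> v q = 0.
Proof.
move=> k0 c0 tau0 T0 TB v_sol v0 vpast.
have B0 : (0 < B)%N by rewrite -(ltr_nat R); apply: lt_le_trans TB.
have [C [Ga [C0 Ga0 hbd]]] := gaussian_bound k0 c0 tau0 T0 TB v_sol v0 vpast.
pose t1 : R := 1 / (48 * (Ga + 1)).
have t10 : 0 < t1 by rewrite divr_gt0 // mulr_gt0 // addr_gt0.
suff H k q : q.1.1 <= k%:R * t1 -> q.1.1 <= T - tau -> 0 <= q.2 -> v q = 0.
  move=> q qT q0; apply: (H (Num.trunc (T / t1)).+1 q) => //.
  have := truncnS_gt (T / t1); rewrite ltr_pdivrMr // => h; lra.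
elim: k q => [|k ih] q qk qT q0.
  by apply: vpast; rewrite mul0r in qk.
have [qk'|qk'] := leP q.1.1 (k%:R * t1); first exact: ih.
apply/eqP/negPn/negP => vq0.
have vq : 0 < v q by rewrite lt_neqAle eq_sym vq0 v0.
have [ka [q1 [ka0 q10 hlow]]] := lattice_lower v_sol.1 v0 vq B0.
have kt0 : 0 <= k%:R * t1 by rewrite mulr_ge0 // ltW.
case: q => -[t x] y /= in qk qT q0 qk' vq hlow vq0 *.
set Phi := expR (2 * (Ga + 1) * (sqn x + y ^+ 2)
     + (4 * (Ga + 1) * (N%:R + 1 + `|c|) + 1) * T).
have Phi0 : 0 < Phi by exact: expR_gt0.
(* Contains the point in the box and, by exp(r^2) >= 1 + r^2, makes C exp(- r^2) Phi smaller than
   [ka]. *)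
pose r := 1 + `|x| + y + C * Phi / ka.
have CP : 0 <= C * Phi / ka by rewrite divr_ge0 ?mulr_ge0 ?ltW.
have nx := normr_ge0 x.
have r1 : 1 <= r by rewrite /r; lra.
have [n0 hn0] := hbd r (le_trans ler01 r1).
pose n := (q1 * n0.+1)%N.
have n0n : (n0 <= n)%N by apply: (leq_trans (leqnSn n0)); rewrite leq_pmull.
have n_gt0 : (0 < n)%N by rewrite muln_gt0 q10.
have hk := hlow n0.+1 isT; rewrite -/n in hk.
have t12 : 0 <= k%:R * t1 <= t by rewrite kt0 ltW.
have tT : t <= T by lra.
have tt1 : t <= k%:R * t1 + 1 / (48 * (Ga + 1)).
  by rewrite -/t1; move: qk; rewrite -natr1 mulrDl mul1r.
have w0 x' y' : 0 <= y' -> half v n B (k%:R * t1, x', y') = 0.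
  move=> y'0; apply: lattice_past => q qt q2; apply: ih => //=.
    by apply: (le_trans qt) => /=; lra.
  by rewrite q2.
have wb t' x' y' : k%:R * t1 <= t' <= t -> `|x'| <= r -> 0 <= y' <= r ->
    half v n B (t', x', y') <= C * expR (Ga * (sqn x' + y' ^+ 2)).
  move=> /andP[h1 h2] hx hy; apply: hn0 => //; apply/andP; split.
    exact: le_trans h1.
  exact: le_trans qT.
have xr : `|x| <= r by rewrite /r; lra.
have yr : 0 <= y <= r by rewrite q0 /r; lra.
have := gaussian_decay k0 c0 (lattice_solution n (n * B).+1 n 0 v_sol) C0 Ga0 t12 tT tt1 w0 wb xr yr.
rewrite -/Phi => hub.
have : C * expR (- r ^+ 2) * Phi < ka.
  have e1 : C * Phi / ka < expR (r ^+ 2).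
    apply: lt_le_trans (expR_ge1Dx _).
    have : r * 1 <= r * r by rewrite ler_wpM2l // (le_trans ler01).
    by rewrite -expr2 mulr1 {1}/r; lra.
  rewrite ltr_pdivrMr // in e1.
  by rewrite expRN mulrAC ltr_pdivrMr ?expR_gt0 // [ka * _]mulrC.
by lra.
Qed.

End Vanishing.

Theorem theorem5p2 (R : realType) (N : nat) (c : R) (a : 'rV[R]_N)
    (hc : 0 < c + 1) (ha : enorm a < 1) (T : R) (hT : 0 < T)
    (u : R * 'rV[R]_N * R -> R)
    (u_C12 : C12 `]0, T] u)
    (u_C0 : {within cyl `[0, T], continuous u})
    (u_ge0 : forall p, cyl `[0, T] p -> 0 <= u p)
    (u_eq : solves_parabolic c a `]0, T] u)
    (u_init : forall (x : 'rV[R]_N) (y : R), 0 <= y -> u (0, x, y) = 0)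
    (u_neumann : neumann c `]0, T] u) :
  forall p, cyl `[0, T] p -> u p = 0.
Proof.
have k0 : 0 < ndy a.
  rewrite /ndy subr_gt0 -(@ltr_sqrt _ _ 1) // sqrtr1; exact: ha.
have v_sol := extension_solution hT u_C12 u_C0 u_eq u_init u_neumann.
have v_ge0 := extension_ge0 hT u_ge0.
have v_past := extension_past hT u_init.
have TB : T <= (Num.trunc T).+1%:R by rewrite ltW // truncnS_gt.
have H tau q : 0 < tau -> q.1.1 <= T - tau -> 0 <= q.2 -> extension T u q = 0.
  by move=> tau0; apply: (vanish k0 hc tau0 hT TB v_sol v_ge0 v_past).
move=> p [/=]; rewrite in_itv /= => pT p0.
rewrite -(extension_id _ pT p0); have /andP[_ pT'] := pT.
(* Vanishing is available only up to [T - tau]; the final time is reached by continuity from the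
   past. *)
have lim : extension T u (p + h *: - dir_t R N) @[h --> (0 : R)^'+] --> extension T u p.
  move=> A hA; have hA' : nbhs p (extension T u @^-1` A) := v_sol.1 p A hA.
  exact: (near_line (- dir_t R N) hA').
apply: (at_right_unique lim); apply: cvg_near_cst; near=> h.
have h0 : 0 < h by near: h; exact: nbhs_right_gt.
apply: (H h) => //=; last by rewrite oppr0 scaler0 addr0.
by rewrite /GRing.scale /= mulrN1 lerD2r.
Unshelve. all: by end_near. Qed.
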